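(* Let $\mathfrak g$ be a classical Lie superalgebra, and let $\tilde{\mathcal C}$ and $\mathcal C$ be abelian subcategories of $\mathfrak g\text{-Mod}$ and $\mathfrak g_{\bar 0}\text{-Mod}$, respectively. Assume that (i) $\mathrm{Ind}$, $\mathrm{Coind}$ and $\mathrm{Res}$ restrict to well-defined functors between $\mathcal C$ and $\tilde{\mathcal C}$; (ii) $\mathcal C$ has enough injective and projective modules; (iii) $\mathrm{gl.dim}\,\mathcal C<\infty$. Then $\mathrm{fin.dim}\,\tilde{\mathcal C}=\mathrm{gl.dim}\,\mathcal C$.
   Context: A finite-dimensional complex Lie superalgebra $\mathfrak g=\mathfrak g_{\bar 0}\oplus\mathfrak g_{\bar 1}$ is classical if $\mathfrak g_{\bar 0}$ is a reductive Lie algebra and $\mathfrak g_{\bar 1}$ is a completely reducible $\mathfrak g_{\bar 0}$-module under the adjoint action. $\mathfrak g\text{-Mod}$ and $\mathfrak g_{\bar 0}\text{-Mod}$ are the categories of all $\mathfrak g$-modules (supermodules) and all $\mathfrak g_{\bar 0}$-modules. $\mathrm{Res}$ is restriction from $\mathfrak g$ to $\mathfrak g_{\bar 0}$, $\mathrm{Ind}=U(\mathfrak g)\otimes_{U(\mathfrak g_{\bar 0})}-$ and $\mathrm{Coind}=\mathrm{Hom}_{U(\mathfrak g_{\bar 0})}(U(\mathfrak g),-)$. For an abelian category $\mathcal A$ with enough projective and injective objects, $\mathrm{pd}_{\mathcal A}M$ denotes the projective dimension of $M\in\mathcal A$, $\mathrm{gl.dim}\,\mathcal A=\sup_{M\in\mathcal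 A}\mathrm{pd}_{\mathcal A}M$, and the finitistic dimension is $\mathrm{fin.dim}\,\mathcal A=\sup\{\mathrm{pd}_{\mathcal A}M: M\in\mathcal A,\ \mathrm{pd}_{\mathcal A}M<\infty\}$. *)

(* Defs.v *)
From HB Require Import structures.
From mathcomp Require Import all_boot all_order all_algebra.
From mathcomp Require Import complex.
From mathcomp Require Import boolp classical_sets reals constructive_ereal ereal.
Set Implicit Arguments.
Unset Strict Implicit.
Unset Printing Implicit Defensive.
Import Order.TTheory GRing.Theory Num.Theory.
Local Open Scope ring_scope.
Local Open Scope classical_set_scope.
Local Open Scope quotient_scope.

(* The parity group Z/2 is [bool]: [false] is even, [true] is odd and [(+)]   *)
(* is the addition.                                                           *)

Definition is_grading (K : numFieldType) (V : lmodType K) (P : bool -> set V) : Prop :=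
  [/\ forall a, P a 0,
      forall a c v w, P a v -> P a w -> P a (c *: v + w),
      forall v, exists v0 v1, [/\ P false v0, P true v1 & v = v0 + v1]
    & forall v, P false v -> P true v -> v = 0].

(* [vectType] makes these finite-dimensional. *)
Record lieSuper (K : numFieldType) := LieSuper {
  lie_sort :> vectType K;
  lie_part : bool -> {vspace lie_sort};
  lbr : lie_sort -> lie_sort -> lie_sort;
  lie_part_sum : (lie_part false + lie_part true)%VS = fullv;
  lie_part_cap : (lie_part false :&: lie_part true)%VS = 0%VS;
  lbr_linearl : forall c x y z, lbr (c *: x + y) z = c *: lbr x z + lbr y z;
  lbr_linearr : forall c x y z, lbr x (c *: y + z) = c *: lbr x y + lbr x z;
  lbr_part : forall a b x y, x \in lie_part a -> y \in lie_part b ->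
    lbr x y \in lie_part (a (+) b);
  lbr_skew : forall a b x y, x \in lie_part a -> y \in lie_part b ->
    lbr x y = - ((-1) ^+ (a && b) *: lbr y x);
  lbr_jacobi : forall a b x y z, x \in lie_part a -> y \in lie_part b ->
    lbr x (lbr y z) = lbr (lbr x y) z + (-1) ^+ (a && b) *: lbr y (lbr x z)
}.
Arguments lie_part {K} l.
Arguments lbr {K l}.

(* The even part, as a purely even Lie superalgebra. *)
Section EvenPart.
Variables (K : numFieldType) (L : lieSuper K).
Let g0 := lie_part L false.
Let part0 (a : bool) : {vspace subvs_of g0} := if a then 0%VS else fullv.
Let br0 (x y : subvs_of g0) : subvs_of g0 := vsproj g0 (lbr (vsval x) (vsval y)).

Fact even_part_brE x y : vsval (br0 x y) = lbr (vsval x) (vsval y).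
Proof. by rewrite /br0 vsprojK // (lbr_part (a:=false) (b:=false)) ?subvsP. Qed.

Fact even_part_mem a x : (x \in part0 a) = (vsval x \in lie_part L a).
Proof.
case: a; rewrite /= ?memvf ?subvsP // memv0.
apply/eqP/idP => [->|xo]; first by rewrite linear0 mem0v.
apply: subvs_inj; rewrite linear0; apply/eqP.
by rewrite -memv0 -(lie_part_cap L) memv_cap subvsP.
Qed.

Fact even_part_sum : (part0 false + part0 true)%VS = fullv.
Proof. by rewrite /= addv0. Qed.
Fact even_part_cap : (part0 false :&: part0 true)%VS = 0%VS.
Proof. by rewrite /= capv0. Qed.
Fact even_part_linearl c x y z : br0 (c *: x + y) z = c *: br0 x z + br0 y z.
Proof. by apply: subvs_inj; rewrite even_part_brE !linearP /= lbr_linearl !even_part_brE. Qed.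
Fact even_part_linearr c x y z : br0 x (c *: y + z) = c *: br0 x y + br0 x z.
Proof. by apply: subvs_inj; rewrite even_part_brE !linearP /= lbr_linearr !even_part_brE. Qed.
Fact even_part_part a b x y :
  x \in part0 a -> y \in part0 b -> br0 x y \in part0 (a (+) b).
Proof. by rewrite !even_part_mem even_part_brE; apply: lbr_part. Qed.
Fact even_part_skew a b x y : x \in part0 a -> y \in part0 b ->
  br0 x y = - ((-1) ^+ (a && b) *: br0 y x).
Proof.
rewrite !even_part_mem => xa yb; apply: subvs_inj.
by rewrite -scalerN linearZ linearN /= !even_part_brE scalerN (lbr_skew xa yb).
Qed.
Fact even_part_jacobi a b x y z : x \in part0 a -> y \in part0 b ->
  br0 x (br0 y z) = br0 (br0 x y) z + (-1) ^+ (a && b) *: br0 y (br0 x z).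
Proof.
rewrite !even_part_mem => xa yb; apply: subvs_inj.
by rewrite linearD linearZ /= !even_part_brE (lbr_jacobi _ xa yb).
Qed.

Definition even_part : lieSuper K :=
  LieSuper even_part_sum even_part_cap even_part_linearl even_part_linearr
    even_part_part even_part_skew even_part_jacobi.
End EvenPart.

(* Complete reducibility of [V], a submodule of [L] for the adjoint action of *)
(* the even part.                                                             *)
Definition ad_even_stable (K : numFieldType) (L : lieSuper K) (W : {vspace L}) : Prop :=
  forall x w, x \in lie_part L false -> w \in W -> lbr x w \in W.

Definition ad_even_completely_reducible (K : numFieldType) (L : lieSuper K)
    (V : {vspace L}) : Prop :=
  forall W : {vspace L}, (W <= V)%VS -> ad_even_stable W ->
  exists W' : {vspace L},
    [/\ ad_even_stable W', (W + W' = V)%VS & (W :&: W' = 0)%VS].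

(* A Lie algebra is reductive when its adjoint representation is completely   *)
(* reducible.                                                                 *)
Definition classical (K : numFieldType) (L : lieSuper K) : Prop :=
  ad_even_completely_reducible (lie_part L false) /\
  ad_even_completely_reducible (lie_part L true).

Record supermod (K : numFieldType) (L : lieSuper K) := Supermod {
  smod_sort :> lmodType K;
  smod_part : bool -> set smod_sort;
  smod_act : L -> smod_sort -> smod_sort;
  smod_grading : is_grading smod_part;
  smod_actl : forall c x y m,
    smod_act (c *: x + y) m = c *: smod_act x m + smod_act y m;
  smod_actr : forall c x m n,
    smod_act x (c *: m + n) = c *: smod_act x m + smod_act x n;
  smod_act_part : forall a b x m, x \in lie_part L a -> smod_part b m ->
    smod_part (a (+) b) (smod_act x m);
  smod_act_lbr : forall a b x y m, x \in lie_part L a -> y \in lie_part L b ->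
    smod_act (lbr x y) m =
      smod_act x (smod_act y m) - (-1) ^+ (a && b) *: smod_act y (smod_act x m)
}.
Arguments smod_part {K L} s.
Arguments smod_act {K L s}.

(* Morphisms of supermodules preserve the parity: with them supermodules form *)
(* an abelian category.                                                       *)
Record is_shom (K : numFieldType) (L : lieSuper K) (M N : supermod L) (f : M -> N) : Prop :=
  IsShom {
    shom_linear : forall c m m', f (c *: m + m') = c *: f m + f m';
    shom_part : forall a m, smod_part M a m -> smod_part N a (f m);
    shom_act : forall x m, f (smod_act x m) = smod_act x (f m)
  }.

Definition smod_iso (K : numFieldType) (L : lieSuper K) (M N : supermod L) : Prop :=
  exists2 f : M -> N, is_shom f & bijective f.

(* Restriction to the even part. Modules over the even part are supermodules  *)
(* as well, so that [Res] keeps the grading.                                  *)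
Section Restriction.
Variables (K : numFieldType) (L : lieSuper K) (N : supermod L).
Let act0 (x : even_part L) : N -> N := smod_act (vsval x).

Fact Res_actl c x y m : act0 (c *: x + y) m = c *: act0 x m + act0 y m.
Proof. by rewrite /act0 linearP smod_actl. Qed.
Fact Res_actr c x m n : act0 x (c *: m + n) = c *: act0 x m + act0 x n.
Proof. exact: smod_actr. Qed.
Fact Res_act_part a b x m : x \in lie_part (even_part L) a ->
  smod_part N b m -> smod_part N (a (+) b) (act0 x m).
Proof. by rewrite even_part_mem; apply: smod_act_part. Qed.
Fact Res_act_lbr a b x y m :
    x \in lie_part (even_part L) a -> y \in lie_part (even_part L) b ->
  act0 (lbr x y) m = act0 x (act0 y m) - (-1) ^+ (a && b) *: act0 y (act0 x m).
Proof.
by rewrite !even_part_mem /act0 even_part_brE; apply: smod_act_lbr.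
Qed.

Definition Res : supermod (even_part L) :=
  Supermod (smod_grading N) Res_actl Res_actr Res_act_part Res_act_lbr.
End Restriction.

(* The universal enveloping algebra, by generators and relations: [ueq] is    *)
(* the smallest congruence making the terms over [K] and [L] an associative   *)
(* unital K-algebra in which the generators satisfy                           *)
(*            [x, y] = x y - (-1)^(|x||y|) y x.                               *)
Section EnvelopingAlgebra.
Variables (K : numFieldType) (L : lieSuper K).

Inductive uterm : Type :=
  | UConst of K
  | UGen of L
  | UAdd of uterm & uterm
  | UMul of uterm & uterm.

Inductive ueq : uterm -> uterm -> Prop :=
  | ueq_refl t : ueq t t
  | ueq_sym s t : ueq s t -> ueq t s
  | ueq_trans s t u : ueq s t -> ueq t u -> ueq s u
  | ueq_add s s' t t' : ueq s s' -> ueq t t' -> ueq (UAdd s t) (UAdd s' t')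
  | ueq_mul s s' t t' : ueq s s' -> ueq t t' -> ueq (UMul s t) (UMul s' t')
  | ueq_addA s t u : ueq (UAdd s (UAdd t u)) (UAdd (UAdd s t) u)
  | ueq_addC s t : ueq (UAdd s t) (UAdd t s)
  | ueq_add0 t : ueq (UAdd (UConst 0) t) t
  | ueq_addN t : ueq (UAdd (UMul (UConst (-1)) t) t) (UConst 0)
  | ueq_mulA s t u : ueq (UMul s (UMul t u)) (UMul (UMul s t) u)
  | ueq_mul1l t : ueq (UMul (UConst 1) t) t
  | ueq_mul1r t : ueq (UMul t (UConst 1)) t
  | ueq_mulDl s t u : ueq (UMul (UAdd s t) u) (UAdd (UMul s u) (UMul t u))
  | ueq_mulDr s t u : ueq (UMul s (UAdd t u)) (UAdd (UMul s t) (UMul s u))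
  | ueq_constD c d : ueq (UConst (c + d)) (UAdd (UConst c) (UConst d))
  | ueq_constM c d : ueq (UConst (c * d)) (UMul (UConst c) (UConst d))
  | ueq_constC c t : ueq (UMul (UConst c) t) (UMul t (UConst c))
  | ueq_genP c x y :
      ueq (UGen (c *: x + y)) (UAdd (UMul (UConst c) (UGen x)) (UGen y))
  | ueq_lbr a b x y : x \in lie_part L a -> y \in lie_part L b ->
      ueq (UGen (lbr x y))
          (UAdd (UMul (UGen x) (UGen y))
                (UMul (UConst (- (-1) ^+ (a && b))) (UMul (UGen y) (UGen x)))).

HB.instance Definition _ := gen_eqMixin uterm.
HB.instance Definition _ := gen_choiceMixin uterm.

Fact ueqb_refl : reflexive (fun s t => `[< ueq s t >]).
Proof. by move=> t; apply/asboolP/ueq_refl. Qed.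
Fact ueqb_sym : symmetric (fun s t => `[< ueq s t >]).
Proof. by move=> s t; apply/asboolP/asboolP; apply: ueq_sym. Qed.
Fact ueqb_trans : transitive (fun s t => `[< ueq s t >]).
Proof. by move=> t s u /asboolP ? /asboolP ?; apply/asboolP/(@ueq_trans _ t). Qed.
Canonical ueq_equiv := EquivRel _ ueqb_refl ueqb_sym ueqb_trans.

Definition env := {eq_quot ueq_equiv}.
HB.instance Definition _ := EqQuotient.on env.
HB.instance Definition _ := Choice.on env.

Definition upi (t : uterm) : env := \pi_env t.

Lemma upiP s t : upi s = upi t <-> ueq s t.
Proof.
split=> [/eqmodP /asboolP //|st]; apply/eqmodP; exact/asboolP.
Qed.
Lemma upi_repr (u : env) : upi (repr u) = u.
Proof. exact: reprK. Qed.
Lemma env_ind (P : env -> Prop) : (forall t, P (upi t)) -> forall u, P u.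
Proof. by move=> Pt u; rewrite -(upi_repr u). Qed.
Lemma ueq_repr t : ueq (repr (upi t)) t.
Proof. by apply/upiP; rewrite upi_repr. Qed.

Definition econst (c : K) : env := upi (UConst c).
Definition egen (x : L) : env := upi (UGen x).
Definition eadd (u v : env) : env := upi (UAdd (repr u) (repr v)).
Definition emul (u v : env) : env := upi (UMul (repr u) (repr v)).

Lemma upiD s t : upi (UAdd s t) = eadd (upi s) (upi t).
Proof. by apply/upiP/ueq_sym/ueq_add; apply: ueq_repr. Qed.
Lemma upiM s t : upi (UMul s t) = emul (upi s) (upi t).
Proof. by apply/upiP/ueq_sym/ueq_mul; apply: ueq_repr. Qed.

Fact eaddA : associative eadd.
Proof.
by elim/env_ind=> s; elim/env_ind=> t; elim/env_ind=> u;
  rewrite -!upiD; apply/upiP/ueq_addA.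
Qed.
Fact eaddC : commutative eadd.
Proof.
by elim/env_ind=> s; elim/env_ind=> t; rewrite -!upiD; apply/upiP/ueq_addC.
Qed.
Fact eadd0 : left_id (econst 0) eadd.
Proof. by elim/env_ind=> s; rewrite -!upiD; apply/upiP/ueq_add0. Qed.
Fact eaddN : left_inverse (econst 0) (emul (econst (-1))) eadd.
Proof. by elim/env_ind=> s; rewrite -!upiM -!upiD; apply/upiP/ueq_addN. Qed.
HB.instance Definition _ := GRing.isZmodule.Build env eaddA eaddC eadd0 eaddN.

Fact emulA : associative emul.
Proof.
by elim/env_ind=> s; elim/env_ind=> t; elim/env_ind=> u;
  rewrite -!upiM; apply/upiP/ueq_mulA.
Qed.
Fact emul1 : left_id (econst 1) emul.
Proof. by elim/env_ind=> s; rewrite -!upiM; apply/upiP/ueq_mul1l. Qed.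
Fact emulr1 : right_id (econst 1) emul.
Proof. by elim/env_ind=> s; rewrite -!upiM; apply/upiP/ueq_mul1r. Qed.
Fact emulDl : left_distributive emul eadd.
Proof.
by elim/env_ind=> s; elim/env_ind=> t; elim/env_ind=> u;
  rewrite -upiD -!upiM -upiD; apply/upiP/ueq_mulDl.
Qed.
Fact emulDr : right_distributive emul eadd.
Proof.
by elim/env_ind=> s; elim/env_ind=> t; elim/env_ind=> u;
  rewrite -upiD -!upiM -upiD; apply/upiP/ueq_mulDr.
Qed.
HB.instance Definition _ :=
  GRing.Zmodule_isPzRing.Build env emulA emul1 emulr1 emulDl emulDr.

Inductive env_part : bool -> env -> Prop :=
  | env_part_const c : env_part false (econst c)
  | env_part_gen a x : x \in lie_part L a -> env_part a (egen x)
  | env_part_add a u v : env_part a u -> env_part a v -> env_part a (u + v)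
  | env_part_mul a b u v :
      env_part a u -> env_part b v -> env_part (a (+) b) (u * v).

Lemma env_gen_ind (P : env -> Prop) :
  (forall c, P (econst c)) -> (forall x, P (egen x)) ->
  (forall u v, P u -> P v -> P (u + v)) ->
  (forall u v, P u -> P v -> P (u * v)) -> forall u, P u.
Proof.
move=> Pc Pg PD PM; elim/env_ind; elim=> // s Ps t Pt.
  by rewrite upiD; apply: PD.
by rewrite upiM; apply: PM.
Qed.

Lemma econstD c d : econst (c + d) = econst c + econst d.
Proof. by rewrite /GRing.add /= -upiD; apply/upiP/ueq_constD. Qed.
Lemma econstM c d : econst (c * d) = econst c * econst d.
Proof. by rewrite /GRing.mul /= -upiM; apply/upiP/ueq_constM. Qed.
Lemma econstC c u : econst c * u = u * econst c.
Proof.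
by elim/env_ind: u => t; rewrite /GRing.mul /= -!upiM; apply/upiP/ueq_constC.
Qed.
Lemma econstN1 u : econst (-1) * u = - u.
Proof. by []. Qed.
Lemma egenP c x y : egen (c *: x + y) = econst c * egen x + egen y.
Proof.
by rewrite /GRing.mul /GRing.add /= -upiM -upiD; apply/upiP/ueq_genP.
Qed.
Lemma egen_lbr a b x y : x \in lie_part L a -> y \in lie_part L b ->
  egen (lbr x y) = egen x * egen y - econst ((-1) ^+ (a && b)) * (egen y * egen x).
Proof.
move=> xa yb; rewrite -econstN1 [_ * (econst _ * _)]mulrA -econstM mulN1r.
rewrite /GRing.mul /GRing.add /= -(upiM (UGen y)) -(upiM (UGen x)) -upiM -upiD.
exact/upiP/ueq_lbr.
Qed.
End EnvelopingAlgebra.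
Arguments UConst {K} L.
Arguments econst {K} L.
Arguments ueq {K L}.
Arguments upi {K L}.

Lemma additive_at0 (V W : zmodType) (f : V -> W) :
  (forall u v, f (u + v) = f u + f v) -> f 0 = 0.
Proof. by move=> fD; apply: (addrI (f 0)); rewrite -fD !addr0. Qed.

(* The parity involution of a graded space; used in proofs only. *)
Lemma parity_invol (K : numFieldType) (V : lmodType K) (P : bool -> set V) :
  is_grading P -> exists s : V -> V,
    [/\ forall c v w, s (c *: v + w) = c *: s v + s w,
        forall a v, P a v -> s v = (-1) ^+ a *: v
      & forall a v, P a (2^-1 *: (v + (-1) ^+ a *: s v))].
Proof.
case=> P0 PP Pdec Pcap.
have PD a v w : P a v -> P a w -> P a (v + w).
  by move=> av aw; rewrite -[v]scale1r; apply: PP.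
have PZ a c v : P a v -> P a (c *: v).
  by move=> av; rewrite -[_ *: _]addr0; apply: PP.
have PN a v : P a v -> P a (- v) by rewrite -scaleN1r; apply: PZ.
pose p0 v := projT1 (cid (Pdec v)).
pose p1 v := projT1 (cid (projT2 (cid (Pdec v)))).
have pP v : [/\ P false (p0 v), P true (p1 v) & v = p0 v + p1 v].
  exact: projT2 (cid (projT2 (cid (Pdec v)))).
have uniq v0 v1 w0 w1 : P false v0 -> P true v1 -> P false w0 -> P true w1 ->
    v0 + v1 = w0 + w1 -> v0 = w0 /\ v1 = w1.
  move=> V0 V1 W0 W1 e.
  have e' : v0 - w0 = w1 - v1.
    by apply/eqP; rewrite subr_eq addrAC eq_sym subr_eq e addrC.
  have z : v0 - w0 = 0.
    by apply: Pcap; [apply/PD/PN | rewrite e'; apply/PD/PN].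
  split; first by apply/eqP; rewrite -subr_eq0 z.
  by apply/eqP; rewrite eq_sym -subr_eq0 -e' z.
exists (fun v => p0 v - p1 v); split=> [c v w|a v av|a v].
- have [v0 v1 ev] := pP v; have [w0 w1 ew] := pP w.
  have [u0 u1 eu] := pP (c *: v + w).
  have [-> ->] : p0 (c *: v + w) = c *: p0 v + p0 w /\
                 p1 (c *: v + w) = c *: p1 v + p1 w.
    apply: uniq => //; [exact: PP | exact: PP |].
    by rewrite -eu {1}ev {1}ew scalerDr addrACA.
  by rewrite scalerBr opprD addrACA.
- have [v0 v1 ev] := pP v.
  have [e0 e1] : p0 v = (if a then 0 else v) /\ p1 v = (if a then v else 0).
    by case: a av => av; apply: uniq => //; rewrite -ev ?addr0 ?add0r.
  by case: a {av} e0 e1 => -> ->; rewrite ?sub0r ?subr0 ?scaleN1r ?scale1r.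
- have [v0 v1 ev] := pP v; rewrite {1}ev.
  have n2 : 2%:R != 0 :> K by rewrite pnatr_eq0.
  case: a; rewrite ?scaleN1r ?scale1r ?opprB.
    by rewrite addrC addrA subrK -mulr2n -scaler_nat scalerA mulVf ?scale1r.
  by rewrite addrACA subrr addr0 -mulr2n -scaler_nat scalerA mulVf ?scale1r.
Qed.

Lemma grading_sign (K : numFieldType) (V : lmodType K) (v : V) : v = - v -> v = 0.
Proof.
move=> e; apply/eqP; have := scaler_eq0 2 v.
by rewrite scaler_nat mulr2n {2}e subrr eqxx pnatr_eq0.
Qed.

Lemma lie_grading (K : numFieldType) (L : lieSuper K) :
  is_grading (fun a x => x \in lie_part L a : Prop).
Proof.
split=> [a|a c v w av aw|v|v v0 v1].
- exact: mem0v.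
- by rewrite memvD // memvZ.
- have /memv_addP [v0 h0 [v1 h1 ->]] : v \in (lie_part L false + lie_part L true)%VS.
    by rewrite lie_part_sum memvf.
  by exists v0, v1.
- by apply/eqP; rewrite -memv0 -(lie_part_cap L) memv_cap v0 v1.
Qed.

Lemma econst1 (K : numFieldType) (L : lieSuper K) : econst L 1 = 1.
Proof. by []. Qed.

Section EnvInclusion.
Variables (K : numFieldType) (L : lieSuper K).

Fixpoint uterm_incl (t : uterm (even_part L)) : uterm L :=
  match t with
  | UConst c => UConst L c
  | UGen x => UGen (vsval x : L)
  | UAdd s t => UAdd (uterm_incl s) (uterm_incl t)
  | UMul s t => UMul (uterm_incl s) (uterm_incl t)
  end.

Fact ueq_incl s t : ueq s t -> ueq (uterm_incl s) (uterm_incl t).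
Proof.
elim=> {s t}; try by constructor.
- by move=> s t u _ st _ tu; apply: ueq_trans st tu.
- move=> a b x y; rewrite !even_part_mem => xa yb.
  by rewrite /= even_part_brE; apply: ueq_lbr.
Qed.

Definition env_incl (u : env (even_part L)) : env L := upi (uterm_incl (repr u)).

Lemma env_incl_pi t : env_incl (upi t) = upi (uterm_incl t).
Proof. by apply/upiP/ueq_incl/ueq_repr. Qed.
Lemma env_incl_const c : env_incl (econst _ c) = econst L c.
Proof. exact: env_incl_pi. Qed.
Lemma env_incl_gen x : env_incl (egen x) = egen (vsval x : L).
Proof. exact: env_incl_pi. Qed.
Lemma env_inclD u v : env_incl (u + v) = env_incl u + env_incl v.
Proof.
elim/env_ind: u => s; elim/env_ind: v => t.
by rewrite {1}/GRing.add /= -upiD !env_incl_pi /= upiD.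
Qed.
Lemma env_inclM u v : env_incl (u * v) = env_incl u * env_incl v.
Proof.
elim/env_ind: u => s; elim/env_ind: v => t.
by rewrite {1}/GRing.mul /= -upiM !env_incl_pi /= upiM.
Qed.
End EnvInclusion.

Section EnvAction.
Variables (K : numFieldType) (L : lieSuper K) (M : supermod L).

Fixpoint uterm_act (t : uterm L) (m : M) : M :=
  match t with
  | UConst c => c *: m
  | UGen x => smod_act x m
  | UAdd s t => uterm_act s m + uterm_act t m
  | UMul s t => uterm_act s (uterm_act t m)
  end.

Lemma uterm_actP t c m n : uterm_act t (c *: m + n) = c *: uterm_act t m + uterm_act t n.
Proof.
elim: t c m n => [d|x|s IHs t IHt|s IHs t IHt] c m n /=.
- by rewrite scalerDr !scalerA mulrC.
- exact: smod_actr.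
- by rewrite IHs IHt scalerDr addrACA.
- by rewrite IHt IHs.
Qed.

Lemma uterm_actD t m n : uterm_act t (m + n) = uterm_act t m + uterm_act t n.
Proof. by have := uterm_actP t 1 m n; rewrite !scale1r. Qed.
Lemma uterm_act0 t : uterm_act t 0 = 0.
Proof. exact/additive_at0/uterm_actD. Qed.
Lemma uterm_actZ t c m : uterm_act t (c *: m) = c *: uterm_act t m.
Proof. by have := uterm_actP t c m 0; rewrite uterm_act0 !addr0. Qed.

Fact ueq_act s t : ueq s t -> uterm_act s =1 uterm_act t.
Proof.
elim=> {s t} //=.
- by move=> s t _ IH m; rewrite IH.
- by move=> s t u _ IH _ IH' m; rewrite IH.
- by move=> s s' t t' _ IH _ IH' m; rewrite IH IH'.
- by move=> s s' t t' _ IH _ IH' m; rewrite IH IH'.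
- by move=> s t u m; rewrite addrA.
- by move=> s t m; rewrite addrC.
- by move=> t m; rewrite scale0r add0r.
- by move=> t m; rewrite scaleN1r addNr scale0r.
- by move=> t m; rewrite scale1r.
- by move=> t m; rewrite scale1r.
- by move=> s t u m; rewrite uterm_actD.
- by move=> c d m; rewrite scalerDl.
- by move=> c d m; rewrite scalerA.
- by move=> c t m; rewrite uterm_actZ.
- by move=> c x y m; rewrite smod_actl.
- by move=> a b x y xa yb m; rewrite (smod_act_lbr _ xa yb) scaleNr.
Qed.

Definition env_act (u : env L) (m : M) : M := uterm_act (repr u) m.

Lemma env_act_pi t m : env_act (upi t) m = uterm_act t m.
Proof. exact/ueq_act/ueq_repr. Qed.
Lemma env_actP u c m n : env_act u (c *: m + n) = c *: env_act u m + env_act u n.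
Proof. exact: uterm_actP. Qed.
Lemma env_actDr u m n : env_act u (m + n) = env_act u m + env_act u n.
Proof. exact: uterm_actD. Qed.
Lemma env_actZ u c m : env_act u (c *: m) = c *: env_act u m.
Proof. exact: uterm_actZ. Qed.
Lemma env_act0r u : env_act u 0 = 0.
Proof. exact: uterm_act0. Qed.
Lemma env_act_const c m : env_act (econst L c) m = c *: m.
Proof. exact: env_act_pi. Qed.
Lemma env_act_gen x m : env_act (egen x) m = smod_act x m.
Proof. exact: env_act_pi. Qed.
Lemma env_actDl u v m : env_act (u + v) m = env_act u m + env_act v m.
Proof.
elim/env_ind: u => s; elim/env_ind: v => t.
by rewrite {1}/GRing.add /= -upiD !env_act_pi.
Qed.
Lemma env_actM u v m : env_act (u * v) m = env_act u (env_act v m).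
Proof.
elim/env_ind: u => s; elim/env_ind: v => t.
by rewrite {1}/GRing.mul /= -upiM !env_act_pi.
Qed.
End EnvAction.

Lemma env_act_parity (K : numFieldType) (L : lieSuper K) (M : supermod (even_part L))
    (s : M -> M) :
    (forall c v w, s (c *: v + w) = c *: s v + s w) ->
    (forall a v, smod_part M a v -> s v = (-1) ^+ a *: v) ->
  forall u m, s (env_act u m) = env_act u (s m).
Proof.
move=> slin sP.
have sD v w : s (v + w) = s v + s w by have := slin 1 v w; rewrite !scale1r.
have s0 : s 0 = 0 by exact: additive_at0 sD.
have sZ c v : s (c *: v) = c *: s v by have := slin c v 0; rewrite s0 !addr0.
elim/env_gen_ind=> [c|x|u v IHu IHv|u v IHu IHv] m.
- by rewrite !env_act_const sZ.
- rewrite !env_act_gen; have [_ _ dec _] := smod_grading M.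
  have [m0 [m1 [h0 h1 ->]]] := dec m.
  have aD w w' : smod_act x (w + w' : M) = smod_act x w + smod_act x w'.
    by have := smod_actr 1 x w w'; rewrite !scale1r.
  have a0 : smod_act x (0 : M) = 0.
    exact: additive_at0 aD.
  have aZ c w : smod_act x (c *: w : M) = c *: smod_act x w.
    by have := smod_actr c x w 0; rewrite a0 !addr0.
  have x0 : x \in lie_part (even_part L) false by rewrite memvf.
  rewrite sD !aD sD (sP _ _ h0) (sP _ _ h1) !aZ.
  by rewrite (sP _ _ (smod_act_part x0 h0)) (sP _ _ (smod_act_part x0 h1)).
- by rewrite !env_actDl sD IHu IHv.
- by rewrite !env_actM IHu IHv.
Qed.

(* The parity involution of the enveloping algebra; used in proofs only. *)
Section EnvParity.
Variables (K : numFieldType) (L : lieSuper K) (s : L -> L).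
Hypothesis slin : forall c v w, s (c *: v + w) = c *: s v + s w.
Hypothesis sP : forall a v, v \in lie_part L a -> s v = (-1) ^+ a *: v.

Fixpoint uterm_parity (t : uterm L) : uterm L :=
  match t with
  | UConst c => UConst L c
  | UGen x => UGen (s x)
  | UAdd s t => UAdd (uterm_parity s) (uterm_parity t)
  | UMul s t => UMul (uterm_parity s) (uterm_parity t)
  end.

Let egenZ c (x : L) : egen (c *: x) = econst L c * egen x.
Proof.
have e0 : egen 0 = 0 :> env L.
  have := egenP 1 (0 : L) 0; rewrite scaler0 addr0 => e.
  by apply: (addrI (egen 0)); rewrite addr0 {3}e econst1 mul1r.
by rewrite -[c *: x]addr0 egenP e0 addr0.
Qed.

Fact ueq_parity t t' : ueq t t' -> ueq (uterm_parity t) (uterm_parity t').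
Proof.
elim=> {t t'} /=; try by constructor.
- by move=> t t' u _ st _ tu; apply: ueq_trans st tu.
- by move=> c x y; rewrite slin; apply: ueq_genP.
- move=> a b x y xa yb.
  rewrite (sP (lbr_part xa yb)) (sP xa) (sP yb).
  apply/upiP; rewrite upiD !upiM.
  change (egen ((-1) ^+ (a (+) b) *: lbr x y) =
    egen ((-1) ^+ a *: x) * egen ((-1) ^+ b *: y) +
    econst L (- (-1) ^+ (a && b)) *
      (egen ((-1) ^+ b *: y) * egen ((-1) ^+ a *: x))).
  rewrite !egenZ (egen_lbr xa yb).
  have mm c d (u v : env L) : econst L c * u * (econst L d * v) = econst L (c * d) * (u * v).
    by rewrite econstM !mulrA -[econst L c * u * _]mulrA -[u * econst L d]econstC mulrA.
  have mN c d (Y : env L) :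
      - (econst L c * (econst L d * Y)) = econst L (- d) * (econst L c * Y).
    rewrite -econstN1 !mulrA -!econstM; congr (econst L _ * Y).
    by rewrite mulN1r !mulNr mulrC.
  by rewrite !mm [_ ^+ b * _ ^+ a]mulrC signr_addb mulrBr mN.
Qed.

Definition env_parity (u : env L) : env L := upi (uterm_parity (repr u)).

Lemma env_parity_pi t : env_parity (upi t) = upi (uterm_parity t).
Proof. by apply/upiP/ueq_parity/ueq_repr. Qed.
Lemma env_parityD u v : env_parity (u + v) = env_parity u + env_parity v.
Proof.
elim/env_ind: u => t; elim/env_ind: v => t'.
by rewrite {1}/GRing.add /= -upiD !env_parity_pi /= upiD.
Qed.
Lemma env_parityM u v : env_parity (u * v) = env_parity u * env_parity v.
Proof.
elim/env_ind: u => t; elim/env_ind: v => t'.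
by rewrite {1}/GRing.mul /= -upiM !env_parity_pi /= upiM.
Qed.
Lemma env_parity_incl u : env_parity (env_incl u) = env_incl u.
Proof.
elim/env_gen_ind: u => [c|x|u v IHu IHv|u v IHu IHv].
- by rewrite env_incl_const env_parity_pi.
- rewrite env_incl_gen env_parity_pi /=.
  by rewrite (sP (a:=false)) ?scale1r // subvsP.
- by rewrite env_inclD env_parityD IHu IHv.
- by rewrite env_inclM env_parityM IHu IHv.
Qed.
Lemma env_parity_part a u : env_part a u -> env_parity u = econst L ((-1) ^+ a) * u.
Proof.
elim=> {a u} [c|a x xa|a u v _ IHu _ IHv|a b u v _ IHu _ IHv].
- by rewrite env_parity_pi /= econst1 mul1r.
- by rewrite env_parity_pi /= -[LHS]/(egen (s x)) (sP xa) egenZ.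
- by rewrite env_parityD IHu IHv mulrDr.
- rewrite env_parityM IHu IHv signr_addb econstM !mulrA.
  by rewrite -[_ * u * _]mulrA -[u * _]econstC !mulrA.
Qed.
End EnvParity.

Lemma env_part_dec (K : numFieldType) (L : lieSuper K) (u : env L) :
  exists u0 u1, [/\ env_part false u0, env_part true u1 & u = u0 + u1].
Proof.
have z1 : env_part true (0 : env L).
  rewrite -(mul0r (egen (0 : L))); apply: (@env_part_mul _ _ false true).
    exact: (env_part_const L 0).
  by apply: env_part_gen; rewrite mem0v.
elim/env_gen_ind: u => [c|x|u v [u0 [u1 [U0 U1 ->]]] [v0 [v1 [V0 V1 ->]]]
                       |u v [u0 [u1 [U0 U1 ->]]] [v0 [v1 [V0 V1 ->]]]].
- by exists (econst L c), 0; split; rewrite ?addr0 //; apply: env_part_const.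
- have [_ _ dec _] := lie_grading L; have [x0 [x1 [X0 X1 ->]]] := dec x.
  exists (egen x0), (egen x1); split; [exact: env_part_gen | exact: env_part_gen |].
  by rewrite -[x0]scale1r egenP econst1 mul1r scale1r.
- exists (u0 + v0), (u1 + v1); split; [exact: env_part_add | exact: env_part_add |].
  by rewrite addrACA.
- exists (u0 * v0 + u1 * v1), (u0 * v1 + u1 * v0); split.
  + by apply: env_part_add; [exact: (env_part_mul U0 V0) | exact: (env_part_mul U1 V1)].
  + by apply: env_part_add; [exact: (env_part_mul U0 V1) | exact: (env_part_mul U1 V0)].
  + by rewrite mulrDl !mulrDr [u1 * v0 + _]addrC addrACA.
Qed.

(* The tensor product of a right module [T] and a left module [M] over [S],   *)
(* where [s : S] acts on [T] by right multiplication by [j s]: [teq] is the   *)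
(* smallest congruence making the terms an abelian group in which [TPure] is  *)
(* biadditive and balanced over [S].                                          *)
Section Tensor.
Variables (S : Type) (T : pzRingType) (M : zmodType).
Variables (j : S -> T) (act : S -> M -> M).

Inductive tterm : Type :=
  | TPure of T & M
  | TZero
  | TOpp of tterm
  | TAdd of tterm & tterm.

Inductive teq : tterm -> tterm -> Prop :=
  | teq_refl t : teq t t
  | teq_sym s t : teq s t -> teq t s
  | teq_trans s t u : teq s t -> teq t u -> teq s u
  | teq_opp t t' : teq t t' -> teq (TOpp t) (TOpp t')
  | teq_add s s' t t' : teq s s' -> teq t t' -> teq (TAdd s t) (TAdd s' t')
  | teq_addA s t u : teq (TAdd s (TAdd t u)) (TAdd (TAdd s t) u)
  | teq_addC s t : teq (TAdd s t) (TAdd t s)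
  | teq_add0 t : teq (TAdd TZero t) t
  | teq_addN t : teq (TAdd (TOpp t) t) TZero
  | teq_pureDl u v m : teq (TPure (u + v) m) (TAdd (TPure u m) (TPure v m))
  | teq_pureDr u m n : teq (TPure u (m + n)) (TAdd (TPure u m) (TPure u n))
  | teq_balanced u s m : teq (TPure (u * j s) m) (TPure u (act s m)).

HB.instance Definition _ := gen_eqMixin tterm.
HB.instance Definition _ := gen_choiceMixin tterm.

Fact teqb_refl : reflexive (fun s t => `[< teq s t >]).
Proof. by move=> t; apply/asboolP/teq_refl. Qed.
Fact teqb_sym : symmetric (fun s t => `[< teq s t >]).
Proof. by move=> s t; apply/asboolP/asboolP; apply: teq_sym. Qed.
Fact teqb_trans : transitive (fun s t => `[< teq s t >]).
Proof. by move=> t s u /asboolP ? /asboolP ?; apply/asboolP/(@teq_trans _ t). Qed.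
Canonical teq_equiv := EquivRel _ teqb_refl teqb_sym teqb_trans.

Definition tensor := {eq_quot teq_equiv}.
HB.instance Definition _ := EqQuotient.on tensor.
HB.instance Definition _ := Choice.on tensor.

Definition tpi (t : tterm) : tensor := \pi_tensor t.

Lemma tpiP s t : tpi s = tpi t <-> teq s t.
Proof.
by split=> [/eqmodP /asboolP //|st]; apply/eqmodP; exact/asboolP.
Qed.
Lemma tpi_repr (u : tensor) : tpi (repr u) = u.
Proof. exact: reprK. Qed.
Lemma tensor_rep (P : tensor -> Prop) : (forall t, P (tpi t)) -> forall u, P u.
Proof. by move=> Pt u; rewrite -(tpi_repr u). Qed.
Lemma teq_repr t : teq (repr (tpi t)) t.
Proof. by apply/tpiP; rewrite tpi_repr. Qed.

Definition tpure (u : T) (m : M) : tensor := tpi (TPure u m).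
Definition topp (x : tensor) : tensor := tpi (TOpp (repr x)).
Definition tadd (x y : tensor) : tensor := tpi (TAdd (repr x) (repr y)).

Lemma tpiN t : tpi (TOpp t) = topp (tpi t).
Proof. by apply/tpiP/teq_sym/teq_opp/teq_repr. Qed.
Lemma tpiD s t : tpi (TAdd s t) = tadd (tpi s) (tpi t).
Proof. by apply/tpiP/teq_sym/teq_add; apply: teq_repr. Qed.

Fact taddA : associative tadd.
Proof.
by elim/tensor_rep=> s; elim/tensor_rep=> t; elim/tensor_rep=> u;
  rewrite -!tpiD; apply/tpiP/teq_addA.
Qed.
Fact taddC : commutative tadd.
Proof.
by elim/tensor_rep=> s; elim/tensor_rep=> t; rewrite -!tpiD; apply/tpiP/teq_addC.
Qed.
Fact tadd0 : left_id (tpi TZero) tadd.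
Proof. by elim/tensor_rep=> s; rewrite -!tpiD; apply/tpiP/teq_add0. Qed.
Fact taddN : left_inverse (tpi TZero) topp tadd.
Proof. by elim/tensor_rep=> s; rewrite -tpiN -tpiD; apply/tpiP/teq_addN. Qed.
HB.instance Definition _ := GRing.isZmodule.Build tensor taddA taddC tadd0 taddN.

Lemma tpureDl u v m : tpure (u + v) m = tpure u m + tpure v m.
Proof. by rewrite /GRing.add /= -tpiD; apply/tpiP/teq_pureDl. Qed.
Lemma tpureDr u m n : tpure u (m + n) = tpure u m + tpure u n.
Proof. by rewrite {2}/GRing.add /= -tpiD; apply/tpiP/teq_pureDr. Qed.
Lemma tpure_balanced u s m : tpure (u * j s) m = tpure u (act s m).
Proof. exact/tpiP/teq_balanced. Qed.

Lemma tensor_ind (P : tensor -> Prop) :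
  (forall u m, P (tpure u m)) -> P 0 -> (forall x, P x -> P (- x)) ->
  (forall x y, P x -> P y -> P (x + y)) -> forall x, P x.
Proof.
move=> Pp P0 PN PD; elim/tensor_rep; elim=> //.
  by move=> t Pt; rewrite tpiN; apply: PN.
by move=> s Ps t Pt; rewrite tpiD; apply: PD.
Qed.

Fixpoint tterm_map (f : T -> T) (k : M -> M) (t : tterm) : tterm :=
  match t with
  | TPure u m => TPure (f u) (k m)
  | TZero => TZero
  | TOpp t => TOpp (tterm_map f k t)
  | TAdd s t => TAdd (tterm_map f k s) (tterm_map f k t)
  end.

Definition tmap (f : T -> T) (k : M -> M) (x : tensor) : tensor :=
  tpi (tterm_map f k (repr x)).

Section TensorMap.
Variables (f : T -> T) (k : M -> M).
Hypothesis fD : forall u v, f (u + v) = f u + f v.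
Hypothesis kD : forall m n, k (m + n) = k m + k n.
Hypothesis fj : forall u s, f (u * j s) = f u * j s.
Hypothesis kact : forall s m, k (act s m) = act s (k m).

Fact teq_map s t : teq s t -> teq (tterm_map f k s) (tterm_map f k t).
Proof.
elim=> {s t} /=; try by constructor.
- by move=> s t u _ st _ tu; apply: teq_trans st tu.
- by move=> u v m; rewrite fD; apply: teq_pureDl.
- by move=> u m n; rewrite kD; apply: teq_pureDr.
- by move=> u s m; rewrite fj kact; apply: teq_balanced.
Qed.

Lemma tmap_pi t : tmap f k (tpi t) = tpi (tterm_map f k t).
Proof. by apply/tpiP/teq_map/teq_repr. Qed.
Lemma tmap_pure u m : tmap f k (tpure u m) = tpure (f u) (k m).
Proof. exact: tmap_pi. Qed.
Lemma tmapD x y : tmap f k (x + y) = tmap f k x + tmap f k y.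
Proof.
elim/tensor_rep: x => s; elim/tensor_rep: y => t.
by rewrite {1}/GRing.add /= -tpiD !tmap_pi /= tpiD.
Qed.
Lemma tmapN x : tmap f k (- x) = - tmap f k x.
Proof.
elim/tensor_rep: x => s.
by rewrite {1}/GRing.opp /= -tpiN !tmap_pi /= tpiN.
Qed.
Lemma tmap0 : tmap f k 0 = 0.
Proof. exact/additive_at0/tmapD. Qed.
End TensorMap.

Definition tscale (u : T) : tensor -> tensor := tmap ( *%R u) id.

Lemma tscale_pure u v m : tscale u (tpure v m) = tpure (u * v) m.
Proof. by apply: tmap_pure => // *; rewrite ?mulrDr ?mulrA. Qed.
Lemma tscaleDr u x y : tscale u (x + y) = tscale u x + tscale u y.
Proof. by apply: tmapD => // *; rewrite ?mulrDr ?mulrA. Qed.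
Lemma tscaleN u x : tscale u (- x) = - tscale u x.
Proof. by apply: tmapN => // *; rewrite ?mulrDr ?mulrA. Qed.
Lemma tscale0 u : tscale u 0 = 0.
Proof. by apply: tmap0 => // *; rewrite ?mulrDr ?mulrA. Qed.
Lemma tscaleDl u v x : tscale (u + v) x = tscale u x + tscale v x.
Proof.
elim/tensor_ind: x => [w m||x IH|x y IHx IHy].
- by rewrite !tscale_pure mulrDl tpureDl.
- by rewrite !tscale0 addr0.
- by rewrite !tscaleN IH opprD.
- by rewrite !tscaleDr IHx IHy addrACA.
Qed.
Lemma tscaleA u v x : tscale u (tscale v x) = tscale (u * v) x.
Proof.
elim/tensor_ind: x => [w m||x IH|x y IHx IHy].
- by rewrite !tscale_pure mulrA.
- by rewrite !tscale0.
- by rewrite !tscaleN IH.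
- by rewrite !tscaleDr IHx IHy.
Qed.
Lemma tscale1 x : tscale 1 x = x.
Proof.
elim/tensor_ind: x => [w m||x IH|x y IHx IHy].
- by rewrite tscale_pure mul1r.
- by rewrite tscale0.
- by rewrite tscaleN IH.
- by rewrite tscaleDr IHx IHy.
Qed.
End Tensor.

(* Induction: U(g) (x)_{U(g_0)} M. *)
Section Induction.
Variables (K : numFieldType) (L : lieSuper K) (M : supermod (even_part L)).

Definition Ind_sort : Type := tensor (@env_incl K L) (@env_act K (even_part L) M).
HB.instance Definition _ := GRing.Zmodule.on Ind_sort.

Definition Ind_pure (u : env L) (m : M) : Ind_sort := tpure _ _ u m.
Definition Ind_scale (c : K) (x : Ind_sort) : Ind_sort := tscale (econst L c) x.
Definition Ind_act (x : L) (y : Ind_sort) : Ind_sort := tscale (egen x) y.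

Fact Ind_scaleA c d x : Ind_scale c (Ind_scale d x) = Ind_scale (c * d) x.
Proof. by rewrite /Ind_scale tscaleA econstM. Qed.
Fact Ind_scale1 : left_id 1 Ind_scale.
Proof. exact: tscale1. Qed.
Fact Ind_scaleDr : right_distributive Ind_scale +%R.
Proof. by move=> c x y; apply: tscaleDr. Qed.
Fact Ind_scaleDl x : {morph Ind_scale^~ x : c d / c + d}.
Proof. by move=> c d; rewrite /Ind_scale econstD tscaleDl. Qed.
HB.instance Definition _ := GRing.Zmodule_isLmodule.Build K Ind_sort
  Ind_scaleA Ind_scale1 Ind_scaleDr Ind_scaleDl.

Inductive Ind_part : bool -> Ind_sort -> Prop :=
  | Ind_part0 a : Ind_part a 0
  | Ind_partD a x y : Ind_part a x -> Ind_part a y -> Ind_part a (x + y)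
  | Ind_part_pure a b u m :
      env_part a u -> smod_part M b m -> Ind_part (a (+) b) (Ind_pure u m).

Let Ind_part_scale a b u x : env_part a u -> Ind_part b x ->
  Ind_part (a (+) b) (tscale u x).
Proof.
move=> ua; elim=> {b x} [b|b x y _ IHx _ IHy|b c v m vb mc].
- by rewrite tscale0; apply: Ind_part0.
- by rewrite tscaleDr; apply: Ind_partD.
- rewrite tscale_pure addbA; apply: Ind_part_pure => //.
  exact: env_part_mul.
Qed.

Let Ind_part_dec x :
  exists x0 x1, [/\ Ind_part false x0, Ind_part true x1 & x = x0 + x1].
Proof.
have PN a (y : Ind_sort) : Ind_part a y -> Ind_part a (- y).
  by move=> ya; rewrite -scaleN1r; apply: (Ind_part_scale (env_part_const L (-1)) ya).
elim/tensor_ind: x => [u m||x [x0 [x1 [h0 h1 ->]]]|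
    x y [x0 [x1 [hx0 hx1 ->]]] [y0 [y1 [hy0 hy1 ->]]]].
- have [u0 [u1 [U0 U1 ->]]] := env_part_dec u.
  have [_ _ dec _] := smod_grading M; have [m0 [m1 [M0 M1 ->]]] := dec m.
  exists (Ind_pure u0 m0 + Ind_pure u1 m1), (Ind_pure u0 m1 + Ind_pure u1 m0); split.
  + by apply: Ind_partD; [exact: (Ind_part_pure U0 M0) | exact: (Ind_part_pure U1 M1)].
  + by apply: Ind_partD; [exact: (Ind_part_pure U0 M1) | exact: (Ind_part_pure U1 M0)].
  + rewrite /Ind_pure tpureDl !tpureDr [tpure _ _ u1 m0 + _]addrC.
    exact: addrACA.
- exists 0, 0; rewrite addr0; split => //; exact: Ind_part0.
- exists (- x0), (- x1); rewrite opprD; split => //; exact: PN.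
- exists (x0 + y0), (x1 + y1); rewrite addrACA; split => //; exact: Ind_partD.
Qed.

Fact Ind_grading : is_grading (Ind_part : bool -> set Ind_sort).
Proof.
split=> [a|a c x y xa ya||x x0 x1].
- exact: Ind_part0.
- by apply: Ind_partD => //; apply: (Ind_part_scale (env_part_const L c) xa).
- exact: Ind_part_dec.
have [sL [sLlin sLP _]] := parity_invol (lie_grading L).
have [sM [sMlin sMP _]] := parity_invol (smod_grading M).
have sMD m n : sM (m + n) = sM m + sM n by have := sMlin 1 m n; rewrite !scale1r.
pose tau : Ind_sort -> Ind_sort := tmap (env_parity sL) sM.
have eD := env_parityD sLlin sLP.
have ej u v : env_parity sL (u * env_incl v) = env_parity sL u * env_incl v.
  by rewrite (env_parityM sLlin sLP) (env_parity_incl sLlin sLP).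
have ek := env_act_parity sMlin sMP.
have sMZ c m : sM (c *: m) = c *: sM m.
  by have := sMlin c m 0; rewrite (additive_at0 sMD) !addr0.
have tauP a y : Ind_part a y -> tau y = (-1) ^+ a *: y.
  elim=> {a y} [a|a y z _ IHy _ IHz|a b u m ua mb].
  - by rewrite scaler0; apply: (tmap0 eD sMD ej ek).
  - by rewrite scalerDr -IHy -IHz; apply: (tmapD eD sMD ej ek).
  - rewrite [LHS](tmap_pure eD sMD ej ek).
    rewrite (env_parity_part sLlin sLP ua) (sMP _ _ mb).
    rewrite -[X in tpure _ _ _ X]env_act_const -tpure_balanced env_incl_const.
    rewrite -[_ * u * _]mulrA -econstC mulrA -econstM -signr_addb.
    by rewrite -tscale_pure.
by apply: grading_sign; rewrite -{1}[x]scale1r -[1]/((-1) ^+ false) -tauP //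
  (tauP _ _ x1) scaleN1r.
Qed.

Fact Ind_actl c x y z : Ind_act (c *: x + y) z = c *: Ind_act x z + Ind_act y z.
Proof. by rewrite /Ind_act egenP tscaleDl -tscaleA. Qed.
Fact Ind_actr c x y z : Ind_act x (c *: y + z) = c *: Ind_act x y + Ind_act x z.
Proof.
rewrite /Ind_act tscaleDr; congr (_ + _).
by rewrite [LHS]tscaleA -econstC -tscaleA.
Qed.
Fact Ind_act_part a b x y : x \in lie_part L a -> Ind_part b y ->
  Ind_part (a (+) b) (Ind_act x y).
Proof. by move=> xa; apply: Ind_part_scale; apply: env_part_gen. Qed.
Fact Ind_act_lbr a b x y z : x \in lie_part L a -> y \in lie_part L b ->
  Ind_act (lbr x y) z =
    Ind_act x (Ind_act y z) - (-1) ^+ (a && b) *: Ind_act y (Ind_act x z).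
Proof.
move=> xa yb; rewrite /Ind_act (egen_lbr xa yb) tscaleDl !tscaleA.
congr (_ + _); rewrite -scaleNr -econstN1 mulrA -econstM mulN1r.
exact/esym/tscaleA.
Qed.

Definition Ind : supermod L :=
  Supermod Ind_grading Ind_actl Ind_actr Ind_act_part Ind_act_lbr.
End Induction.

(* Coinduction: Hom_{U(g_0)}(U(g), M), on which [u] in U(g) acts by           *)
(* precomposition with right multiplication by [u].                           *)
Section Coinduction.
Variables (K : numFieldType) (L : lieSuper K) (M : supermod (even_part L)).

Record Coind_sort : Type := CoindFun {
  coind_fun :> env L -> M;
  coind_funD : forall u v, coind_fun (u + v) = coind_fun u + coind_fun v;
  coind_funM : forall s u, coind_fun (env_incl s * u) = env_act s (coind_fun u)
}.

Lemma coindP (f h : Coind_sort) : f =1 h -> f = h.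
Proof.
case: f h => [f fD fM] [h hD hM] /= /funext fh; subst h.
by congr CoindFun; apply: Prop_irrelevance.
Qed.

HB.instance Definition _ := gen_eqMixin Coind_sort.
HB.instance Definition _ := gen_choiceMixin Coind_sort.

Definition Coind_zero : Coind_sort.
Proof.
exists (fun _ => 0) => [u v|s u]; first by rewrite addr0.
by rewrite env_act0r.
Defined.
Definition Coind_opp (f : Coind_sort) : Coind_sort.
Proof.
exists (fun u => - f u) => [u v|s u]; first by rewrite coind_funD opprD.
by rewrite coind_funM -!scaleN1r env_actZ.
Defined.
Definition Coind_add (f h : Coind_sort) : Coind_sort.
Proof.
exists (fun u => f u + h u) => [u v|s u]; first by rewrite !coind_funD addrACA.
by rewrite !coind_funM env_actDr.
Defined.
Definition Coind_scale (c : K) (f : Coind_sort) : Coind_sort.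
Proof.
exists (fun u => c *: f u) => [u v|s u]; first by rewrite coind_funD scalerDr.
by rewrite coind_funM env_actZ.
Defined.
Definition Coind_act (x : L) (f : Coind_sort) : Coind_sort.
Proof.
exists (fun u => f (u * egen x)) => [u v|s u]; first by rewrite mulrDl coind_funD.
by rewrite -mulrA coind_funM.
Defined.

Fact Coind_addA : associative Coind_add.
Proof. by move=> f h k; apply: coindP => u /=; rewrite addrA. Qed.
Fact Coind_addC : commutative Coind_add.
Proof. by move=> f h; apply: coindP => u /=; rewrite addrC. Qed.
Fact Coind_add0 : left_id Coind_zero Coind_add.
Proof. by move=> f; apply: coindP => u /=; rewrite add0r. Qed.
Fact Coind_addN : left_inverse Coind_zero Coind_opp Coind_add.
Proof. by move=> f; apply: coindP => u /=; rewrite addNr. Qed.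
HB.instance Definition _ :=
  GRing.isZmodule.Build Coind_sort Coind_addA Coind_addC Coind_add0 Coind_addN.

Fact Coind_scaleA c d f : Coind_scale c (Coind_scale d f) = Coind_scale (c * d) f.
Proof. by apply: coindP => u /=; rewrite scalerA. Qed.
Fact Coind_scale1 : left_id 1 Coind_scale.
Proof. by move=> f; apply: coindP => u /=; rewrite scale1r. Qed.
Fact Coind_scaleDr : right_distributive Coind_scale +%R.
Proof. by move=> c f h; apply: coindP => u /=; rewrite scalerDr. Qed.
Fact Coind_scaleDl f : {morph Coind_scale^~ f : c d / c + d}.
Proof. by move=> c d; apply: coindP => u /=; rewrite scalerDl. Qed.
HB.instance Definition _ := GRing.Zmodule_isLmodule.Build K Coind_sort
  Coind_scaleA Coind_scale1 Coind_scaleDr Coind_scaleDl.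

Definition Coind_part (a : bool) (f : Coind_sort) : Prop :=
  forall b u, env_part b u -> smod_part M (a (+) b) (f u).

Fact Coind_grading : is_grading (Coind_part : bool -> set Coind_sort).
Proof.
have [M0 MP _ Mcap] := smod_grading M.
split=> [a|a c f h fa ha|f|f f0 f1].
- by move=> b u ub /=; apply: M0.
- by move=> b u ub /=; apply: MP; [exact: fa | exact: ha].
- have [sL [sLlin sLP _]] := parity_invol (lie_grading L).
  have [sM [sMlin sMP sMpr]] := parity_invol (smod_grading M).
  have sMD m n : sM (m + n) = sM m + sM n by have := sMlin 1 m n; rewrite !scale1r.
  have eD := env_parityD sLlin sLP.
  have eI := env_parity_incl sLlin sLP.
  have tD u v : sM (f (env_parity sL (u + v))) =
      sM (f (env_parity sL u)) + sM (f (env_parity sL v)).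
    by rewrite eD coind_funD sMD.
  have tM s u : sM (f (env_parity sL (env_incl s * u))) =
      env_act s (sM (f (env_parity sL u))).
    by rewrite (env_parityM sLlin sLP) eI coind_funM (env_act_parity sMlin sMP).
  pose t : Coind_sort := CoindFun tD tM.
  have fc c u : f (econst L c * u) = c *: f u.
    by rewrite -env_incl_const coind_funM env_act_const.
  have tpart a : Coind_part a (2^-1 *: (f + (-1) ^+ a *: t)).
    move=> b u ub.
    have -> : (2^-1 *: (f + (-1) ^+ a *: t)) u =
        2^-1 *: (f u + (-1) ^+ (a (+) b) *: sM (f u)).
      rewrite -[LHS]/(2^-1 *: (f u + (-1) ^+ a *: sM (f (env_parity sL u)))).
      rewrite (env_parity_part sLlin sLP ub) fc signr_addb.
      have -> : sM ((-1) ^+ b *: f u) = (-1) ^+ b *: sM (f u).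
        by have := sMlin ((-1) ^+ b) (f u) 0; rewrite (additive_at0 sMD) !addr0.
      by rewrite scalerA.
    exact: sMpr.
  exists (2^-1 *: (f + (-1) ^+ false *: t)), (2^-1 *: (f + (-1) ^+ true *: t)).
  split; [exact: tpart | exact: tpart |].
  have n2 : 2%:R != 0 :> K by rewrite pnatr_eq0.
  rewrite -scalerDr scale1r scaleN1r addrACA subrr addr0 -mulr2n -scaler_nat.
  by rewrite scalerA mulVf ?scale1r.
- apply: coindP => u; have [u0 [u1 [h0 h1 ->]]] := env_part_dec u.
  rewrite coind_funD (Mcap _ (f0 _ _ h0) (f1 _ _ h0)) add0r.
  exact: Mcap (f1 _ _ h1) (f0 _ _ h1).
Qed.

Fact Coind_actl c x y f :
  Coind_act (c *: x + y) f = c *: Coind_act x f + Coind_act y f.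
Proof.
apply: coindP => u /=; rewrite egenP mulrDr coind_funD mulrA -econstC -mulrA.
by rewrite -[econst L c]env_incl_const coind_funM env_act_const.
Qed.
Fact Coind_actr c x f h :
  Coind_act x (c *: f + h) = c *: Coind_act x f + Coind_act x h.
Proof. exact: coindP. Qed.
Fact Coind_act_part a b x f : x \in lie_part L a -> Coind_part b f ->
  Coind_part (a (+) b) (Coind_act x f).
Proof.
move=> xa fb c u uc /=; rewrite -addbA addbC -addbA.
exact: (fb _ _ (env_part_mul uc (env_part_gen xa))).
Qed.
Fact Coind_act_lbr a b x y f : x \in lie_part L a -> y \in lie_part L b ->
  Coind_act (lbr x y) f =
    Coind_act x (Coind_act y f) - (-1) ^+ (a && b) *: Coind_act y (Coind_act x f).
Proof.
move=> xa yb; apply: coindP => u /=; rewrite (egen_lbr xa yb).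
rewrite mulrDr coind_funD mulrA; congr (_ + _).
set c := _ ^+ _.
have -> : u * - (econst L c * (egen y * egen x)) =
    env_incl (econst _ (- c)) * (u * egen y * egen x).
  rewrite env_incl_const -econstN1 [econst _ _ * (_ * _)]mulrA -econstM mulN1r.
  by rewrite mulrA -econstC !mulrA.
by rewrite coind_funM env_act_const scaleNr.
Qed.

Definition Coind : supermod L :=
  Supermod Coind_grading Coind_actl Coind_actr Coind_act_part Coind_act_lbr.
End Coinduction.

(* A predicate on supermodules stands for the full subcategory on the objects *)
(* satisfying it.                                                             *)
Section Subcategories.
Variables (K : numFieldType) (L : lieSuper K).
Implicit Types (A : supermod L -> Prop) (M N P : supermod L).

(* Membership up to isomorphism: subcategories need not be replete. *)
Definition ess_in A M : Prop := exists2 N, A N & smod_iso N M.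

(* Abelian with exact inclusion: zero object, biproducts, kernels and         *)
(* cokernels exist in [A] and are those of the category of all supermodules.  *)
(* Hence monomorphisms and epimorphisms of [A] are the injective and the      *)
(* surjective morphisms.                                                      *)
Record abelian_subcat A : Prop := AbelianSubcat {
  abelian_zero : exists2 Z, A Z & forall z : Z, z = 0;
  abelian_biproduct : forall M N, A M -> A N -> exists2 P, A P &
    exists (i1 : M -> P) (i2 : N -> P) (p1 : P -> M) (p2 : P -> N),
      [/\ is_shom i1, is_shom i2, is_shom p1 & is_shom p2] /\
      [/\ forall m, p1 (i1 m) = m, forall n, p2 (i2 n) = n,
          forall m, p2 (i1 m) = 0, forall n, p1 (i2 n) = 0
        & forall x, i1 (p1 x) + i2 (p2 x) = x];
  abelian_kernel : forall M N (f : M -> N), A M -> A N -> is_shom f ->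
    exists2 P, A P & exists2 i : P -> M, is_shom i /\ injective i &
      range i = f @^-1` [set 0];
  abelian_cokernel : forall M N (f : M -> N), A M -> A N -> is_shom f ->
    exists2 Q, A Q & exists2 q : N -> Q, is_shom q /\ range q = setT &
      q @^-1` [set 0] = range f
}.

Definition projective_in A P : Prop :=
  A P /\ forall M N (f : M -> N) (h : P -> N), A M -> A N ->
    is_shom f -> range f = setT -> is_shom h ->
    exists2 k : P -> M, is_shom k & f \o k = h.

Definition injective_in A P : Prop :=
  A P /\ forall M N (f : M -> N) (h : M -> P), A M -> A N ->
    is_shom f -> injective f -> is_shom h ->
    exists2 k : N -> P, is_shom k & k \o f = h.

Definition enough_projectives A : Prop :=
  forall M, A M -> exists2 P, projective_in A P &
    exists2 f : P -> M, is_shom f & range f = setT.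

Definition enough_injectives A : Prop :=
  forall M, A M -> exists2 P, injective_in A P &
    exists2 f : M -> P, is_shom f & injective f.

(* A resolution 0 -> P_n -> ... -> P_1 -> P_0 -> M -> 0 by projectives of [A]. *)
Definition has_proj_resolution A M (n : nat) : Prop :=
  exists (P : nat -> supermod L) (d : forall i, P i.+1 -> P i) (e : P 0%N -> M),
    [/\ forall i, projective_in A (P i), forall i, is_shom (d i) & is_shom e] /\
    [/\ range e = setT,
        range (d 0%N) = e @^-1` [set 0],
        forall i, range (d i.+1) = d i @^-1` [set 0]
      & forall i, (n < i)%N -> forall x : P i, x = 0].
End Subcategories.

Section HomologicalDimensions.
Variables (R : realType) (L : lieSuper R[i]).
Implicit Types (A : supermod L -> Prop) (M : supermod L).
Local Open Scope ereal_scope.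

(* [+oo] when [M] has no finite resolution. *)
Definition projdim A M : \bar R :=
  ereal_inf [set n%:R%:E | n in [set n : nat | has_proj_resolution A M n]].

Definition gldim A : \bar R := ereal_sup [set x | exists2 M, A M & x = projdim A M].

Definition findim A : \bar R :=
  ereal_sup [set x | exists2 M, A M /\ projdim A M < +oo & x = projdim A M].
End HomologicalDimensions.

(* Main.v *)
(* Res has an exact right adjoint Coind and an exact left adjoint Ind, so that  *)
(* Ind and Res preserve projectives and resolutions.                            *)
(*                                                                              *)
(* Lower bound: let N in C have projective dimension n = gl.dim C. The unit     *)
(* N -> Res Ind N is injective with a cokernel of dimension at most n, so       *)
(* Res Ind N, and hence Ind N, has dimension exactly n.                         *)
(*                                                                              *)
(* Upper bound: if M has a projective resolution of length m + 1 > n, its last  *)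
(* map splits over g_0, because the m-th syzygy of Res M is projective. The     *)
(* last term is a summand of an induced module, and induced modules are         *)
(* coinduced, hence injective relatively to g_0; so the last map splits over g  *)
(* and the resolution can be shortened.                                         *)
(*                                                                              *)
(* Exactness of Ind and Coind and the isomorphism between induced and coinduced *)
(* modules rest on a relative PBW theorem: U(g) is free over U(g_0) on the      *)
(* increasing products of a basis of g_1. It is proved by straightening words   *)
(* and checking that the ambiguities resolve. Given it, the isomorphism from    *)
(* Ind M to the coinduction of a twist of M by the character tr (ad | g_1) is   *)
(* built from the functional that reads the coefficient of the top product; it  *)
(* is triangular for the filtration by the number of odd factors.               *)

Require Import Defs.
From mathcomp Require Import all_boot all_order all_algebra.
From mathcomp Require Import complex.
From mathcomp Require Import boolp classical_sets reals constructive_ereal ereal.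
From mathcomp Require Import zify.
Set Implicit Arguments.
Unset Strict Implicit.
Unset Printing Implicit Defensive.
Import Order.TTheory GRing.Theory Num.Theory.
Local Open Scope ring_scope.

(** [Ind] is left adjoint and [Coind] right adjoint to [Res]. Since [Ind] and [Res] are exact and
    [Coind] preserves surjections, [Ind] and [Res] preserve projectives ([Ind_proj], [Res_proj]) and
    bounds on projective dimension ([Ind_pdle], [Res_pdle]). Such a bound is expressed by [pdle]:
    all n-th syzygies are projective. A Schanuel argument ([stable_retract_syzygy]) makes this
    independent of the resolution.

    Let n be the least uniform bound on C. If N in C attains it, the unit embeds N into Res Ind N
    with a cokernel of dimension at most n. A bound n - 1 for Ind N would then pass to N by the
    estimates [pdle_ses] ([pdle_Ind_unit]), so Ind N has dimension n. Conversely, let M have finite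
    dimension k > n. Its last nonzero syzygy X is projective, hence a summand of Ind Res X, and the
    sequence starting at X splits over g_0. Induced modules are relatively injective
    ([Ind_relatively_injective]), so it splits over g, and [pdle_descent] lowers k by one until n is
    reached.

    The input that is not formal is that Ind M is coinduced from a twist of M ([frobenius_bij]).
    Coinduced functions are recorded by their values on words in a basis of g_1, subject to the
    relations [good]. By the diamond lemma, arbitrary values on increasing words extend to all words
    ([good_exists], [coind_exists]), and they determine the function ([coind_incr_ext]). The
    functional [theta], supported on the top word, pairs the word of J with the word of the
    complement of I by a matrix that is triangular for the sizes of J and I, with invertible
    diagonal. This gives both the isomorphism and the linear independence ([ind_comb_eq0]) behind
    the exactness of [Ind]. *)

(** * Identities in abelian groups, by reflection *)

Inductive zexp := ZX of nat | Z0 | ZD of zexp & zexp | ZN of zexp.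

Fixpoint zeval (V : zmodType) (env : seq V) (e : zexp) : V :=
  match e with
  | ZX i => env`_i
  | Z0 => 0
  | ZD e1 e2 => zeval env e1 + zeval env e2
  | ZN e1 => - zeval env e1
  end.

Fixpoint zcoef (e : zexp) (i : nat) : int :=
  match e with
  | ZX j => (i == j)%:Z
  | Z0 => 0
  | ZD e1 e2 => zcoef e1 i + zcoef e2 i
  | ZN e1 => - zcoef e1 i
  end.

Lemma zevalE (V : zmodType) (env : seq V) e :
  zeval env e = \sum_(i < size env) env`_i *~ zcoef e i.
Proof.
elim: e => [j||e1 IH1 e2 IH2|e1 IH1] /=.
- have [jn|nj] := ltnP j (size env); last first.
    rewrite nth_default // big1 // => i _.
    by rewrite (_ : (i == j :> nat) = false) //; have := ltn_ord i; lia.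
  rewrite (bigD1 (Ordinal jn)) //= eqxx big1 ?addr0 // => i ij.
  by rewrite (_ : (i == j :> nat) = false) //; apply: contraNF ij => /eqP ij; apply/eqP/val_inj.
- by rewrite big1 // => i _; rewrite mulr0z.
- by rewrite IH1 IH2 -big_split; apply: eq_bigr => i _; rewrite mulrzDr.
- by rewrite IH1 -sumrN; apply: eq_bigr => i _; rewrite mulrNz.
Qed.

Lemma zexp_eq (V : zmodType) (env : seq V) e1 e2 :
  all (fun i => zcoef e1 i == zcoef e2 i) (iota 0 (size env)) ->
  zeval env e1 = zeval env e2.
Proof.
move=> /allP e12; rewrite !zevalE; apply: eq_bigr => i _.
by rewrite (eqP (e12 i _)) // mem_iota /=.
Qed.

Ltac zindex x env :=
  lazymatch env with
  | x :: _ => constr:(0%N)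
  | _ :: ?env' => let n := zindex x env' in constr:(n.+1)
  end.

Ltac zinsert x env :=
  lazymatch env with
  | context [x :: _] => env
  | _ => constr:(x :: env)
  end.

Ltac zvars t env :=
  lazymatch t with
  | ?a + ?b => let env' := zvars a env in zvars b env'
  | - ?a => zvars a env
  | 0 => env
  | ?a *+ 2 => zvars a env
  | _ => zinsert t env
  end.

Ltac zreify t env :=
  lazymatch t with
  | ?a + ?b => let a' := zreify a env in let b' := zreify b env in constr:(ZD a' b')
  | - ?a => let a' := zreify a env in constr:(ZN a')
  | 0 => constr:(Z0)
  | ?a *+ 2 => let a' := zreify a env in constr:(ZD a' a')
  | _ => let n := zindex t env in constr:(ZX n)
  end.

(* Decides the identities that hold in every abelian group. *)
Ltac zmodule :=
  lazymatch goal with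
  | |- @eq ?V ?s ?t =>
    let env0 := constr:(@nil V) in
    let env1 := zvars s env0 in
    let env := zvars t env1 in
    let s' := zreify s env in
    let t' := zreify t env in
    apply: (@zexp_eq _ env s' t'); vm_compute; reflexivity
  end.

(** Proof by linear combination: hypotheses are combined with [eq_add] and [eq_sub] into one
    equation, and [zmodule] checks that its two sides differ by the same element as those of the
    goal. *)
Lemma eq_diff (V : zmodType) (a b s t : V) : a = b -> s - t = a - b -> s = t.
Proof. by move=> -> /eqP; rewrite subrr subr_eq0 => /eqP. Qed.

Lemma eq_add (V : zmodType) (a b s t : V) : a = b -> s = t -> a + s = b + t.
Proof. by move=> -> ->. Qed.

Lemma eq_sub (V : zmodType) (a b s t : V) : a = b -> s = t -> a - s = b - t.
Proof. by move=> -> ->. Qed.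

(** * Straightening of words in the odd generators *)

Section Straightening.
Variables (K : numFieldType) (d : nat) (E Y : lmodType K).
Variables (c : 'I_d -> 'I_d -> E) (A : E -> 'I_d -> 'I_d -> K) (r : E -> Y -> Y).
Implicit Types (f g : seq 'I_d -> Y) (u v w : seq 'I_d) (a b : E) (i j k l : 'I_d).

(* [f w] stands for the value at the product of the letters of [w], taken from  *)
(* right to left, of a function that is linear over the even part on the left;  *)
(* [wact a f w] is then its value at that product times [a].                    *)
Fixpoint wact a f w : Y :=
  if w is k :: v then wact a (fun t => f (k :: t)) v - \sum_l A a k l *: f (l :: v)
  else r a (f [::]).

(* The relations [y_i y_j + y_j y_i = c i j], on words of length at most [n]. *)
Definition good n f := forall u i j v, (size u + size v + 2 <= n)%N ->
  f (u ++ i :: j :: v) + f (u ++ j :: i :: v) = wact (c i j) (fun t => f (u ++ t)) v.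

Lemma wact_cons a f k v :
  wact a f (k :: v) = wact a (fun t => f (k :: t)) v - \sum_l A a k l *: f (l :: v).
Proof. by []. Qed.
Local Arguments wact : simpl never.

Lemma wact_ext a f g w :
  (forall t, size t = size w -> f t = g t) -> wact a f w = wact a g w.
Proof.
elim: w f g => [|k v IH] f g fg; first by rewrite /wact fg.
rewrite !wact_cons.
rewrite (IH _ (fun t => g (k :: t))) => [|t tv]; last by apply: fg; rewrite /= tv.
by congr (_ - _); apply: eq_bigr => l _; rewrite fg.
Qed.

Hypothesis rPr : forall a (k : K) y z, r a (k *: y + z) = k *: r a y + r a z.
Hypothesis rPl : forall (k : K) a b y, r (k *: a + b) y = k *: r a y + r b y.
Hypothesis APl : forall (k : K) a b i l, A (k *: a + b) i l = k * A a i l + A b i l.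

Lemma wactP a (k : K) f g w :
  wact a (fun t => k *: f t + g t) w = k *: wact a f w + wact a g w.
Proof.
elim: w f g => [|i v IH] f g; first exact: rPr.
rewrite !wact_cons IH scalerBr addrACA -opprD; congr (_ - _).
rewrite scaler_sumr -big_split; apply: eq_bigr => l _.
by rewrite scalerDr !scalerA mulrC.
Qed.

Lemma wactPl (k : K) a b f w : wact (k *: a + b) f w = k *: wact a f w + wact b f w.
Proof.
elim: w f => [|i v IH] f; first exact: rPl.
rewrite !wact_cons IH scalerBr addrACA -opprD; congr (_ - _).
rewrite scaler_sumr -big_split; apply: eq_bigr => l _.
by rewrite APl scalerDl scalerA.
Qed.

Lemma wactD a f g w : wact a (fun t => f t + g t) w = wact a f w + wact a g w.
Proof.
by have := wactP a 1 f g w; rewrite scale1r => <-; apply: wact_ext => t _; rewrite scale1r.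
Qed.

Lemma wact0 a w : wact a (fun=> 0) w = 0.
Proof. 
apply: (addrI (wact a (fun=> 0) w)); rewrite addr0 -[LHS]wactD.
by apply: wact_ext => t _; rewrite addr0. Qed.

Lemma wactZ a (k : K) f w : wact a (fun t => k *: f t) w = k *: wact a f w.
Proof.
have := wactP a k f (fun=> 0) w; rewrite wact0 addr0 => <-.
by apply: wact_ext => t _; rewrite addr0.
Qed.

Lemma wactB a f g w : wact a (fun t => f t - g t) w = wact a f w - wact a g w.
Proof.
rewrite wactD -[- wact a g w]scaleN1r -wactZ; congr (_ + _).
by apply: wact_ext => t _; rewrite scaleN1r.
Qed.

Lemma wact_sum a (k : 'I_d -> K) (F : 'I_d -> seq 'I_d -> Y) w :
  wact a (fun t => \sum_l k l *: F l t) w = \sum_l k l *: wact a (F l) w.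
Proof.
elim: (index_enum _) => [|l s IH].
  by rewrite big_nil -[RHS](wact0 a w); apply: wact_ext => t _; rewrite big_nil.
rewrite big_cons -IH -wactP.
by apply: wact_ext => t _; rewrite big_cons.
Qed.

Lemma wact0l f w : wact 0 f w = 0.
Proof.
have := wactPl 1 0 0 f w; rewrite scaler0 addr0 scale1r => e.
by apply: (addrI (wact 0 f w)); rewrite addr0 -e.
Qed.

Lemma wactDl a b f w : wact (a + b) f w = wact a f w + wact b f w.
Proof. by have := wactPl 1 a b f w; rewrite !scale1r. Qed.

Lemma wact_suml (k : 'I_d -> K) (a : 'I_d -> E) f w :
  wact (\sum_l k l *: a l) f w = \sum_l k l *: wact (a l) f w.
Proof.
elim: (index_enum _) => [|l s IH]; first by rewrite !big_nil wact0l.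
by rewrite !big_cons -IH wactPl.
Qed.

Variable br : E -> E -> E.
Hypothesis r_br : forall a b y, r (br a b) y = r a (r b y) - r b (r a y).
Hypothesis A_br : forall a b k m,
  A (br a b) k m = \sum_l (A b k l * A a l m - A a k l * A b l m).
Hypothesis br_c : forall a i j,
  br a (c i j) = \sum_l A a i l *: c l j + \sum_l A a j l *: c i l.
Hypothesis c_sym : forall i j, c i j = c j i.
Hypothesis c_jac : forall i j k l,
  A (c i j) k l + A (c j k) i l + A (c k i) j l = 0.

(** Right translations by even elements form a representation: at each letter the matrices [A]
    contribute their commutator, which [A_br] identifies. *)
Lemma wact_br a b f w : wact (br a b) f w = wact a (wact b f) w - wact b (wact a f) w.
Proof.
elim: w f => [|k v IH] f; first exact: r_br.
rewrite !wact_cons IH.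
rewrite !wactB !wact_sum.
under [X in _ = _ - X - _]eq_bigr do rewrite scalerBr scaler_sumr.
under [X in _ = _ - (_ - X)]eq_bigr do rewrite scalerBr scaler_sumr.
rewrite !sumrB.
set a1 := wact a _ v; set b1 := wact b _ v.
set s1 := \sum_i A b k i *: _; set s2 := \sum_i A a k i *: _.
set s3 := \sum_(i < d) _; set s4 := \sum_(i < d) \sum_(i0 < d) _.
set s5 := \sum_(i < d) \sum_(i0 < d) _.
(* The single sums [s1] and [s2] occur in both compositions and cancel; only the double sums
   remain. *)
have -> : s3 = s5 - s4.
  rewrite /s3; under eq_bigr do rewrite A_br scaler_suml.
  rewrite exchange_big /= /s4 /s5 -sumrB; apply: eq_bigr => l _.
  by rewrite -sumrB; apply: eq_bigr => m _; rewrite scalerBl !scalerA.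
zmodule.
Qed.

(* Sorting an adjacent pair decreases this weight. *)
Fixpoint wgt w : nat :=
  if w is k :: v then (k * size v + wgt v)%N else 0%N.

Lemma wgt_lt u w w' : size w = size w' -> (wgt w < wgt w')%N -> (wgt (u ++ w) < wgt (u ++ w'))%N.
Proof.
move=> ww' lt; elim: u => //= k u IH.
by rewrite !size_cat ww' ltn_add2l.
Qed.

Lemma wgt_swap u (i j : 'I_d) v : (j < i)%N -> (wgt (u ++ j :: i :: v) < wgt (u ++ i :: j :: v))%N.
Proof. by move=> ji; apply: wgt_lt => //=; nia. Qed.

Lemma good_le m n f : (m <= n)%N -> good n f -> good m f.
Proof. by move=> mn gf u i j v uv; apply: gf; apply: leq_trans mn. Qed.

Lemma good_cons n f k : good n.+1 f -> good n (fun t => f (k :: t)).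
Proof. by move=> gf u i j v uv; apply: (gf (k :: u)). Qed.

Lemma good_cat n f u : good (size u + n) f -> good n (fun t => f (u ++ t)).
Proof.
elim: u f => [|k u IH] f gf //.
by apply: (IH (fun t => f (k :: t))); apply: good_cons.
Qed.

(** Right multiplication by an even element respects the relations because the adjoint action is a
    derivation of the odd bracket ([br_c]). This settles a pair at the head of the word; letters
    before it are handled by induction. *)
Lemma good_wact a n f : good n f -> good n (wact a f).
Proof.
move=> gf u; elim: u n f gf => [|k u IH] n f gf i j v uv.
  rewrite /= in uv *; rewrite !wact_cons.
  have gij t : size t = size v -> f [:: i, j & t] + f [:: j, i & t] = wact (c i j) f t.
    by move=> tv; apply: (gf [::]); rewrite tv.
  have g1 : wact a (fun t => f [:: i, j & t]) v + wact a (fun t => f [:: j, i & t]) v =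
     wact a (wact (c i j) f) v.
    by rewrite -wactD; apply: wact_ext => t tv; rewrite gij.
  (* By [br_c] the bracket is a sum of relations with one of the two letters replaced. These are the
     corrections produced by moving [a] past the pair. *)
  have g2 : wact (br a (c i j)) f v =
      \sum_l A a i l *: f [:: l, j & v] + \sum_l A a i l *: f [:: j, l & v] +
      (\sum_l A a j l *: f [:: i, l & v] + \sum_l A a j l *: f [:: l, i & v]).
    rewrite br_c wactDl !wact_suml; congr (_ + _); rewrite -big_split;
      by apply: eq_bigr => l _ /=; rewrite -scalerDr -(gf [::]).
  rewrite wact_br in g2.
  rewrite -[RHS]/(wact (c i j) (wact a f) v); apply: (eq_diff (eq_add g1 g2)).
  zmodule.
case: n gf uv => [|n] gf uv; first by rewrite addn2 in uv.
have e := IH n _ (good_cons k gf) i j v uv.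
rewrite /= !wact_cons.
have -> : wact (c i j) (fun t => wact a f (k :: u ++ t)) v =
  wact (c i j) (fun t => wact a (fun t' => f (k :: t')) (u ++ t)) v
   - \sum_l A a k l *: wact (c i j) (fun t => f (l :: u ++ t)) v.
  by rewrite wactB wact_sum.
have -> : \sum_l A a k l *: wact (c i j) (fun t => f (l :: u ++ t)) v =
   \sum_l A a k l *: f (l :: u ++ [:: i, j & v]) + \sum_l A a k l *: f (l :: u ++ [:: j, i & v]).
  rewrite -big_split; apply: eq_bigr => l _ /=; rewrite -scalerDr; congr (_ *: _).
  by rewrite -(gf (l :: u)).
apply: (eq_diff e); zmodule.
Qed.


Definition incr : rel 'I_d := fun i j => (i < j)%N.

(** Looks for the leftmost descent, [u] being the increasing prefix already read. Equal neighbours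
    count, as the square of an odd letter is rewritten too. *)
Fixpoint descent_from u i w :=
  if w is j :: v then
    if incr i j then descent_from (rcons u i) j v else Some (u, i, j, v)
  else None.

Definition descent w := if w is i :: v then descent_from [::] i v else None.

Lemma descent_from_cat u i v w : path incr i v ->
  descent_from u i (v ++ w) = descent_from (u ++ belast i v) (last i v) w.
Proof.
elim: v u i => [|j v IH] u i /=; first by rewrite cats0.
by case/andP=> ij jv; rewrite ij IH // cat_rcons.
Qed.

Lemma descent_sorted w : sorted incr w -> descent w = None.
Proof. by case: w => //= i v iv; rewrite -[v]cats0 descent_from_cat. Qed.

Lemma descentE u i j v : sorted incr (rcons u i) -> (j <= i)%N ->
  descent (u ++ i :: j :: v) = Some (u, i, j, v).
Proof.
rewrite leqNgt => ui ij; case: u ui => [|k u] /= ui.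
  by rewrite /incr (negPf ij).
by rewrite -cat_rcons descent_from_cat // belast_rcons last_rcons /= /incr (negPf ij).
Qed.

Lemma unsorted_descent w : ~~ sorted incr w ->
  exists u i j v, [/\ w = u ++ i :: j :: v, sorted incr (rcons u i) & (j <= i)%N].
Proof.
elim/last_ind: w => [//|w z IH]; have [sw|nsw] := boolP (sorted incr w); last first.
  move=> _; have [u [i [j [v [-> si ij]]]]] := IH nsw.
  by exists u, i, j, (rcons v z); rewrite -!rcons_cons -rcons_cat.
case: (lastP w) sw => [|u i] // sw nw.
exists u, i, z, [::]; rewrite -cats1 cat_rcons; split=> //.
rewrite leqNgt; apply: contra nw => iz.
have {}iz : incr i z by [].
case: u sw => [|k u] /=; first by rewrite iz.
by rewrite (rcons_path _ _ (rcons u i)) last_rcons iz andbT.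
Qed.

Lemma half_eq (x y : Y) : x + x = y + y -> x = y.
Proof.
move=> xy; have n2 : 2%:R != 0 :> K by rewrite pnatr_eq0.
by apply: (scalerI n2); rewrite !scaler_nat.
Qed.

Section Sort.
Variables (phi b : seq 'I_d -> Y).

(** Rewriting at the leftmost descent; the correction is read from [phi], already known on shorter
    words. A repeated letter uses y_i y_i = c i i / 2. The number [m] is fuel: each swap lowers
    [wgt], so from fuel [(wgt w).+1] the default 0 is never reached. *)
Fixpoint sort_word m w : Y :=
  if descent w is Some (u, i, j, v) then
    let p := wact (c i j) (fun t => phi (u ++ t)) v in
    if i == j then 2^-1 *: p
    else if m is m'.+1 then p - sort_word m' (u ++ j :: i :: v) else 0
  else b w.

Lemma sort_word_fuel m m' w : (wgt w < m)%N -> (wgt w < m')%N ->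
  sort_word m w = sort_word m' w.
Proof.
elim: m m' w => [|m IH] [|m'] w //= wm wm'.
have [/descent_sorted -> //|/unsorted_descent] := boolP (sorted incr w).
case=> u [i [j [v [ew ui ij]]]]; subst w; rewrite (descentE _ ui ij); case: eqP => // nij.
have {}ij : (j < i)%N by rewrite ltn_neqAle ij andbT; apply/eqP => /val_inj/esym.
have := wgt_swap u v ij => lt.
by rewrite (IH m') //; apply: leq_trans lt _.
Qed.

Let psi w := sort_word (wgt w).+1 w.

Lemma sort_word_sorted w : sorted incr w -> psi w = b w.
Proof. by move=> sw; rewrite /psi /= descent_sorted. Qed.

Lemma sort_word_descent u i j v : sorted incr (rcons u i) -> (j <= i)%N ->
  psi (u ++ i :: j :: v) + psi (u ++ j :: i :: v) =
  wact (c i j) (fun t => phi (u ++ t)) v.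
Proof.
move=> ui ij; rewrite /psi [X in X + _]/= (descentE _ ui ij).
case: eqP => [eij|nij].
  subst j; rewrite /= (descentE _ ui ij) eqxx -scalerDl -[2^-1]mul1r -splitr scale1r.
  by [].
have {}ij : (j < i)%N by rewrite ltn_neqAle ij andbT; apply/eqP => /val_inj/esym.
have := wgt_swap u v ij => lt.
by rewrite (@sort_word_fuel _ (wgt (u ++ [:: j, i & v])).+1) // subrK.
Qed.

Variable n : nat.
Hypothesis phi_good : good n phi.

(** The two rewritings commute: the corrections live on words shorter by two, where [phi] is good
    and [good_wact] applies. If the left pair is a repeated letter, twice the claim is obtained. *)
Let confluence_disjoint u k l x i j v : (size (u ++ k :: l :: x ++ i :: j :: v) = n.+1)%N ->
  sorted incr (rcons u k) -> (l <= k)%N -> (j <= i)%N ->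
  ((l < k)%N -> psi (u ++ l :: k :: x ++ i :: j :: v) + psi (u ++ l :: k :: x ++ j :: i :: v) =
      wact (c i j) (fun t => phi (u ++ l :: k :: x ++ t)) v) ->
  psi (u ++ k :: l :: x ++ i :: j :: v) + psi (u ++ k :: l :: x ++ j :: i :: v) =
      wact (c i j) (fun t => phi (u ++ k :: l :: x ++ t)) v.
Proof.
move=> sz uk lk ij IH.
have D1 := sort_word_descent (x ++ i :: j :: v) uk lk.
have D2 := sort_word_descent (x ++ j :: i :: v) uk lk.
rewrite !size_cat /= !size_cat /= in sz.
have gf : good (n - size u) (fun t => phi (u ++ t)).
  by apply: good_cat; apply: good_le phi_good; lia.
have Q := @good_wact (c k l) _ _ gf x i j v ltac:(lia).
have G : wact (c i j) (fun t => phi (u ++ k :: l :: x ++ t)) v +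
     wact (c i j) (fun t => phi (u ++ l :: k :: x ++ t)) v =
     wact (c i j) (fun t => wact (c k l) (fun t => phi (u ++ t)) (x ++ t)) v.
  rewrite -wactD; apply: wact_ext => t tv; apply: (gf [::]).
  by rewrite size_cat tv /=; lia.
have [elk|llk] := eqVneq l k; last first.
  have {}IH := IH ltac:(by rewrite ltn_neqAle llk).
  by apply: (eq_diff (eq_add (eq_sub (eq_add D1 D2) IH) (eq_sub Q G))); zmodule.
subst l; apply: half_eq.
by apply: (eq_diff (eq_add (eq_add D1 D2) (eq_sub Q G))); zmodule.
Qed.

(** If k differs from i, the six arrangements of the three letters form a hexagon of relations: five
    of its edges are known, and the Jacobi identity [c_jac] closes it. Repeated leading letters are
    treated apart, since the hexagon degenerates. *)
Let confluence_overlap u k i j v : (size (u ++ k :: i :: j :: v) = n.+1)%N ->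
  sorted incr (rcons u k) -> (i <= k)%N -> (j <= i)%N ->
  (forall u' x y v', (wgt (u' ++ x :: y :: v') < wgt (u ++ k :: i :: j :: v))%N ->
    size (u' ++ x :: y :: v') = n.+1 -> (y <= x)%N ->
    psi (u' ++ x :: y :: v') + psi (u' ++ y :: x :: v') =
      wact (c x y) (fun t => phi (u' ++ t)) v') ->
  psi (u ++ k :: i :: j :: v) + psi (u ++ k :: j :: i :: v) =
      wact (c i j) (fun t => phi (u ++ k :: t)) v.
Proof.
move=> sz uk ik ji IH.
have jk : (j <= k)%N by apply: leq_trans ik.
pose f t := phi (u ++ t).
rewrite -[RHS]/(wact (c i j) (fun t => f (k :: t)) v).
pose S a x := \sum_l A a x l *: f (l :: v).
have J (x y z : 'I_d) : S (c x y) z + S (c y z) x + S (c z x) y = 0.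
  rewrite -!big_split big1 // => l _ /=.
  by rewrite -!scalerDl c_jac scale0r.
have cons a x : wact a f (x :: v) = wact a (fun t => f (x :: t)) v - S a x by [].
have D1 := sort_word_descent (j :: v) uk ik.
have D2 := sort_word_descent (i :: v) uk jk.
have IH1 (x y z : 'I_d) : (z <= y)%N ->
    (wgt (u ++ x :: y :: z :: v) < wgt (u ++ k :: i :: j :: v))%N ->
    psi (u ++ x :: y :: z :: v) + psi (u ++ x :: z :: y :: v) =
    wact (c y z) (fun t => f (x :: t)) v.
  move=> zy lt; have := IH (rcons u x) y z v; rewrite !cat_rcons => -> //.
    by apply: wact_ext => t _; rewrite cat_rcons.
  by rewrite -sz !size_cat.
have IH0 (x y z : 'I_d) : (z <= y)%N ->
    (wgt (u ++ y :: z :: x :: v) < wgt (u ++ k :: i :: j :: v))%N ->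
    psi (u ++ y :: z :: x :: v) + psi (u ++ z :: y :: x :: v) = wact (c y z) f (x :: v).
  by move=> zy lt; rewrite IH // -sz !size_cat.
rewrite -/f !cons in D1 D2; rewrite -/(f _) in IH0 *.
have lt3 (x y z : 'I_d) : (x * (size v).+2 + y * (size v).+1 + z * size v <
    k * (size v).+2 + i * (size v).+1 + j * size v)%N ->
    (wgt (u ++ x :: y :: z :: v) < wgt (u ++ k :: i :: j :: v))%N.
  by move=> lt; apply: wgt_lt => //=; rewrite !addnA ltn_add2r.
have [eik|nik] := eqVneq i k.
  subst k; have [eij|nij] := eqVneq j i.
    (* For three equal letters the Jacobi identity says that three times the correction is 0, and 3
       is invertible. *)
    subst j; have J0 := J i i i.
    have {}J0 : S (c i i) i = 0.
      have n3 : 3%:R != 0 :> K by rewrite pnatr_eq0.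
      by apply: (scalerI n3); rewrite scaler0 scaler_nat -J0; rewrite !mulrS mulr0n addr0 addrA.
    by rewrite D1 J0 subr0.
  have lij : (j < i)%N by rewrite ltn_neqAle nij.
  have F2 := IH1 j i i (leqnn _) (lt3 j i i ltac:(nia)).
  apply: half_eq.
  apply: (eq_diff (eq_sub (eq_sub (eq_add D1 (eq_add D2 D2)) F2) (J i i j))).
  rewrite (c_sym j i); zmodule.
have lik : (i < k)%N by rewrite ltn_neqAle nik.
have F1 := IH1 i k j jk (lt3 i k j ltac:(nia)).
have F2 := IH1 j k i ik (lt3 j k i ltac:(nia)).
have F3 := IH0 k i j ji (lt3 i j k ltac:(nia)).
rewrite cons in F3.
apply: (eq_diff (eq_sub (eq_add (eq_sub (eq_sub (eq_add D1 D2) F1) F2) F3) (J k i j))).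
rewrite (c_sym j k); zmodule.
Qed.

(** Diamond lemma, by induction on [wgt]: a given descent is the leftmost one, or overlaps it in one
    letter, or lies entirely to its right. *)
Lemma sort_word_confluent u i j v : size (u ++ i :: j :: v) = n.+1 -> (j <= i)%N ->
  psi (u ++ i :: j :: v) + psi (u ++ j :: i :: v) =
      wact (c i j) (fun t => phi (u ++ t)) v.
Proof.
have [m] := ubnP (wgt (u ++ i :: j :: v)); elim: m u i j v => // m IH u i j v wm sz ij.
have [ui|/unsorted_descent] := boolP (sorted incr (rcons u i)).
  exact: sort_word_descent.
case=> u' [k [l [x [e uk lk]]]].
case: (lastP x) e => [|x' i'] e.
  have {}e : rcons u i = rcons (rcons u' k) l by rewrite e -!cats1 -catA.
  have [eu ei] := rcons_inj e; subst u l.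
  rewrite cat_rcons in sz wm *; rewrite cat_rcons.
  rewrite (@confluence_overlap u' k i j v) //.
    by apply: wact_ext => t _; rewrite cat_rcons.
  move=> u2 x2 y2 v2 lt2 sz2 xy2; apply: IH => //.
  by apply: leq_trans lt2 _; rewrite -ltnS.
have {}e : rcons u i = rcons (u' ++ k :: l :: x') i' by rewrite e -!rcons_cons -rcons_cat.
have [eu ei] := rcons_inj e; subst u i'.
rewrite -!catA /= in sz wm *.
rewrite (@confluence_disjoint u' k l x' i j v) //.
  by apply: wact_ext => t _; rewrite -catA.
move=> lk'.
have := IH (u' ++ l :: k :: x') i j v; rewrite -!catA /= => ->.
- by apply: wact_ext => t _; rewrite -catA.
- rewrite -ltnS; apply: leq_trans wm; rewrite ltnS; exact: wgt_swap.
- by rewrite -sz !size_cat.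
- by [].
Qed.

Definition sort_step w := if (size w <= n)%N then phi w else psi w.

Lemma good_sort_step : good n.+1 sort_step.
Proof.
move=> u i j v uv.
have e : wact (c i j) (fun t => sort_step (u ++ t)) v = wact (c i j) (fun t => phi (u ++ t)) v.
  apply: wact_ext => t tv; rewrite /sort_step size_cat tv.
  by rewrite ifT //; lia.
rewrite e /sort_step !size_cat /=; case: ifP => [le|/negbT nle].
  by apply: phi_good; lia.
have sz : (size u + (size v).+2 = n.+1)%N by lia.
have [ji|/ltnW ij] := leqP j i.
  by apply: sort_word_confluent; rewrite // size_cat /=.
by rewrite addrC c_sym; apply: sort_word_confluent; rewrite // size_cat /=.
Qed.
End Sort.

Fixpoint straighten (b : seq 'I_d -> Y) n : seq 'I_d -> Y :=
  if n is n'.+1 then sort_step (straighten b n') b n' else b.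

Lemma good0 f : good 0 f.
Proof. by move=> u i j v; rewrite addn2. Qed.

Lemma good_straighten (b : seq 'I_d -> Y) n : good n (straighten b n).
Proof. by elim: n => [|n IH]; [exact: good0 | exact: good_sort_step]. Qed.

Lemma straighten_le (b : seq 'I_d -> Y) m n w : (size w <= m)%N -> (m <= n)%N ->
  straighten b n w = straighten b m w.
Proof.
move=> wm; elim: n => [|n IH]; first by rewrite leqn0 => /eqP ->.
rewrite leq_eqVlt => /predU1P[-> //|mn].
by rewrite /= /sort_step (leq_trans wm) // IH.
Qed.

(** The stages [straighten b n] agree on words that are short enough, so the diagonal is well
    defined and takes each relation from a sufficiently late stage. *)
Lemma good_exists (b : seq 'I_d -> Y) : exists f, (forall n, good n f) /\
  forall w, sorted incr w -> f w = b w.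
Proof.
exists (fun w => straighten b (size w) w); split=> [n u i j v uv|w].
  set N := size (u ++ i :: j :: v).
  have eN t : (size t <= N)%N -> straighten b (size t) t = straighten b N t.
    by move=> tN; rewrite -(@straighten_le b (size t) N).
  have sN : (size u + size v + 2 <= N)%N by rewrite /N size_cat /=; lia.
  rewrite !eN; [|by rewrite /N !size_cat..].
  rewrite (@good_straighten b N u i j v sN).
  by apply: wact_ext => t tv; rewrite eN // size_cat tv; lia.
elim: (size w) => //= n IH sw; rewrite /sort_step; case: ifP => _; first exact: IH.
exact: sort_word_sorted.
Qed.

(** The correction in a relation involves words shorter by two, where [f] vanishes. So a swap only
    changes the sign, a repeated neighbour forces 0, and sorting within [P] ends at an increasing
    word. *)
Lemma good_bounded_ind f (P : pred (seq 'I_d)) n : good n f ->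
  (forall u i j v, P (u ++ i :: j :: v) -> P (u ++ j :: i :: v)) ->
  (forall w, (size w + 2 <= n)%N -> f w = 0) ->
  (forall w, (size w <= n)%N -> P w -> sorted incr w -> f w = 0) ->
  forall w, (size w <= n)%N -> P w -> f w = 0.
Proof.
move=> gf Psw f0 fs w.
have [m] := ubnP (wgt w); elim: m w => // m IH w wm wn Pw.
have [sw|/unsorted_descent] := boolP (sorted incr w); first exact: fs.
case=> u [i [j [v [ew ui ji]]]]; subst w.
have sz : (size u + size v + 2 <= n)%N by move: wn; rewrite size_cat /=; lia.
have := gf u i j v sz.
have -> : wact (c i j) (fun t => f (u ++ t)) v = 0.
  rewrite -[RHS](wact0 (c i j) v); apply: wact_ext => t tv.
  by apply: f0; rewrite size_cat tv.
have [-> e|nij] := eqVneq i j.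
  by apply: half_eq; rewrite e addr0.
have lt : (j < i)%N by rewrite ltn_neqAle ji andbT eq_sym.
rewrite (IH (u ++ j :: i :: v)) ?addr0 //.
- by rewrite -ltnS; apply: leq_trans wm; rewrite ltnS; apply: wgt_swap.
- by move: wn; rewrite !size_cat.
- exact: Psw.
Qed.

Lemma good_vanish f n : good n f ->
  (forall w, (size w <= n)%N -> sorted incr w -> f w = 0) ->
  forall w, (size w <= n)%N -> f w = 0.
Proof.
elim: n => [|n IH] gf fs w wn.
  by apply: fs => //; case: w wn.
apply: (@good_bounded_ind f xpredT n.+1 gf) => // [t tn|t tn _].
  apply: IH => [|s sn|]; [exact: good_le gf | by apply: fs; lia | by lia].
exact: fs.
Qed.

(** Off-diagonal entries of [A a] replace one letter by a different one. Where these words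
    contribute 0, moving [a] through [w] only costs the diagonal entries at its letters. *)
Lemma wact_diag a f w :
  (forall u k v l, w = u ++ k :: v -> l != k -> f (u ++ l :: v) = 0) ->
  wact a f w = r a (f w) - (\sum_(k <- w) A a k k) *: f w.
Proof.
elim: w f => [|k v IH] f fw.
  by rewrite big_nil scale0r subr0.
rewrite wact_cons IH => [|u k' v' l' ev ll]; last by apply: (fw (k :: u) k'); rewrite ?ev.
have -> : \sum_l A a k l *: f (l :: v) = A a k k *: f (k :: v).
  rewrite (bigD1 k) //= big1 ?addr0 // => l lk.
  by have /= -> := fw [::] k v l erefl lk; rewrite scaler0.
by rewrite big_cons scalerDl opprD [- _ - _]addrC addrA.
Qed.

End Straightening.

(** * The enveloping algebra as a module over that of the even part *)

Section LinearFunctions.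
Variables (K : numFieldType) (V W : lmodType K) (f : V -> W).
Hypothesis flin : forall c u v, f (c *: u + v) = c *: f u + f v.

Lemma lin_D u v : f (u + v) = f u + f v.
Proof. by have := flin 1 u v; rewrite !scale1r. Qed.
Lemma lin_0 : f 0 = 0.
Proof. exact: additive_at0 lin_D. Qed.
Lemma lin_Z c u : f (c *: u) = c *: f u.
Proof. by have := flin c u 0; rewrite lin_0 !addr0. Qed.
Lemma lin_N u : f (- u) = - f u.
Proof. by rewrite -scaleN1r lin_Z scaleN1r. Qed.
Lemma lin_B u v : f (u - v) = f u - f v.
Proof. by rewrite lin_D lin_N. Qed.
Lemma lin_sum (I : finType) (P : pred I) (F : I -> V) :
  f (\sum_(i | P i) F i) = \sum_(i | P i) f (F i).
Proof. by apply: (big_morph f lin_D lin_0). Qed.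
End LinearFunctions.

(** * Structure constants in a basis of the odd part *)

Section OddBasis.
Variables (K : numFieldType) (L : lieSuper K).

Definition odd_dim := \dim (lie_part L true).
Notation d := odd_dim.
Definition odd_basis (i : 'I_d) : L := (vbasis (lie_part L true))`_i.
Local Notation y := odd_basis.
Definition odd_coord (i : 'I_d) (x : L) : K := coord (vbasis (lie_part L true)) i x.
Definition odd_lbr (i j : 'I_d) : even_part L := vsproj (lie_part L false) (lbr (y i) (y j)).
Definition ad_odd (a : even_part L) (i j : 'I_d) : K := odd_coord j (lbr (vsval a : L) (y i)).

Lemma odd_basis_mem i : y i \in lie_part L true.
Proof. by apply: vbasis_mem; rewrite mem_nth // size_tuple. Qed.

Lemma odd_coordE x : x \in lie_part L true -> x = \sum_i odd_coord i x *: y i.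
Proof. exact: coord_vbasis. Qed.

Lemma odd_coordP c x x' i : odd_coord i (c *: x + x') = c * odd_coord i x + odd_coord i x'.
Proof. by rewrite /odd_coord linearP. Qed.

Lemma odd_coord_sum (k : 'I_d -> K) i : odd_coord i (\sum_j k j *: y j) = k i.
Proof. by rewrite /odd_coord coord_sum_free // (basis_free (vbasisP _)). Qed.

Lemma odd_coord_basis i j : odd_coord j (y i) = (i == j)%:R.
Proof. exact: (coord_free _ _ (basis_free (vbasisP _))). Qed.

Lemma even_mem (a : even_part L) : (vsval a : L) \in lie_part L false.
Proof. exact: subvsP. Qed.

Lemma ad_oddE a i : lbr (vsval a : L) (y i) = \sum_l ad_odd a i l *: y l.
Proof.
by apply: odd_coordE; apply: (lbr_part (even_mem a) (odd_basis_mem i)).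
Qed.

Lemma odd_lbrE i j : vsval (odd_lbr i j) = lbr (y i) (y j).
Proof.
by rewrite vsprojK // (lbr_part (odd_basis_mem i) (odd_basis_mem j)).
Qed.

Lemma lbr_suml n (k : 'I_n -> K) (F : 'I_n -> L) z :
  lbr (\sum_l k l *: F l) z = \sum_l k l *: lbr (F l) z.
Proof.
have gl c u v : lbr (c *: u + v) z = c *: lbr u z + lbr v z by exact: lbr_linearl.
by rewrite (lin_sum gl); apply: eq_bigr => l _; rewrite (lin_Z gl).
Qed.

Lemma lbr_sumr n (k : 'I_n -> K) (F : 'I_n -> L) z :
  lbr z (\sum_l k l *: F l) = \sum_l k l *: lbr z (F l).
Proof.
have gl c u v : lbr z (c *: u + v) = c *: lbr z u + lbr z v by exact: lbr_linearr.
by rewrite (lin_sum gl); apply: eq_bigr => l _; rewrite (lin_Z gl).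
Qed.

Lemma ad_oddP c a b i l : ad_odd (c *: a + b) i l = c * ad_odd a i l + ad_odd b i l.
Proof. by rewrite /ad_odd linearP lbr_linearl odd_coordP. Qed.

Lemma ad_odd_br a b k m :
  ad_odd (lbr a b) k m = \sum_l (ad_odd b k l * ad_odd a l m - ad_odd a k l * ad_odd b l m).
Proof.
have e (a' b' : even_part L) : lbr (vsval a' : L) (lbr (vsval b' : L) (y k)) =
    \sum_m (\sum_l ad_odd b' k l * ad_odd a' l m) *: y m.
  rewrite ad_oddE lbr_sumr.
  under eq_bigr do rewrite ad_oddE scaler_sumr.
  rewrite exchange_big; apply: eq_bigr => p _ /=; rewrite scaler_suml.
  by apply: eq_bigr => l _; rewrite scalerA.
rewrite /ad_odd even_part_brE.
have -> : lbr (lbr (vsval a : L) (vsval b)) (y k) =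
    lbr (vsval a : L) (lbr (vsval b : L) (y k)) - lbr (vsval b : L) (lbr (vsval a : L) (y k)).
  by rewrite (lbr_jacobi _ (even_mem a) (even_mem b)) expr0 scale1r addrK.
rewrite !e -sumrB; under eq_bigr do rewrite -scalerBl -sumrB.
by rewrite odd_coord_sum.
Qed.

Lemma br_odd_lbr a i j : lbr a (odd_lbr i j) =
  \sum_l ad_odd a i l *: odd_lbr l j + \sum_l ad_odd a j l *: odd_lbr i l.
Proof.
apply: subvs_inj; rewrite linearD !linear_sum even_part_brE odd_lbrE.
rewrite (lbr_jacobi _ (even_mem a) (odd_basis_mem i)) expr0 scale1r !ad_oddE.
rewrite lbr_suml lbr_sumr.
by congr (_ + _); apply: eq_bigr => l _; rewrite linearZ /= odd_lbrE.
Qed.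

Lemma odd_lbr_sym i j : odd_lbr i j = odd_lbr j i.
Proof.
by rewrite /odd_lbr (lbr_skew (odd_basis_mem i) (odd_basis_mem j)) expr1 scaleN1r opprK.
Qed.

(** The super Jacobi identity for three odd elements: turning the nested brackets around by
    skew-symmetry makes all signs equal. *)
Lemma odd_jacobi i j k l :
  ad_odd (odd_lbr i j) k l + ad_odd (odd_lbr j k) i l + ad_odd (odd_lbr k i) j l = 0.
Proof.
have sk p q r : lbr (y p) (lbr (y q) (y r)) = - lbr (lbr (y q) (y r)) (y p).
  rewrite (lbr_skew (odd_basis_mem p) (lbr_part (odd_basis_mem q) (odd_basis_mem r))).
  by rewrite expr0 scale1r.
have := lbr_jacobi (y k) (odd_basis_mem i) (odd_basis_mem j).
rewrite expr1 scaleN1r !sk opprK => e.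
rewrite /ad_odd !odd_lbrE.
have lc : lbr (y k) (y i) = lbr (y i) (y k).
  by rewrite -!odd_lbrE odd_lbr_sym.
rewrite lc -[odd_coord l _]mul1r -[odd_coord _ (lbr (lbr (y i) (y k)) _)]addr0.
have -> : lbr (lbr (y j) (y k)) (y i) =
    - (lbr (lbr (y i) (y j)) (y k) + lbr (lbr (y i) (y k)) (y j)).
  by rewrite -e opprK.
rewrite /odd_coord linearN linearD /= mul1r addr0; zmodule.
Qed.

End OddBasis.

(** * The relative Poincare-Birkhoff-Witt theorem in dual form *)

Section Words.
Variables (K : numFieldType) (L : lieSuper K) (M : supermod (even_part L)).
Notation d := (odd_dim L).
Local Notation y := (@odd_basis K L).

(* The letters are multiplied from right to left. *)
Fixpoint word_env (w : seq 'I_d) : env L :=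
  if w is i :: v then word_env v * egen (y i) else 1.

Lemma word_env_cat u w : word_env (u ++ w) = word_env w * word_env u.
Proof. by elim: u => [|i u IH] /=; rewrite ?mulr1 // IH mulrA. Qed.

Notation mact := (wact (@ad_odd K L) (@smod_act K (even_part L) M)).
Notation mgood := (good (@odd_lbr K L) (@ad_odd K L) (@smod_act K (even_part L) M)).

Lemma egen_sum (k : 'I_d -> K) (F : 'I_d -> L) :
  egen (\sum_i k i *: F i) = \sum_i econst L (k i) * egen (F i).
Proof.
have egen0 : egen 0 = 0 :> env L.
  have := egenP (-1) (0 : L) 0; rewrite scaler0 addr0 => ->.
  by rewrite econstN1 addNr.
elim: (index_enum _) => [|i s IH]; first by rewrite !big_nil.
by rewrite !big_cons egenP IH.
Qed.

Lemma egenD (x x' : L) : egen (x + x') = egen x + egen x'.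
Proof. by have := egenP 1 x x'; rewrite scale1r econst1 mul1r. Qed.

Lemma egen_comm (a : even_part L) i :
  egen (y i) * egen (vsval a : L) =
  egen (vsval a : L) * egen (y i) - \sum_l econst L (ad_odd a i l) * egen (y l).
Proof.
rewrite -egen_sum -ad_oddE (egen_lbr (even_mem a) (odd_basis_mem i)) expr0 econst1 mul1r.
by rewrite opprB addrC subrK.
Qed.

Lemma egen_anticomm i j :
  egen (y i) * egen (y j) + egen (y j) * egen (y i) = egen (vsval (odd_lbr i j) : L).
Proof.
rewrite odd_lbrE (egen_lbr (odd_basis_mem i) (odd_basis_mem j)) expr1 econstN1.
by rewrite opprK.
Qed.

Lemma coind_const (f : Coind_sort M) c u : f (econst L c * u) = c *: f u.
Proof. by rewrite -env_incl_const coind_funM env_act_const. Qed.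

Lemma coind_sum (f : Coind_sort M) (F : 'I_d -> env L) :
  f (\sum_i F i) = \sum_i f (F i).
Proof. apply: (big_morph f (coind_funD f)); exact: additive_at0 (coind_funD f). Qed.

Lemma coind_fun0 (f : Coind_sort M) : f 0 = 0.
Proof. exact: additive_at0 (coind_funD f). Qed.

Lemma coind_funN (f : Coind_sort M) u : f (- u) = - f u.
Proof. by apply: (addrI (f u)); rewrite -coind_funD !subrr coind_fun0. Qed.

Definition coind_rmul (v : env L) (f : Coind_sort M) : Coind_sort M.
Proof.
exists (fun u => f (u * v)) => [u u'|s u]; first by rewrite mulrDl coind_funD.
by rewrite -mulrA coind_funM.
Defined.

(** Justifies the recursion of [wact]: [egen_comm] moves [a] leftwards through the product until
    linearity over U(g_0) extracts it. *)
Lemma coind_wact (f : Coind_sort M) a w :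
  mact a (fun t => f (word_env t)) w = f (word_env w * egen (vsval a : L)).
Proof.
elim: w f => [|k v IH] f.
  by rewrite /= mul1r -[egen _]mulr1 -env_incl_gen coind_funM env_act_gen.
rewrite wact_cons (IH (Coind_act (y k) f)) /=.
rewrite -[_ * egen (y k) * _]mulrA egen_comm mulrBr coind_funD coind_funN mulr_sumr.
rewrite coind_sum mulrA; congr (_ - _); apply: eq_bigr => l _.
by rewrite mulrA -econstC -mulrA coind_const.
Qed.

Lemma coind_good n (f : Coind_sort M) : mgood n (fun t => f (word_env t)).
Proof.
move=> u i j v _; rewrite !word_env_cat /= -coind_funD -mulrDl -!(mulrA (word_env v)).
rewrite -mulrDr [_ + egen (y i) * _]addrC egen_anticomm.
have := coind_wact (coind_rmul (word_env u) f) (odd_lbr i j) v.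
by rewrite /= => <-; apply: wact_ext => t _; rewrite word_env_cat.
Qed.

(* A good function f extends to the coinduced function whose value at u is the *)
(* value at the empty word of the translate of f by u.                         *)
Let even_proj (x : L) : even_part L :=
  vsproj (lie_part L false) (daddv_pi (lie_part L false) (lie_part L true) x).
Let odd_proj (x : L) : L := daddv_pi (lie_part L true) (lie_part L false) x.

Let proj_even x : x \in lie_part L false -> vsval (even_proj x) = x :> L /\ odd_proj x = 0.
Proof.
move=> x0; rewrite /even_proj /odd_proj daddv_pi_id ?lie_part_cap // vsprojK //; split=> //.
have := daddv_pi_add (lie_part_cap L) (w := x); rewrite lie_part_sum memvf => /(_ isT).
rewrite (daddv_pi_id (lie_part_cap L)) // => e.
by apply: (addrI x); rewrite e addr0.
Qed.

Let proj_odd x : x \in lie_part L true -> even_proj x = 0 /\ odd_proj x = x.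
Proof.
move=> x1; rewrite /even_proj /odd_proj.
have e : daddv_pi (lie_part L true) (lie_part L false) x = x.
  by rewrite daddv_pi_id // capvC lie_part_cap.
split=> //; have := daddv_pi_add (lie_part_cap L) (w := x).
rewrite lie_part_sum memvf => /(_ isT); rewrite e => {}e.
by rewrite (addIr x (etrans e (esym (add0r x)))) linear0.
Qed.

(** Right translation by [x]. Products are read from right to left, so multiplying by an odd basis
    element on the right prepends a letter. *)
Let gact (x : L) (f : seq 'I_d -> M) w : M :=
  mact (even_proj x) f w + \sum_i odd_coord i (odd_proj x) *: f (i :: w).

Fixpoint tact (t : uterm L) (f : seq 'I_d -> M) (w : seq 'I_d) : M :=
  match t with
  | UConst c => c *: f w
  | UGen x => gact x f w
  | UAdd s t => tact s f w + tact t f w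
  | UMul s t => tact s (tact t f) w
  end.

Let rr : forall (a : even_part L) (k : K) (m n : M),
  smod_act a (k *: m + n) = k *: smod_act a m + smod_act a n.
Proof. by move=> a k m n; apply: smod_actr. Qed.
Let rl : forall (k : K) (a b : even_part L) (m : M),
  smod_act (k *: a + b) m = k *: smod_act a m + smod_act b m.
Proof. by move=> k a b m; apply: smod_actl. Qed.
Let rb : forall (a b : even_part L) (m : M),
  smod_act (lbr a b) m = smod_act a (smod_act b m) - smod_act b (smod_act a m).
Proof.
move=> a b m; have mem (x : even_part L) : x \in lie_part (even_part L) false by rewrite memvf.
by rewrite (smod_act_lbr _ (mem a) (mem b)) expr0 scale1r.
Qed.

Let maP := wactP (@ad_odd K L) rr.
Let maPl := wactPl rl (@ad_oddP K L).

Let gactP x k f h w : gact x (fun t => k *: f t + h t) w = k *: gact x f w + gact x h w.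
Proof.
rewrite /gact maP scalerDr addrACA; congr (_ + _).
rewrite scaler_sumr -big_split; apply: eq_bigr => i _.
by rewrite scalerDr !scalerA mulrC.
Qed.

Let gactPl k x x' f w : gact (k *: x + x') f w = k *: gact x f w + gact x' f w.
Proof.
rewrite /gact /even_proj /odd_proj !linearP maPl scalerDr addrACA; congr (_ + _).
rewrite scaler_sumr -big_split; apply: eq_bigr => i _.
by rewrite odd_coordP scalerDl scalerA.
Qed.

Lemma tactP t k f h w : tact t (fun t => k *: f t + h t) w = k *: tact t f w + tact t h w.
Proof.
elim: t f h w => [c|x|s IHs t IHt|s IHs t IHt] f h w /=.
- by rewrite scalerDr !scalerA mulrC.
- exact: gactP.
- by rewrite IHs IHt scalerDr addrACA.
- by rewrite -IHs; congr tact; apply: funext => v; rewrite IHt.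
Qed.

Let all_good f := forall n, mgood n f.

Let goodP k f h : all_good f -> all_good h -> all_good (fun t => k *: f t + h t).
Proof.
move=> gf gh n u i j v uv; rewrite addrACA -scalerDr (gf n) // (gh n) //.
Qed.

Let good_shift f i : all_good f -> all_good (fun t => f (i :: t)).
Proof. by move=> gf n; apply: good_cons. Qed.

Let good_0 : all_good (fun=> 0).
Proof. by move=> n u i j v _; rewrite addr0 (wact0 _ rr). Qed.

Let good_gact x f : all_good f -> all_good (gact x f).
Proof.
move=> gf; rewrite /gact.
elim: (index_enum _) => [|i s IH].
  rewrite (_ : (fun w => _) = mact (even_proj x) f); last first.
    by apply: funext => w; rewrite big_nil addr0.
  move=> n; apply: (good_wact rr rl (@ad_oddP K L) rb (@ad_odd_br K L) (@br_odd_lbr K L)).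
  exact: gf.
rewrite (_ : (fun w => _) = fun w => odd_coord i (odd_proj x) *: f (i :: w) +
  (mact (even_proj x) f w + \sum_(j <- s) odd_coord j (odd_proj x) *: f (j :: w))); last first.
  by apply: funext => w; rewrite big_cons addrCA.
by apply: goodP => //; apply: good_shift.
Qed.

Let good_tact t f : all_good f -> all_good (tact t f).
Proof.
elim: t f => [c|x|s IHs t IHt|s IHs t IHt] f gf.
- rewrite (_ : tact _ f = fun w => c *: f w + 0); first exact: goodP.
  by apply: funext => w; rewrite addr0.
- exact: good_gact.
- rewrite (_ : tact _ f = fun w => 1 *: tact s f w + tact t f w).
    by apply: goodP; [exact: IHs | exact: IHt].
  by apply: funext => w; rewrite scale1r.
- exact: (IHs (tact t f) (IHt f gf)).
Qed.

Let gact_even a f w : gact (vsval (a : even_part L)) f w = mact a f w.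
Proof.
have [e1 e2] := proj_even (even_mem a); rewrite /gact e2 (_ : even_proj _ = a);
  last exact: subvs_inj.
by rewrite big1 ?addr0 // => i _; rewrite /odd_coord linear0 scale0r.
Qed.

Let gact_odd x f w : x \in lie_part L true ->
  gact x f w = \sum_i odd_coord i x *: f (i :: w).
Proof.
by move=> x1; have [e1 e2] := proj_odd x1; rewrite /gact e1 e2
  (wact0l rl (@ad_oddP K L)) add0r.
Qed.

Let gact_basis i f w : gact (y i) f w = f (i :: w).
Proof.
rewrite gact_odd ?odd_basis_mem // (bigD1 i) //= big1 => [|j ji].
  by rewrite odd_coord_basis eqxx scale1r addr0.
by rewrite odd_coord_basis eq_sym (negPf ji) scale0r.
Qed.

Let gact_lbr_basis (a : even_part L) i f w :
  gact (lbr (vsval a : L) (y i)) f w =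
  gact (vsval a : L) (gact (y i) f) w - gact (y i) (gact (vsval a : L) f) w.
Proof.
rewrite ad_oddE gact_odd; last by rewrite memv_suml // => l _; rewrite memvZ ?odd_basis_mem.
rewrite gact_basis !gact_even wact_cons.
rewrite opprB addrC -addrA.
under [X in X = _]eq_bigr do rewrite odd_coord_sum.
rewrite [X in _ = _ + X](_ : _ = 0) ?addr0 //; apply/eqP; rewrite addrC subr_eq0; apply/eqP.
by apply: wact_ext => t _; rewrite gact_basis.
Qed.

(** The one bracket that needs [f] to be good; brackets with an even element hold for every function
    of words. *)
Let good_anticomm i j f w : all_good f ->
  gact (lbr (y i) (y j)) f w = gact (y i) (gact (y j) f) w + gact (y j) (gact (y i) f) w.
Proof.
by move=> gf; rewrite -odd_lbrE gact_even !gact_basis addrC (gf (size w + 2)%N [::] i j w).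
Qed.

Let gact_suml (k : 'I_d -> K) (F : 'I_d -> L) f w :
  gact (\sum_l k l *: F l) f w = \sum_l k l *: gact (F l) f w.
Proof.
have gl c u v : gact (c *: u + v) f w = c *: gact u f w + gact v f w by exact: gactPl.
by rewrite (lin_sum gl); apply: eq_bigr => l _; rewrite (lin_Z gl).
Qed.

Let gact0 x w : gact x (fun=> 0) w = 0.
Proof. by rewrite /gact (wact0 _ rr) add0r big1 // => i _; rewrite scaler0. Qed.

Let gact_sumr x (k : 'I_d -> K) (F : 'I_d -> seq 'I_d -> M) w :
  gact x (fun t => \sum_l k l *: F l t) w = \sum_l k l *: gact x (F l) w.
Proof.
elim: (index_enum _) => [|l s IH].
  rewrite big_nil -[RHS](gact0 x w); congr gact.
  by apply: funext => t; rewrite big_nil.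
rewrite big_cons -IH -gactP; congr gact.
by apply: funext => t; rewrite big_cons.
Qed.

Let gact_sumE (k : 'I_d -> K) (F : 'I_d -> L) f :
  gact (\sum_l k l *: F l) f = fun w => \sum_l k l *: gact (F l) f w.
Proof. by apply: funext => w; rewrite gact_suml. Qed.

Let gact_even_odd (a : even_part L) x f w : x \in lie_part L true ->
  gact (lbr (vsval a : L) x) f w =
  gact (vsval a : L) (gact x f) w - gact x (gact (vsval a : L) f) w.
Proof.
move=> /odd_coordE ->; rewrite lbr_sumr !gact_sumE gact_sumr -sumrB.
by apply: eq_bigr => i _; rewrite -scalerBr gact_lbr_basis.
Qed.

Let gact_odd_odd x x' f w : all_good f -> x \in lie_part L true -> x' \in lie_part L true ->
  gact (lbr x x') f w = gact x (gact x' f) w + gact x' (gact x f) w.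
Proof.
move=> gf /odd_coordE -> /odd_coordE ->; rewrite lbr_suml !gact_sumE.
under [X in X = _]eq_bigr do rewrite lbr_sumr gact_suml.
under [X in _ = X + _]eq_bigr do rewrite gact_sumr.
under [X in _ = _ + X]eq_bigr do rewrite gact_sumr scaler_sumr.
rewrite [X in _ = _ + X]exchange_big -big_split; apply: eq_bigr => i _ /=.
rewrite !scaler_sumr -big_split /=; apply: eq_bigr => j _ /=.
by rewrite good_anticomm // !scalerDr !scalerA [_ * odd_coord i _]mulrC.
Qed.

Let gact_lbr a b x x' f w : x \in lie_part L a -> x' \in lie_part L b -> all_good f ->
  gact (lbr x x') f w = gact x (gact x' f) w - (-1) ^+ (a && b) *: gact x' (gact x f) w.
Proof.
move=> xa xb gf; case: a b xa xb => [] [] xa xb /=; rewrite ?expr1 ?scaleN1r ?opprK ?expr0 ?scale1r.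
- exact: gact_odd_odd.
- rewrite (lbr_skew xa xb) expr0 scale1r -(proj_even xb).1.
  have gl c u v : gact (c *: u + v) f w = c *: gact u f w + gact v f w by exact: gactPl.
  by rewrite (lin_N gl) gact_even_odd // opprB.
- by rewrite -(proj_even xa).1; apply: gact_even_odd.
- rewrite -(proj_even xa).1 -(proj_even xb).1 -even_part_brE !gact_even.
  rewrite (wact_br rr rb (@ad_odd_br K L)).
  by congr (_ - _); apply: wact_ext => t _; rewrite gact_even.
Qed.

(** Good functions form a U(g)-module: the defining relations hold on them, and [good_tact] keeps
    the inner function good in a product. *)
Let tact_ueq s t : ueq s t -> forall f, all_good f -> tact s f = tact t f.
Proof.
have tactD u f h w : tact u (fun t => f t + h t) w = tact u f w + tact u h w.
  have := tactP u 1 f h w; rewrite scale1r => <-; congr tact.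
  by apply: funext => v; rewrite scale1r.
have tactZ u c f w : tact u (fun t => c *: f t) w = c *: tact u f w.
  have t0 : tact u (fun=> 0) w = 0.
    apply: (addrI (tact u (fun=> 0) w)); rewrite addr0 -[LHS]tactD; congr tact.
    by apply: funext => v; rewrite addr0.
  have := tactP u c f (fun=> 0) w; rewrite t0 addr0 => <-; congr tact.
  by apply: funext => v; rewrite addr0.
elim=> {s t}.
- by [].
- by move=> s t _ IH f gf; rewrite IH.
- by move=> s t u _ IH _ IH' f gf; rewrite IH // IH'.
- by move=> s s' t t' _ IH _ IH' f gf; apply: funext => w /=; rewrite IH // IH'.
- by move=> s s' t t' _ IH _ IH' f gf /=; rewrite IH' // IH //; apply: good_tact.
- by move=> s t u f gf; apply: funext => w /=; rewrite addrA.
- by move=> s t f gf; apply: funext => w /=; rewrite addrC.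
- by move=> t f gf; apply: funext => w /=; rewrite scale0r add0r.
- by move=> t f gf; apply: funext => w /=; rewrite scaleN1r addNr scale0r.
- by move=> s t u f gf; apply: funext => w /=.
- by move=> t f gf; apply: funext => w /=; rewrite scale1r.
- by move=> t f gf; apply: funext => w /=; rewrite tactZ scale1r.
- by move=> s t u f gf; apply: funext => w /=.
- by move=> s t u f gf; apply: funext => w /=; rewrite tactD.
- by move=> c c' f gf; apply: funext => w /=; rewrite scalerDl.
- by move=> c c' f gf; apply: funext => w /=; rewrite scalerA.
- by move=> c t f gf; apply: funext => w /=; rewrite tactZ.
- by move=> c x x' f gf; apply: funext => w /=; rewrite gactPl.
- move=> a b x x' xa xb f gf; apply: funext => w /=.
  by rewrite (gact_lbr _ xa xb) // scaleNr.
Qed.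

Let eact (u : env L) f := tact (repr u) f.

Let eact_pi t f : all_good f -> eact (upi t) f = tact t f.
Proof. by move=> gf; apply: tact_ueq => //; apply: ueq_repr. Qed.

Let eactD u v f : all_good f -> eact (u + v) f [::] = eact u f [::] + eact v f [::].
Proof.
move=> gf; elim/env_ind: u => s; elim/env_ind: v => t.
by rewrite {1}/GRing.add /= -upiD !eact_pi.
Qed.

Let eactM u v f : all_good f -> eact (u * v) f = eact u (eact v f).
Proof.
move=> gf; elim/env_ind: u => s; elim/env_ind: v => t.
by rewrite {1}/GRing.mul /= -upiM !eact_pi // ; apply: good_tact.
Qed.

Let eact_incl s f : all_good f -> eact (env_incl s) f [::] = env_act s (f [::]).
Proof.
move=> gf; elim/env_ind: s => s; rewrite env_incl_pi eact_pi // env_act_pi.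
elim: s f gf => [c|x|s IHs t IHt|s IHs t IHt] f gf //=.
- by rewrite IHs // IHt.
- by rewrite IHs ?IHt //; apply: good_tact.
Qed.

Let eact_word w f : all_good f -> eact (word_env w) f [::] = f w.
Proof.
elim: w f => [|i v IH] f gf /=; first by rewrite eact_pi //= scale1r.
by rewrite eactM // eact_pi //= IH ?gact_basis //; apply: good_gact.
Qed.

(** Existence half of the relative PBW theorem: increasing words satisfy no relation over U(g_0), so
    values on them can be prescribed freely. *)
Lemma coind_exists (b : seq 'I_d -> M) : exists f : Coind_sort M,
  forall w, sorted (@incr d) w -> f (word_env w) = b w.
Proof.
have [f [gf fb]] := good_exists rr rl (@ad_oddP K L) rb (@ad_odd_br K L)
  (@br_odd_lbr K L) (@odd_lbr_sym K L) (@odd_jacobi K L) b.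
have fD u v : eact (u + v) f [::] = eact u f [::] + eact v f [::] by exact: eactD.
have fM s u : eact (env_incl s * u) f [::] = env_act s (eact u f [::]).
  by rewrite eactM // eact_incl //; apply: good_tact.
by exists (CoindFun fD fM) => w sw /=; rewrite eact_word // fb.
Qed.

Lemma coind_word_ext (f h : Coind_sort M) :
  (forall w, f (word_env w) = h (word_env w)) -> f = h.
Proof.
move=> fh; apply: coindP.
(* Vanishing on all words, rather than at 1, is what right translation by [u] preserves, so that the
   induction on [u] goes through. *)
suff van u (k : Coind_sort M) : (forall w, k (word_env w) = 0) ->
    forall w, k (word_env w * u) = 0.
  move=> u; apply/eqP; rewrite -subr_eq0; apply/eqP.
  have := van u (f - h) _ [::]; rewrite /= mul1r; apply => w.
  by rewrite -[LHS]/(f (word_env w) - h (word_env w)) fh subrr.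
elim/env_gen_ind: u k => [c|x|u v IHu IHv|u v IHu IHv] k k0 w.
- by rewrite -econstC coind_const k0 scaler0.
- have [_ _ dec _] := lie_grading L; have [x0 [x1 [X0 X1 ->]]] := dec x.
  rewrite egenD mulrDr coind_funD -(proj_even X0).1 -coind_wact.
  rewrite (_ : (fun t => k (word_env t)) = fun=> 0) ?(wact0 _ rr) ?add0r; last exact/funext.
  rewrite (odd_coordE X1) egen_sum mulr_sumr coind_sum.
  by rewrite big1 // => i _; rewrite mulrA -econstC -mulrA coind_const (k0 (i :: w)) scaler0.
- by rewrite mulrDr coind_funD IHu // IHv // addr0.
- by rewrite mulrA; apply: (IHu (coind_rmul v k)) => w' /=; apply: IHv.
Qed.

(** Uniqueness half of the relative PBW theorem: the relations reduce every word to increasing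
    ones. *)
Lemma coind_incr_ext (f h : Coind_sort M) :
  (forall w, sorted (@incr d) w -> f (word_env w) = h (word_env w)) -> f = h.
Proof.
move=> fh; apply: coind_word_ext => w.
apply/eqP; rewrite -subr_eq0 -[_ - _]/((f - h) (word_env w)); apply/eqP.
apply: (good_vanish rr (coind_good (f - h)) _ (leqnn (size w))) => t _ st.
by rewrite -[LHS]/(f (word_env t) - h (word_env t)) fh // subrr.
Qed.

End Words.

(** * Morphisms and adjunctions *)

Section Morphisms.
Variables (K : numFieldType) (L : lieSuper K).
Implicit Types M N P : supermod L.

Lemma shom_id M : is_shom (fun m : M => m).
Proof. by split. Qed.

Lemma shom_comp M N P (f : N -> P) (h : M -> N) :
  is_shom f -> is_shom h -> is_shom (fun m => f (h m)).
Proof.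
move=> [fl fp fa] [hl hp ha]; split=> [c m m'|a m am|x m].
- by rewrite hl fl.
- exact/fp/hp.
- by rewrite ha fa.
Qed.

Lemma smod_part0 M a : smod_part M a 0.
Proof. by have [] := smod_grading M. Qed.

Lemma smod_actD M (x : L) (m n : M) : smod_act x (m + n) = smod_act x m + smod_act x n.
Proof. exact: (lin_D (fun c u v => smod_actr c x u v)). Qed.

Lemma smod_actN M (x : L) (m : M) : smod_act x (- m) = - smod_act x m.
Proof. exact: (lin_N (fun c u v => smod_actr c x u v)). Qed.

Lemma smod_act0 M (x : L) : smod_act x (0 : M) = 0.
Proof. exact: (lin_0 (fun c u v => smod_actr c x u v)). Qed.

Lemma shom_0 M N : is_shom (fun _ : M => 0 : N).
Proof.
split=> [c m m'|a m _|x m]; first by rewrite scaler0 addr0.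
  exact: smod_part0.
by rewrite smod_act0.
Qed.

Lemma shom_add M N (f h : M -> N) : is_shom f -> is_shom h -> is_shom (fun m => f m + h m).
Proof.
move=> [fl fp fa] [hl hp ha]; split=> [c m m'|a m am|x m].
- by rewrite fl hl scalerDr addrACA.
- have [_ PP _ _] := smod_grading N.
  by rewrite -[f m]scale1r; apply: PP; [exact: fp | exact: hp].
- by rewrite fa ha smod_actD.
Qed.

Lemma shom_opp M N (f : M -> N) : is_shom f -> is_shom (fun m => - f m).
Proof.
move=> [fl fp fa]; split=> [c m m'|a m am|x m].
- by rewrite fl opprD scalerN.
- have [P0 PP _ _] := smod_grading N.
  by rewrite -scaleN1r -[_ *: _]addr0; apply: PP; [exact: fp | exact: P0].
- by rewrite fa smod_actN.
Qed.

Lemma shom_sub M N (f h : M -> N) : is_shom f -> is_shom h -> is_shom (fun m => f m - h m).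
Proof. by move=> fs hs; apply: shom_add => //; apply: shom_opp. Qed.

Lemma shomD M N (f : M -> N) m m' : is_shom f -> f (m + m') = f m + f m'.
Proof. by case=> fl _ _; apply: lin_D. Qed.
Lemma shomB M N (f : M -> N) m m' : is_shom f -> f (m - m') = f m - f m'.
Proof. by case=> fl _ _; apply: lin_B. Qed.
Lemma shom0 M N (f : M -> N) : is_shom f -> f 0 = 0.
Proof. by case=> fl _ _; apply: lin_0. Qed.

(** An injective morphism reflects parity as well: it sends the component of the wrong parity to an
    element of both parities, hence to 0. *)
Lemma shom_factor_inj M N P (i : N -> P) (f : M -> N) :
  is_shom i -> injective i -> is_shom (fun m => i (f m)) -> is_shom f.
Proof.
move=> si ii [fl fp fa].
have [il ip ia] := si.
have flin c m m' : f (c *: m + m') = c *: f m + f m'.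
  by apply: ii; rewrite fl il.
split=> // [a m am|x m]; last by apply: ii; rewrite fa ia.
have [N0 NP Ndec Ncap] := smod_grading N.
have [P0 PP Pdec Pcap] := smod_grading P.
have key v0 v1 b : smod_part N false v0 -> smod_part N true v1 -> smod_part P b (i (v0 + v1)) ->
    smod_part N b (v0 + v1).
  move=> h0 h1 hb.
  have PD c (u v : P) : smod_part P c u -> smod_part P c v -> smod_part P c (u - v).
    by move=> hu hv; rewrite addrC -scaleN1r; apply: PP.
  rewrite (shomD _ _ si) in hb.
  case: b hb => hb.
    have /ii -> : i v0 = i 0; last by rewrite add0r.
    rewrite (shom0 si); apply: Pcap; first exact: ip.
    rewrite -[i v0](addrK (i v1)); apply: PD => //; exact: ip.
  have /ii -> : i v1 = i 0; last by rewrite addr0.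
  rewrite (shom0 si); apply: Pcap; last exact: ip.
  rewrite -[i v1](addrK (i v0)) [i v1 + _]addrC; apply: PD => //; exact: ip.
have [v0 [v1 [h0 h1 e]]] := Ndec (f m).
by rewrite e; apply: key => //; rewrite -e; apply: fp.
Qed.

Lemma shom_inv M N (f : M -> N) : is_shom f -> bijective f ->
  exists2 h : N -> M, is_shom h & cancel f h /\ cancel h f.
Proof.
move=> fs [h fh hf]; exists h => //; apply: (shom_factor_inj fs).
  exact: can_inj fh.
have -> : (fun m => f (h m)) = (fun m => m) by apply: funext => m; rewrite hf.
exact: shom_id.
Qed.

Lemma smod_iso_refl M : smod_iso M M.
Proof. by exists (fun m => m); [exact: shom_id | exists (fun m => m)]. Qed.

Lemma shom_env_act M N (f : M -> N) u m : is_shom f -> f (env_act u m) = env_act u (f m).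
Proof.
move=> fs; have [fl _ fa] := fs.
elim/env_gen_ind: u m => [c|x|u v IHu IHv|u v IHu IHv] m.
- by rewrite !env_act_const (lin_Z fl).
- by rewrite !env_act_gen fa.
- by rewrite !env_actDl (shomD _ _ fs) IHu IHv.
- by rewrite !env_actM IHu IHv.
Qed.

Lemma env_act_part M a b u (m : M) : env_part a u -> smod_part M b m ->
  smod_part M (a (+) b) (env_act u m).
Proof.
move=> ua; elim: ua b m => {a u} [c|a x xa|a u v _ IHu _ IHv|a a' u v _ IHu _ IHv] b m mb.
- have [P0 PP _ _] := smod_grading M.
  by rewrite env_act_const -[_ *: _]addr0; apply: PP => //; apply: P0.
- by rewrite env_act_gen; apply: smod_act_part.
- have [P0 PP _ _] := smod_grading M.
  by rewrite env_actDl -[env_act u m]scale1r; apply: PP; [exact: IHu | exact: IHv].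
- by rewrite env_actM -addbA; apply/IHu/IHv.
Qed.
End Morphisms.

(** * The adjunctions of [Ind] and [Coind] with [Res] *)

Section Adjunctions.
Variables (K : numFieldType) (L : lieSuper K).

Lemma shom_Res (N P : supermod L) (f : N -> P) :
  is_shom f -> @is_shom _ _ (Res N) (Res P) f.
Proof. by case=> fl fp fa; split=> // x m; apply: fa. Qed.

Lemma env_act_Res (N : supermod L) s (n : N) :
  env_act (env_incl s) n = env_act s (n : Res N).
Proof.
elim/env_gen_ind: s n => [c|x|u v IHu IHv|u v IHu IHv] n.
- by rewrite env_incl_const !env_act_const.
- by rewrite env_incl_gen !env_act_gen.
- by rewrite env_inclD !env_actDl IHu IHv.
- by rewrite env_inclM !env_actM IHv IHu.
Qed.

Lemma coind_env_act (M : supermod (even_part L)) u (f : Coind M) v :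
  env_act u f v = f (v * u).
Proof.
elim/env_gen_ind: u f v => [c|x|u u' IHu IHv|u u' IHu IHv] f v.
- by rewrite env_act_const -econstC coind_const.
- by rewrite env_act_gen.
- by rewrite env_actDl mulrDr coind_funD -IHu -IHv.
- by rewrite env_actM IHu IHv mulrA.
Qed.

Section CoindLift.
Variables (N : supermod L) (M : supermod (even_part L)) (h : N -> M).
Hypothesis hs : @is_shom _ _ (Res N) M h.

Definition Coind_lift (n : N) : Coind_sort M.
Proof.
exists (fun u => h (env_act u n)) => [u v|s u].
  by rewrite env_actDl (shomD _ _ hs).
by rewrite env_actM env_act_Res (shom_env_act _ _ hs).
Defined.

Lemma shom_Coind_lift : @is_shom _ _ N (Coind M) Coind_lift.
Proof.
have [hl hp ha] := hs.
split=> [c m m'|a m am|x m].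
- by apply: coindP => u /=; rewrite env_actP hl.
- by move=> b u ub /=; apply: hp; rewrite addbC; apply: env_act_part.
- by apply: coindP => u /=; rewrite env_actM env_act_gen.
Qed.

Lemma Coind_lift1 n : Coind_lift n 1 = h n.
Proof. by rewrite /= -econst1 env_act_const scale1r. Qed.
End CoindLift.

Lemma shom_Coind_ev (M : supermod (even_part L)) :
  @is_shom _ _ (Res (Coind M)) M (fun f : Coind M => f 1).
Proof.
split=> [c f h //|a f af|x f].
  by rewrite -[a]addbF; apply: af; rewrite -econst1; apply: env_part_const.
by rewrite /= mul1r -[egen _]mulr1 -env_incl_gen coind_funM env_act_gen.
Qed.

Lemma Coind_hom_ext (N : supermod L) (M : supermod (even_part L)) (f h : N -> Coind M) :
  is_shom f -> is_shom h -> (forall n, f n 1 = h n 1) -> f = h.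
Proof.
move=> fs hs fh; apply: funext => n; apply: coindP => u.
by rewrite -[u]mul1r -!coind_env_act -!shom_env_act.
Qed.

Lemma ind_env_act (M : supermod (even_part L)) u (z : Ind M) : env_act u z = tscale u z.
Proof.
elim/env_gen_ind: u z => [c|x|u u' IHu IHv|u u' IHu IHv] z.
- by rewrite env_act_const.
- by rewrite env_act_gen.
- by rewrite env_actDl tscaleDl IHu IHv.
- by rewrite env_actM -tscaleA IHu IHv.
Qed.

Lemma env_act_pure (M : supermod (even_part L)) u v (m : M) :
  env_act u (Ind_pure v m : Ind M) = Ind_pure (u * v) m.
Proof. by rewrite ind_env_act; apply: tscale_pure. Qed.

Definition Ind_unit (M : supermod (even_part L)) (m : M) : Ind M := Ind_pure 1 m.

Lemma Ind_pureE (M : supermod (even_part L)) u (m : M) :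
  Ind_pure u m = env_act u (Ind_unit m).
Proof. by rewrite env_act_pure mulr1. Qed.

Lemma shom_Ind_unit (M : supermod (even_part L)) : @is_shom _ _ M (Res (Ind M)) (@Ind_unit M).
Proof.
have act s (m : M) : Ind_unit (env_act s m) = env_act (env_incl s) (Ind_unit m).
  by rewrite env_act_pure mulr1 -[env_incl s]mul1r; apply/esym/tpure_balanced.
split=> [c m m'|a m am|x m].
- rewrite [LHS]tpureDr; congr (_ + _).
  by rewrite -env_act_const -[LHS]/(Ind_unit _) act env_incl_const env_act_const.
- by rewrite -[a]addFb; apply: Ind_part_pure => //; rewrite -econst1; apply: env_part_const.
- by rewrite -env_act_gen act env_incl_gen env_act_gen.
Qed.

Lemma Ind_ind (M : supermod (even_part L)) (S : Ind M -> Prop) :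
  (forall u m, S (env_act u (Ind_unit m))) -> (forall z, S z -> S (- z)) -> S 0 ->
  (forall z z', S z -> S z' -> S (z + z')) -> forall z, S z.
Proof.
move=> Sp SN S0 SD z; apply: (@tensor_ind _ _ _ _ _ S) => // u m.
by rewrite -/(Ind_pure u m) Ind_pureE.
Qed.

Lemma Ind_hom_ext (M : supermod (even_part L)) (N : supermod L) (f h : Ind M -> N) :
  is_shom f -> is_shom h -> (forall m, f (Ind_unit m) = h (Ind_unit m)) -> f = h.
Proof.
move=> fs hs fh; apply: funext => z.
elim/Ind_ind: z => [u m|z IH||z z' IH IH'].
- by rewrite !shom_env_act // fh.
- by case: fs => fl _ _; case: hs => hl _ _; rewrite (lin_N fl) (lin_N hl) IH.
- by rewrite !shom0.
- by rewrite !shomD // IH IH'.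
Qed.

Section IndLift.
Variables (N : supermod L) (M : supermod (even_part L)) (h : M -> N).
Hypothesis hs : @is_shom _ _ M (Res N) h.

Fixpoint tterm_lift (t : tterm (env L) M) : N :=
  match t with
  | TPure u m => env_act u (h m)
  | TZero => 0
  | TOpp t => - tterm_lift t
  | TAdd s t => tterm_lift s + tterm_lift t
  end.

Let teq_lift s t : teq (@env_incl K L) (@env_act K (even_part L) M) s t ->
  tterm_lift s = tterm_lift t.
Proof.
elim=> {s t} //=.
- by move=> s t u _ -> _ ->.
- by move=> t t' _ ->.
- by move=> s s' t t' _ -> _ ->.
- by move=> s t u; rewrite addrA.
- by move=> s t; rewrite addrC.
- by move=> t; rewrite add0r.
- by move=> t; rewrite addNr.
- by move=> u v m; rewrite env_actDl.
- by move=> u m n; rewrite (shomD _ _ hs) env_actDr.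
- by move=> u s m; rewrite env_actM env_act_Res (shom_env_act _ _ hs).
Qed.

Definition Ind_lift (z : Ind M) : N := tterm_lift (repr z).

Let lift_pi t : Ind_lift (tpi _ _ t) = tterm_lift t.
Proof. exact/teq_lift/teq_repr. Qed.

Let liftD z z' : Ind_lift (z + z') = Ind_lift z + Ind_lift z'.
Proof.
elim/tensor_rep: z => t; elim/tensor_rep: z' => t'.
by rewrite -[tpi _ _ t + _]/(tadd _ _) -tpiD !lift_pi.
Qed.

Let lift_pure u m : Ind_lift (env_act u (Ind_unit m)) = env_act u (h m).
Proof. by rewrite -Ind_pureE; apply: lift_pi. Qed.

Let lift_act u z : Ind_lift (env_act u z) = env_act u (Ind_lift z).
Proof.
have l0 : Ind_lift 0 = 0 by exact: additive_at0 liftD.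
have lN z' : Ind_lift (- z') = - Ind_lift z'.
  by apply: (addrI (Ind_lift z')); rewrite -liftD !subrr.
elim/Ind_ind: z => [v m|z IH||z z' IH IH'].
- by rewrite -env_actM !lift_pure env_actM.
- by rewrite -scaleN1r env_actZ !scaleN1r !lN IH -scaleN1r -[in RHS]scaleN1r env_actZ.
- by rewrite !(env_act0r, l0).
- by rewrite env_actDr !liftD IH IH' env_actDr.
Qed.

Lemma Ind_lift_unit m : Ind_lift (Ind_unit m) = h m.
Proof. by have := lift_pure 1 m; rewrite -econst1 !env_act_const !scale1r. Qed.

Lemma shom_Ind_lift : is_shom Ind_lift.
Proof.
have [hl hp ha] := hs.
split=> [c z z'|a z az|x z].
- by rewrite liftD -!env_act_const lift_act.
- elim: az => {a z} [a|a z z' _ IH _ IH'|a b u m ua mb].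
  + by rewrite (additive_at0 liftD); apply: smod_part0.
  + have [_ PP _ _] := smod_grading N.
    by rewrite liftD -[Ind_lift z]scale1r; apply: PP.
  + by rewrite Ind_pureE lift_pure; apply: env_act_part => //; apply: hp.
- by rewrite -!env_act_gen lift_act.
Qed.
End IndLift.
End Adjunctions.

(** * Induction and coinduction agree up to a twist *)

Section IncreasingWords.
Variable d : nat.

Lemma incr_trans : transitive (@incr d).
Proof. by move=> j i k; apply: ltn_trans. Qed.

Lemma incr_irr : irreflexive (@incr d).
Proof. by move=> i; apply: ltnn. Qed.

Lemma incr_uniq w : sorted (@incr d) w -> uniq w.
Proof. exact: (sorted_uniq incr_trans incr_irr). Qed.

Lemma incr_enum (J : {set 'I_d}) : sorted (@incr d) (enum J).
Proof.
rewrite /enum_mem; apply: (sorted_filter incr_trans); rewrite -enumT.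
by have := iota_ltn_sorted 0 d; rewrite -val_enum_ord sorted_map.
Qed.

Lemma incr_wordE w : sorted (@incr d) w -> w = enum [set i in w].
Proof.
move=> sw; apply: (irr_sorted_eq incr_trans incr_irr sw (incr_enum _)) => i.
by rewrite mem_enum inE.
Qed.

Lemma uniq_word_leq (w : seq 'I_d) : uniq w -> (size w <= d)%N.
Proof. by move/card_uniqP <-; rewrite -[X in (_ <= X)%N](card_ord d) max_card. Qed.
End IncreasingWords.

(* The twist by the character [a |-> tr (ad a | g_1)], with the parity shifted  *)
(* by dim g_1: tensoring with the top exterior power of g_1, up to duality.     *)
Section Twist.
Variables (K : numFieldType) (L : lieSuper K) (M : supermod (even_part L)).
Notation d := (odd_dim L).

Definition odd_trace (a : even_part L) : K := \sum_i ad_odd a i i.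

Lemma odd_trace_br a b : odd_trace (lbr a b) = 0.
Proof.
rewrite /odd_trace; under eq_bigr do rewrite ad_odd_br sumrB.
rewrite sumrB [X in X - _]exchange_big /= -sumrB big1 // => i _.
by rewrite -sumrB big1 // => j _; rewrite mulrC subrr.
Qed.

Definition twist_part (a : bool) : set M := smod_part M (a (+) odd d).
Definition twist_act (x : even_part L) (m : M) : M := smod_act x m + odd_trace x *: m.

Fact twist_grading : is_grading twist_part.
Proof.
have [M0 MP Mdec Mcap] := smod_grading M; rewrite /twist_part; split=> [a|a|m|m].
- exact: M0.
- exact: MP.
- have [m0 [m1 [h0 h1 ->]]] := Mdec m.
  case: (odd d) => /=; last by exists m0, m1.
  by exists m1, m0; split=> //; apply: addrC.
- by case: (odd d) => //= h1 h0; apply: Mcap.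
Qed.

Fact twist_actl c x y m : twist_act (c *: x + y) m = c *: twist_act x m + twist_act y m.
Proof.
rewrite /twist_act smod_actl scalerDr addrACA; congr (_ + _).
rewrite scalerA -scalerDl; congr (_ *: _); rewrite /odd_trace mulr_sumr -big_split.
by apply: eq_bigr => i _; rewrite ad_oddP.
Qed.

Fact twist_actr c x m n : twist_act x (c *: m + n) = c *: twist_act x m + twist_act x n.
Proof.
rewrite /twist_act smod_actr !scalerDr addrACA; congr (_ + _).
by rewrite !scalerA mulrC.
Qed.

Let twist_act0 m : twist_act 0 m = 0.
Proof.
apply: (addrI (twist_act 0 m)).
by rewrite addr0 -{1}[twist_act 0 m]scale1r -twist_actl scaler0 addr0.
Qed.

Fact twist_act_part a b x m : x \in lie_part (even_part L) a ->
  twist_part b m -> twist_part (a (+) b) (twist_act x m).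
Proof.
have [M0 MP _ _] := smod_grading M.
rewrite /twist_part; case: a => /= [x0 _|_ mb].
  by move: x0; rewrite memv0 => /eqP ->; rewrite [twist_act _ _]twist_act0; apply: M0.
rewrite /twist_act addrC; apply: MP => //.
by have := smod_act_part (memvf x : x \in lie_part (even_part L) false) mb.
Qed.

Fact twist_act_lbr a b x y m :
    x \in lie_part (even_part L) a -> y \in lie_part (even_part L) b ->
  twist_act (lbr x y) m =
    twist_act x (twist_act y m) - (-1) ^+ (a && b) *: twist_act y (twist_act x m).
Proof.
move=> xa yb; case ab: (a && b).
  have z0 (z : even_part L) : z \in lie_part (even_part L) true -> z = 0.
    by rewrite memv0 => /eqP.
  have {xa}-> : x = 0 by apply: z0; case: a xa ab.
  have {yb}-> : y = 0 by apply: z0; case: b yb ab; rewrite ?andbF.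
  rewrite !twist_act0 scaler0 subr0.
  have -> : lbr (0 : even_part L) 0 = 0; last exact: twist_act0.
  have := lbr_linearl (0 : K) (0 : even_part L) 0 0; rewrite !scale0r !addr0 add0r => e.
  by apply: subvs_inj; rewrite even_part_brE; have := lbr_linearl (-1) (0 : L) 0 0;
    rewrite scaler0 addr0 scaleN1r addNr => ->.
rewrite expr0 scale1r /twist_act odd_trace_br scale0r addr0.
rewrite (smod_act_lbr _ xa yb) ab expr0 scale1r.
have sD z (u v : M) : smod_act z (u + v) = smod_act z u + smod_act z v by exact: smod_actD.
have sZ z k (u : M) : smod_act z (k *: u) = k *: smod_act z u.
  exact: (lin_Z (fun c u v => smod_actr c z u v)).
rewrite !sD !sZ !scalerDr !scalerA [odd_trace y * _]mulrC.
set p := smod_act x _; set q := odd_trace y *: smod_act x m; set r := odd_trace x *: _.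
set s := smod_act y _; set t := _ *: m.
zmodule.
Qed.

Definition twist : supermod (even_part L) :=
  Supermod twist_grading twist_actl twist_actr twist_act_part twist_act_lbr.
End Twist.

(** * The comparison map from induction to twisted coinduction *)

Section Frobenius.
Variables (K : numFieldType) (L : lieSuper K) (M : supermod (even_part L)).
Notation d := (odd_dim L).
Local Notation y := (@odd_basis K L).
Local Notation yw := (@word_env K L).

Lemma word_env_part w : env_part (odd (size w)) (yw w).
Proof.
elim: w => [|i v IH] /=; first by rewrite -econst1; apply: env_part_const.
by rewrite -addbT; apply: env_part_mul IH (env_part_gen (odd_basis_mem i)).
Qed.

(** The component of [f] of the other parity takes, on increasing words, values that lie in both
    parities. It therefore vanishes there, and so everywhere. *)
Lemma coind_part_incr (N : supermod (even_part L)) (f : Coind N) a :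
  (forall w, sorted (@incr d) w -> smod_part N (a (+) odd (size w)) (f (yw w))) ->
  smod_part (Coind N) a f.
Proof.
move=> fw; have [_ _ dec _] := smod_grading (Coind N).
have [f0 [f1 [h0 h1 ef]]] := dec f.
have [N0 NP _ Ncap] := smod_grading N.
have N_B c u v : smod_part N c u -> smod_part N c v -> smod_part N c (u - v).
  by move=> hu hv; rewrite addrC -scaleN1r; apply: NP.
have both b (n : N) : smod_part N b n -> smod_part N (~~ b) n -> n = 0.
  by case: b => /= hb hb'; apply: Ncap.
have key (g h : Coind N) : smod_part (Coind N) a g -> smod_part (Coind N) (~~ a) h ->
    f = g + h -> smod_part (Coind N) a f.
  move=> ga ha e; suff -> : f = g by [].
  apply: coind_incr_ext => w sw.
  have hw : h (yw w) = 0.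
    apply: (both (a (+) odd (size w))).
      have -> : h (yw w) = f (yw w) - g (yw w) by rewrite e addrC addKr.
      by apply: N_B; [exact: fw | apply: ga; exact: word_env_part].
    by rewrite -addNb; apply: ha; apply: word_env_part.
  by rewrite e -[LHS]/(g (yw w) + h (yw w)) hw addr0.
case: a fw key => fw key; last exact: (key f0 f1).
by apply: (key f1 f0) => //; rewrite addrC.
Qed.

Let M' := twist M.

Let theta_ex (m : M) : exists f : Coind_sort M', forall w, sorted (@incr d) w ->
  f (yw w) = if size w == d then m else 0.
Proof. exact: (coind_exists (M := M')). Qed.

(** The functional reading the coefficient of the top product, scaled by [m]. *)
Definition theta (m : M) : Coind M' := projT1 (cid (theta_ex m)).

Lemma theta_incr m w : sorted (@incr d) w -> theta m (yw w) = if size w == d then m else 0.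
Proof. exact: (projT2 (cid (theta_ex m))). Qed.

Let rr : forall (a : even_part L) (k : K) (m n : M'),
  smod_act a (k *: m + n) = k *: smod_act a m + smod_act a n.
Proof. by move=> a k m n; apply: smod_actr. Qed.

Lemma theta_small m w : (size w < d)%N -> theta m (yw w) = 0.
Proof.
move=> wd; apply: (good_vanish rr (coind_good (theta m)) _ (leqnn (size w))) => t tw st.
by rewrite theta_incr // ifF //; apply/negbTE; rewrite neq_ltn (leq_ltn_trans tw wd).
Qed.

Let perm_swap (u v : seq 'I_d) i j : perm_eq (u ++ i :: j :: v) (u ++ j :: i :: v).
Proof.
by rewrite perm_cat2l -cat1s -[j :: i :: v]cat1s -[j :: v]cat1s -[i :: v]cat1s perm_catCA.
Qed.

(** Swaps keep the repeated letter, so sorting never reaches the top word, and the corrections are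
    too short to contribute ([theta_small]). *)
Lemma theta_dup m w : size w = d -> ~~ uniq w -> theta m (yw w) = 0.
Proof.
move=> wd; apply: (good_bounded_ind rr (P := fun w => ~~ uniq w) (coind_good (n := d) (theta m)));
  rewrite ?wd //.
- by move=> u i j v; rewrite (perm_uniq (perm_swap _ _ _ _)).
- by move=> t td; apply: theta_small; lia.
- by move=> t _ nt /incr_uniq; rewrite (negPf nt).
Qed.

Lemma theta_uniq w : size w = d -> uniq w ->
  exists2 e : K, e != 0 & forall m, theta m (yw w) = e *: m.
Proof.
have [n] := ubnP (wgt w); elim: n w => // n IH w wn wd uw.
have [sw|/unsorted_descent] := boolP (sorted (@incr d) w).
  exists 1; first exact: oner_neq0.
  by move=> m; rewrite theta_incr // wd eqxx scale1r.
case=> u [i [j [v [ew ui ji]]]]; subst w.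
have ij : (j < i)%N.
  rewrite ltn_neqAle ji andbT; apply: contraTneq uw => /val_inj ->.
  by rewrite cat_uniq /= inE eqxx /= !andbF.
have [|||e e0 he] := IH (u ++ j :: i :: v).
- by rewrite -ltnS; apply: leq_trans wn; rewrite ltnS; apply: wgt_swap.
- by move: wd; rewrite !size_cat.
- by rewrite (perm_uniq (perm_swap _ _ _ _)).
exists (- e); first by rewrite oppr_eq0.
move=> m; have /(_ u i j v) := coind_good (n := d) (theta m).
have -> : wact (ad_odd (L:=L)) (@smod_act _ _ M') (odd_lbr i j)
    (fun t => theta m (yw (u ++ t))) v = 0.
  rewrite -[RHS](wact0 (@ad_odd K L) rr (odd_lbr i j) v); apply: wact_ext => t tv.
  by apply: theta_small; move: wd; rewrite !size_cat tv /=; lia.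
rewrite he => e'; apply: (addIr (e *: m)); rewrite -scalerDl addNr scale0r.
by apply: e'; move: wd; rewrite size_cat /=; lia.
Qed.

Lemma thetaP c m n : theta (c *: m + n) = c *: theta m + theta n.
Proof.
apply: coind_incr_ext => w sw.
rewrite -[RHS]/(c *: theta m (yw w) + theta n (yw w)) !theta_incr //.
by case: eqP; rewrite // scaler0 addr0.
Qed.

Lemma theta_part a m : smod_part M a m -> smod_part (Coind M') a (theta m).
Proof.
move=> am; apply: coind_part_incr => w sw; rewrite theta_incr //.
case: eqP => [->|_]; last exact: smod_part0.
by rewrite /= /twist_part -addbA addbb addbF.
Qed.

(** The purpose of the twist: moving [a] through the top word subtracts the trace of ad a on g_1
    ([wact_diag]), which is what [twist_act] adds. *)
Lemma theta_act a m : theta (smod_act a m) = smod_act (vsval a : L) (theta m).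
Proof.
apply: coind_incr_ext => w sw; rewrite -[RHS]/(theta m (yw w * egen (vsval a : L))) -coind_wact.
have uw := incr_uniq sw.
have [wd|wd] := eqVneq (size w) d; last first.
  rewrite theta_small; last by rewrite ltn_neqAle wd uniq_word_leq.
  rewrite -[LHS](wact0 (@ad_odd K L) rr a w); apply: wact_ext => t tw.
  by rewrite theta_small // tw ltn_neqAle wd uniq_word_leq.
(* A word of length d without repetition uses every letter, so its diagonal entries sum to the full
   trace; replacing one letter creates a repetition. *)
have all_w i : i \in w.
  have [|||_ ->] := @uniq_min_size _ w (enum 'I_d) => //.
  - by move=> j _; rewrite mem_enum.
  - by rewrite size_enum_ord wd.
  - by rewrite mem_enum.
rewrite wact_diag => [|u k v l ew lk].
  rewrite !theta_incr // wd eqxx /= /twist_act.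
  rewrite (perm_big (index_enum 'I_d)) /=; last first.
    apply: uniq_perm => //; first exact: index_enum_uniq.
    by move=> i; rewrite all_w mem_index_enum.
  by rewrite addrK.
apply: theta_dup; first by move: wd; rewrite ew !size_cat.
apply: contraTN (all_w l) => ul; rewrite ew mem_cat inE (negPf lk) /=.
by move: ul; rewrite cat_uniq /= negb_or => /and3P[_ /andP[/negPf-> _] /andP[/negPf-> _]].
Qed.

Lemma shom_theta : @is_shom _ _ M (Res (Coind M')) theta.
Proof.
split=> [c m n|a m|a m]; [exact: thetaP | exact: theta_part | exact: theta_act].
Qed.

Definition frobenius : Ind M -> Coind M' := Ind_lift theta.

Lemma shom_frobenius : is_shom frobenius.
Proof. exact: shom_Ind_lift shom_theta. Qed.

Lemma frobenius_word w w' m :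
  frobenius (env_act (yw w) (Ind_unit m)) (yw w') = theta m (yw (w ++ w')).
Proof.
rewrite (shom_env_act _ _ shom_frobenius) coind_env_act /frobenius (Ind_lift_unit shom_theta).
by rewrite word_env_cat.
Qed.

(** Triangularity: either the concatenation is shorter than d, or the sizes agree and J, not
    contained in I, shares a letter with its complement. *)
Lemma theta_compl (J I : {set 'I_d}) m : J != I -> (#|J| <= #|I|)%N ->
  theta m (yw (enum J ++ enum (~: I))) = 0.
Proof.
move=> JI cJI; have sz : size (enum J ++ enum (~: I)) = (#|J| + (d - #|I|))%N.
  by rewrite size_cat -!cardE [#|~: I|]cardsCs finset.setCK card_ord.
have Id : (#|I| <= d)%N by rewrite -[X in (_ <= X)%N](card_ord d) max_card.
have [lt|ge] := ltnP #|J| #|I|; first by apply: theta_small; rewrite sz; lia.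
apply: theta_dup; first by rewrite sz; lia.
apply: contra JI => /=; rewrite cat_uniq => /and3P[_ /hasPn h _].
rewrite eqEcard ge andbT; apply/fintype.subsetP => i iJ; apply/negPn/negP => iI.
by have := h i; rewrite !mem_enum inE iI iJ => /(_ isT).
Qed.

Lemma theta_compl_eq (J : {set 'I_d}) :
  exists2 e : K, e != 0 & forall m, theta m (yw (enum J ++ enum (~: J))) = e *: m.
Proof.
apply: theta_uniq.
  by rewrite size_cat -!cardE cardsC card_ord.
rewrite cat_uniq !enum_uniq /= andbT; apply/hasPn => i.
by rewrite !mem_enum inE.
Qed.

Lemma theta0 : theta 0 = 0.
Proof. exact: shom0 shom_theta. Qed.

Lemma frobenius_sum (x : {set 'I_d} -> M) w :
  frobenius (\sum_(J : {set 'I_d}) env_act (yw (enum J)) (Ind_unit (x J))) (yw w) =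
  \sum_(J : {set 'I_d}) theta (x J) (yw (enum J ++ w)).
Proof.
have fD := fun z z' => shomD z z' shom_frobenius.
rewrite (big_morph frobenius fD (shom0 shom_frobenius)).
rewrite (big_morph (fun f : Coind M' => f (yw w)) (id1 := 0) (op1 := +%R)) //.
by apply: eq_bigr => J _; rewrite frobenius_word.
Qed.

(** Evaluation at the complement of J isolates [x J]: smaller or equally large sets contribute 0 by
    [theta_compl], and larger ones by induction. *)
Lemma frobenius_sum_eq0 (x : {set 'I_d} -> M) :
  frobenius (\sum_(J : {set 'I_d}) env_act (yw (enum J)) (Ind_unit (x J))) = 0 -> forall J, x J = 0.
Proof.
move=> e J; have [n] := ubnP (d - #|J|); elim: n J => // n IH J Jn.
have := frobenius_sum x (enum (~: J)); rewrite e.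
have [k k0 hk] := theta_compl_eq J.
rewrite (bigD1 J) //= hk big1 ?addr0.
  by move/esym/eqP; rewrite scaler_eq0 (negPf k0) => /eqP.
move=> I IJ; have [le|gt] := leqP #|I| #|J|; first exact: theta_compl.
rewrite IH ?theta0 //.
have Id : (#|I| <= d)%N by rewrite -[X in (_ <= X)%N](card_ord d) max_card.
by move: Jn; rewrite !ltnS; lia.
Qed.

Lemma frobenius_surj (f : Coind M') : exists z, frobenius z = f.
Proof.
have H n : forall f : Coind M',
    (forall I : {set 'I_d}, (n <= #|I|)%N -> f (yw (enum (~: I))) = 0) ->
    exists z, frobenius z = f.
  elim: n => [|n IH] h h0.
    exists 0; rewrite (shom0 shom_frobenius); apply: coind_incr_ext => w sw.
    by rewrite (incr_wordE sw) -[[set i in w]]finset.setCK h0.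
  pose e J := projT1 (cid2 (theta_compl_eq J)).
  have e0 J : e J != 0 by rewrite /e; case: cid2.
  have he (J : {set 'I_d}) m : theta m (yw (enum J ++ enum (~: J))) = e J *: m.
    by rewrite /e; case: cid2.
  (* These coefficients cancel the values at complements of sets of size n. By [theta_compl] they
     leave unchanged the values, already 0, at complements of larger sets. *)
  pose x (J : {set 'I_d}) : M :=
    if #|J| == n then (e J)^-1 *: (h (yw (enum (~: J))) : M) else 0.
  pose z0 : Ind M := \sum_(J : {set 'I_d}) env_act (yw (enum J)) (Ind_unit (x J)).
  have [I nI|z hz] := IH (h - frobenius z0).
    rewrite -[LHS]/(h (yw (enum (~: I))) - frobenius z0 (yw (enum (~: I)))) frobenius_sum.
    apply/eqP; rewrite subr_eq0; apply/eqP.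
    have [eI|neI] := eqVneq #|I| n.
      rewrite (bigD1 I) //= he /x eI eqxx scalerA mulfV // scale1r big1 ?addr0 // => J JI.
      by case: eqP => [eJ|_]; rewrite ?theta0 // theta_compl // eJ eI.
    have {neI}nI : (n < #|I|)%N by rewrite ltn_neqAle eq_sym neI.
    rewrite h0 // big1 // => J _; rewrite /x.
    case: eqP => [eJ|_]; last by rewrite theta0.
    by rewrite theta_compl ?eJ 1?ltnW //; apply: contraTneq nI => <-; rewrite eJ ltnn.
  by exists (z + z0); rewrite (shomD _ _ shom_frobenius) hz subrK.
(* No subset has more than d elements, so here the vanishing condition is vacuous. *)
apply: (H d.+1) => I; rewrite ltnNge.
by rewrite -[X in ~~ (_ <= X)%N](card_ord d) max_card.
Qed.

End Frobenius.

(** * Induced modules as sums of copies of M indexed by subsets of the odd basis *)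

Section InductionBasis.
Variables (K : numFieldType) (L : lieSuper K) (M : supermod (even_part L)).
Notation d := (odd_dim L).
Local Notation y := (@odd_basis K L).
Local Notation yw := (@word_env K L).

Definition ind_comb (x : {set 'I_d} -> M) : Ind M :=
  \sum_(J : {set 'I_d}) env_act (yw (enum J)) (Ind_unit (x J)).

Let S (z : Ind M) := exists x, z = ind_comb x.

Let SP c z z' : S z -> S z' -> S (c *: z + z').
Proof.
move=> [x ->] [x' ->]; exists (fun J => c *: x J + x' J).
rewrite /ind_comb scaler_sumr -big_split; apply: eq_bigr => J _ /=.
have [ul _ _] := shom_Ind_unit M.
by rewrite ul [RHS]env_actP.
Qed.

Let S0 : S 0.
Proof.
exists (fun=> 0); rewrite /ind_comb big1 // => J _.
by rewrite (shom0 (shom_Ind_unit M)) env_act0r.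
Qed.

Let SD z z' : S z -> S z' -> S (z + z').
Proof. by rewrite -{2}[z]scale1r; apply: SP. Qed.
Let SZ c z : S z -> S (c *: z).
Proof. by rewrite -[c *: z]addr0 => h; apply: SP. Qed.
Let SN z : S z -> S (- z).
Proof. by rewrite -scaleN1r; apply: SZ. Qed.
Let Ssum (k : 'I_d -> K) (F : 'I_d -> Ind M) : (forall i, S (F i)) -> S (\sum_i k i *: F i).
Proof. by move=> SF; apply: (big_ind S) => // i _; apply: SZ. Qed.

(** The even factor is pushed to the right until it acts on [m]. Each correction replaces one odd
    letter, so the length of the word is kept. *)
Let S_move a (x : env L) u m :
  (forall u' m', size u' = size u -> S (env_act (x * yw u') (Ind_unit m'))) ->
  S (env_act (x * egen (vsval (a : even_part L) : L) * yw u) (Ind_unit m)).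
Proof.
elim/last_ind: u x m => [|u i IH] x m Su.
  have := Su [::] (smod_act a m) erefl; rewrite /= !mulr1 env_actM env_act_gen.
  by have [_ _ ->] := shom_Ind_unit M.
have yr j : yw (rcons u j) = egen (y j) * yw u by rewrite -cats1 word_env_cat /= mul1r.
have e : egen (vsval a : L) * egen (y i) =
    egen (y i) * egen (vsval a : L) + \sum_l econst L (ad_odd a i l) * egen (y l).
  by rewrite egen_comm subrK.
rewrite yr -!mulrA [egen _ * (egen _ * _)]mulrA e mulrDl mulrDr env_actDl; apply: SD.
  rewrite -mulrA mulrA [_ * (_ * yw u)]mulrA; apply: IH => u' m' su.
  have := Su (rcons u' i) m'; rewrite !size_rcons su => /(_ erefl).
  by rewrite -cats1 word_env_cat /= mul1r mulrA.
rewrite mulr_suml mulr_sumr.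
have actsum : env_act (\sum_l x * (econst L (ad_odd a i l) * egen (y l) * yw u)) (Ind_unit m) =
    \sum_l ad_odd a i l *: env_act (x * (egen (y l) * yw u)) (Ind_unit m).
  rewrite (big_morph (fun u => env_act u (Ind_unit m)) (id1 := 0) (op1 := +%R)).
  - apply: eq_bigr => l _; rewrite -env_act_const -env_actM; congr (env_act _ _).
    by rewrite !mulrA econstC.
  - by move=> v v'; rewrite env_actDl.
  - by rewrite -(_ : econst L 0 = 0) // env_act_const scale0r.
rewrite actsum; apply: Ssum => l.
by have := Su (rcons u l) m; rewrite !size_rcons yr => /(_ erefl).
Qed.

(** Sorting as before: a swap lowers [wgt], and the bracket term has two odd letters fewer. Hence an
    induction on length, and on weight inside it. *)
Let S_word n w m : (size w <= n)%N -> S (env_act (yw w) (Ind_unit m)).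
Proof.
elim/ltn_ind: n w m => n IHn w m.
have [k] := ubnP (wgt w); elim: k w => // k IHk w wk wn.
have [sw|/unsorted_descent] := boolP (sorted (@incr d) w).
  rewrite (incr_wordE sw); set J := [set i in w].
  exists (fun I => if I == J then m else 0); rewrite /ind_comb (bigD1 J) //= eqxx big1 ?addr0 //.
  by move=> I /negPf->; rewrite (shom0 (shom_Ind_unit M)) env_act0r.
case=> u [i [j [v [ew ui ji]]]]; subst w.
have e : yw (u ++ i :: j :: v) + yw (u ++ j :: i :: v) =
    yw v * egen (vsval (odd_lbr i j) : L) * yw u.
  rewrite !word_env_cat /= -mulrDl -!(mulrA (yw v)) -mulrDr.
  by rewrite [_ + egen (y i) * _]addrC egen_anticomm mulrA.
have h0 : S (env_act (yw v * egen (vsval (odd_lbr i j) : L) * yw u) (Ind_unit m)).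
  apply: S_move => u' m' su; rewrite -word_env_cat.
  move: wn; rewrite size_cat /= => wn.
  by apply: (IHn n.-2); rewrite ?size_cat; lia.
have [eij|nij] := eqVneq i j.
  subst j; have n2 : 2%:R != 0 :> K by rewrite pnatr_eq0.
  rewrite -[env_act _ _](scalerK n2); apply: SZ.
  by rewrite scaler_nat mulr2n -env_actDl e.
have ij : (j < i)%N by rewrite ltn_neqAle ji andbT eq_sym.
rewrite -[yw _](addrK (yw (u ++ j :: i :: v))) e env_actDl; apply: SD => //.
rewrite -econstN1 env_actM env_act_const scaleN1r; apply: SN.
apply: IHk; last by move: wn; rewrite !size_cat.
by rewrite -ltnS; apply: leq_trans wk; rewrite ltnS; apply: wgt_swap.
Qed.

Let S_act u z : S z -> S (env_act u z).
Proof.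
elim/env_gen_ind: u z => [c|x|u v IHu IHv|u v IHu IHv] z Sz.
- by rewrite env_act_const; apply: SZ.
- case: Sz => f ->; rewrite /ind_comb.
  rewrite (big_morph _ (env_actDr (egen x)) (env_act0r _ _)).
  apply: (big_ind S) => // J _.
  have [_ _ dec _] := lie_grading L; have [x0 [x1 [X0 X1 ->]]] := dec x.
  rewrite egenD env_actDl; apply: SD.
    have -> : x0 = vsval (vsproj (lie_part L false) x0) by rewrite vsprojK.
    rewrite -env_actM -[egen _]mul1r.
    apply: (S_move (vsproj (lie_part L false) x0 : even_part L)) => u' m' _.
    by rewrite mul1r; apply: S_word.
  rewrite env_act_gen (odd_coordE X1).
  set m := env_act (yw (enum J)) _.
  have gl c u v : smod_act (c *: u + v : L) m = c *: smod_act u m + smod_act v m.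
    exact: smod_actl.
  rewrite (lin_sum gl); apply: (big_ind S) => // i _.
  rewrite (lin_Z gl); apply: SZ; rewrite -env_act_gen /m -env_actM.
  have -> : egen (y i) * yw (enum J) = yw (rcons (enum J) i).
    by rewrite -cats1 word_env_cat /= mul1r.
  exact: S_word.
- by rewrite env_actDl; apply: SD; [exact: IHu | exact: IHv].
- by rewrite env_actM; apply/IHu/IHv.
Qed.

Lemma ind_comb_span z : exists x, z = ind_comb x.
Proof.
rewrite -/(S z); elim/Ind_ind: z => // u m; apply: S_act.
by have := S_word (w := [::]) m (leqnn _); rewrite /= -econst1 env_act_const scale1r.
Qed.

Lemma ind_comb_eq0 x : ind_comb x = 0 -> forall J, x J = 0.
Proof.
by move=> x0; apply: frobenius_sum_eq0; rewrite -/(ind_comb x) x0 (shom0 (shom_frobenius M)).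
Qed.

Lemma frobenius_bij : bijective (@frobenius K L M).
Proof.
have inj : injective (@frobenius K L M).
  move=> z z' e; apply/eqP; rewrite -subr_eq0; apply/eqP.
  have [x ex] := ind_comb_span (z - z'); rewrite ex /ind_comb big1 // => J _.
  rewrite (frobenius_sum_eq0 (x := x)) ?(shom0 (shom_Ind_unit M)) ?env_act0r //.
  by rewrite -/(ind_comb x) -ex (shomB _ _ (shom_frobenius M)) e subrr.
pose g f := projT1 (cid (frobenius_surj (M := M) f)).
have gK f : frobenius (g f) = f by rewrite /g; case: cid.
by exists g => // z; apply: inj; rewrite gK.
Qed.
End InductionBasis.

(** * Exactness of induction and relative injectivity of induced modules *)

Section InductionExact.
Variables (K : numFieldType) (L : lieSuper K).
Implicit Types M N P : supermod (even_part L).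
Local Open Scope classical_set_scope.

Definition Ind_map M N (f : M -> N) : Ind M -> Ind N :=
  Ind_lift (fun m => Ind_unit (f m)).

Lemma shom_Ind_map_unit M N (f : M -> N) : is_shom f ->
  @is_shom _ _ M (Res (Ind N)) (fun m => Ind_unit (f m)).
Proof. exact: shom_comp (shom_Ind_unit N). Qed.

Lemma shom_Ind_map M N (f : M -> N) : is_shom f -> is_shom (Ind_map f).
Proof. by move=> fs; apply: shom_Ind_lift; apply: shom_Ind_map_unit. Qed.

Lemma Ind_map_unit M N (f : M -> N) m : is_shom f -> Ind_map f (Ind_unit m) = Ind_unit (f m).
Proof. by move=> fs; rewrite /Ind_map (Ind_lift_unit (shom_Ind_map_unit fs)). Qed.

Lemma Ind_map_comb M N (f : M -> N) x : is_shom f ->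
  Ind_map f (ind_comb x) = ind_comb (fun J => f (x J)).
Proof.
move=> fs; have fi := shom_Ind_map fs.
rewrite /ind_comb (big_morph _ (fun z z' => shomD z z' fi) (shom0 fi)).
by apply: eq_bigr => J _; rewrite (shom_env_act _ _ fi) Ind_map_unit.
Qed.

Lemma Ind_unit_inj M : injective (@Ind_unit _ _ M).
Proof.
move=> m m' e; apply/eqP; rewrite -subr_eq0; apply/eqP.
pose x (J : {set 'I_(odd_dim L)}) := if J == finset.set0 then m - m' else 0.
have -> : m - m' = x finset.set0 by rewrite /x eqxx.
apply: ind_comb_eq0; rewrite /ind_comb (bigD1 finset.set0) //= big1 => [|J].
  rewrite addr0 /x eqxx enum_set0 /= -econst1 env_act_const scale1r.
  by rewrite (shomB _ _ (shom_Ind_unit M)) e subrr.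
by rewrite /x => /negPf ->; rewrite (shom0 (shom_Ind_unit M)) env_act0r.
Qed.

Lemma Ind_map_inj M N (f : M -> N) : is_shom f -> injective f -> injective (Ind_map f).
Proof.
move=> fs fi z z' e; apply/eqP; rewrite -subr_eq0; apply/eqP.
have : Ind_map f (z - z') = 0 by rewrite (shomB _ _ (shom_Ind_map fs)) e subrr.
have [x ->] := ind_comb_span (z - z'); rewrite Ind_map_comb // => /ind_comb_eq0 x0.
rewrite /ind_comb big1 // => J _; have := x0 J; rewrite -(shom0 fs) => /fi ->.
by rewrite (shom0 (shom_Ind_unit M)) env_act0r.
Qed.

Lemma Ind_map_surj M N (f : M -> N) : is_shom f -> range f = setT -> range (Ind_map f) = setT.
Proof.
move=> fs fT; apply/seteqP; split=> // z _; have [x ->] := ind_comb_span z.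
have ex J : exists m, f m = x J.
  have : range f (x J) by rewrite fT.
  by case=> m _ <-; exists m.
exists (ind_comb (fun J => projT1 (cid (ex J)))) => //.
rewrite Ind_map_comb // /ind_comb; apply: eq_bigr => J _; congr (env_act _ (Ind_unit _)).
by case: cid.
Qed.

Lemma Ind_map_exact M N P (f : M -> N) (h : N -> P) : is_shom f -> is_shom h ->
  range f = h @^-1` [set 0] -> range (Ind_map f) = Ind_map h @^-1` [set 0].
Proof.
move=> fs hs fh; apply/seteqP; split=> [_ [z _ <-]|z /=].
  have [x ->] := ind_comb_span z; rewrite /= !Ind_map_comb //.
  rewrite /ind_comb big1 // => J _; have -> : h (f (x J)) = 0.
    have : range f (f (x J)) by exists (x J).
    by rewrite fh.
  by rewrite (shom0 (shom_Ind_unit P)) env_act0r.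
have [x ->] := ind_comb_span z; rewrite Ind_map_comb // => /ind_comb_eq0 x0.
have ex J : exists m, f m = x J.
  have : (h @^-1` [set 0]) (x J) by exact: x0.
  by rewrite -fh => -[m _ <-]; exists m.
exists (ind_comb (fun J => projT1 (cid (ex J)))) => //.
rewrite Ind_map_comb // /ind_comb; apply: eq_bigr => J _; congr (env_act _ (Ind_unit _)).
by case: cid.
Qed.

(** Preimages are chosen on increasing words only; [coind_exists] extends the choice, and
    [coind_incr_ext] shows that its image is [h]. *)
Lemma Coind_lift_surj M N (f : M -> N) (h : Coind N) : is_shom f -> range f = setT ->
  exists k : Coind M, forall u, f (k u) = h u.
Proof.
move=> fs fT.
have ex w : exists m, f m = h (word_env w).
  have : range f (h (word_env w)) by rewrite fT.
  by case=> m _ <-; exists m.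
have [k kw] := coind_exists (fun w => projT1 (cid (ex w))).
exists k => u.
have fD u' v : f (k (u' + v)) = f (k u') + f (k v) by rewrite coind_funD (shomD _ _ fs).
have fM s u' : f (k (env_incl s * u')) = env_act s (f (k u')).
  by rewrite coind_funM (shom_env_act _ _ fs).
suff -> : h = CoindFun fD fM by [].
by apply: coind_incr_ext => w sw /=; rewrite kw //; case: cid.
Qed.

(* Induced modules are coinduced, hence injective relatively to the even part. *)
Lemma Ind_relatively_injective M (N P : supermod L) (i : N -> P) (r0 : P -> N) (f : N -> Ind M) :
  is_shom i -> @is_shom _ _ (Res P) (Res N) r0 -> cancel i r0 -> is_shom f ->
  exists2 h : P -> Ind M, is_shom h & forall n, h (i n) = f n.
Proof.
move=> is_ r0s ir fs; have [g gs [fg gf]] := shom_inv (shom_frobenius M) (frobenius_bij M).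
(* The g_0-map that corresponds to [f] by adjunction. Composed with [r0] it extends along [i], and
   its transpose is the required extension of [f]. *)
pose e (n : N) : twist M := frobenius (f n) 1.
have es : @is_shom _ _ (Res N) (twist M) e.
  exact: (shom_comp (shom_Coind_ev (twist M)) (shom_Res (shom_comp (shom_frobenius M) fs))).
have ers : @is_shom _ _ (Res P) (twist M) (fun p => e (r0 p)) by exact: shom_comp es r0s.
have cs : @is_shom _ _ P (Coind (twist M)) (Coind_lift ers) by exact: shom_Coind_lift.
exists (fun p => g (Coind_lift ers p)); first exact: shom_comp gs cs.
move=> n; apply: (can_inj fg); rewrite gf.
have eqf : (fun n => Coind_lift ers (i n) : Coind (twist M)) = fun n => frobenius (f n).
  apply: Coind_hom_ext.
  - exact: shom_comp cs is_.
  - exact: shom_comp (shom_frobenius M) fs.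
  - by move=> n'; rewrite (Coind_lift1 ers) /e ir.
exact: (congr1 (fun h => h n) eqf).
Qed.
End InductionExact.

(** * Projective dimension *)

Local Open Scope classical_set_scope.

(** * Short exact sequences and their splittings *)

Section ShortExact.
Variables (K : numFieldType) (L : lieSuper K).
Implicit Types M N P X Y Z : supermod L.

Definition shom_surj M N (f : M -> N) := forall n, exists m, f m = n.

Record ses X Y Z (j : X -> Y) (q : Y -> Z) : Prop := Ses {
  ses_shom_l : is_shom j;
  ses_shom_r : is_shom q;
  ses_inj : injective j;
  ses_surj : shom_surj q;
  ses_exact : forall y, q y = 0 <-> exists x, j x = y
}.

Lemma shom_surjE M N (f : M -> N) : shom_surj f <-> range f = setT.
Proof.
split=> [fs|fT n]; first by apply/seteqP; split=> // n _; have [m <-] := fs n; exists m.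
by have : range f n; [rewrite fT | case=> m _ <-; exists m].
Qed.

Lemma shom_surj_comp M N P (f : N -> P) (h : M -> N) : shom_surj f -> shom_surj h ->
  shom_surj (fun m => f (h m)).
Proof. by move=> fs hs p; have [n <-] := fs p; have [m <-] := hs n; exists m. Qed.

Lemma ses_comp X Y Z (j : X -> Y) (q : Y -> Z) x : ses j q -> q (j x) = 0.
Proof. by move=> s; apply/(ses_exact s); exists x. Qed.

Lemma ses_factor X Y Z (j : X -> Y) (q : Y -> Z) N (f : N -> Y) : ses j q -> is_shom f ->
  (forall n, q (f n) = 0) -> exists2 g : N -> X, is_shom g & forall n, j (g n) = f n.
Proof.
move=> s fs qf; have ex n : exists x, j x = f n by apply/(ses_exact s).
pose g n := projT1 (cid (ex n)); have gP n : j (g n) = f n by rewrite /g; case: cid.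
exists g => //; apply: (shom_factor_inj (ses_shom_l s) (ses_inj s)).
by rewrite (_ : (fun n => j (g n)) = f) //; apply: funext.
Qed.

Lemma shom_factor_surj M N P (e : M -> N) (s : N -> P) :
  is_shom e -> shom_surj e -> is_shom (fun m => s (e m)) -> is_shom s.
Proof.
move=> es eT [fl fp fa]; have [el ep ea] := es; split=> [c n n'|a n na|x n].
- by have [m <-] := eT n; have [m' <-] := eT n'; rewrite -el fl.
- have [m em] := eT n; have [_ _ Mdec _] := smod_grading M.
  have [N0 NP _ Ncap] := smod_grading N.
  have NB b (u v : N) : smod_part N b u -> smod_part N b v -> smod_part N b (u - v).
    by move=> hu hv; rewrite addrC -scaleN1r; apply: NP.
  have [m0 [m1 [h0 h1 e01]]] := Mdec m; subst n.
  rewrite e01 (shomD _ _ es) in na *.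
  case: a na => na.
    have -> : e m0 = 0; last by rewrite add0r; apply: fp.
    apply: Ncap; first exact: ep.
    by rewrite -[e m0](addrK (e m1)); apply: NB => //; apply: ep.
  have -> : e m1 = 0; last by rewrite addr0; apply: fp.
  apply: Ncap; last exact: ep.
  by rewrite -[e m1](addrK (e m0)) [e m1 + _]addrC; apply: NB => //; apply: ep.
- by have [m <-] := eT n; rewrite -ea fa.
Qed.

Lemma ses_section X Y Z (j : X -> Y) (q : Y -> Z) (r : Y -> X) : ses j q -> is_shom r ->
  (forall x, r (j x) = x) -> exists2 s : Z -> Y, is_shom s & forall z, q (s z) = z.
Proof.
move=> e rs rj; have [js qs ji qT ex] := e.
(* Subtracting j (r y) makes the value independent of the chosen preimage y; this is what [sq]
   shows. *)
pose s z := let y := projT1 (cid (qT z)) in y - j (r y).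
have sq y : s (q y) = y - j (r y).
  rewrite /s; case: cid => y' /= e'.
  have /(ses_exact e) [x ex'] : q (y' - y) = 0 by rewrite (shomB _ _ qs) e' subrr.
  have -> : y' = j x + y by rewrite ex' subrK.
  by rewrite (shomD _ _ rs) rj (shomD _ _ js); zmodule.
exists s.
  apply: (shom_factor_surj qs qT); rewrite (_ : (fun m => s (q m)) = fun y => y - j (r y)).
    by apply: shom_sub; [exact: shom_id | exact: shom_comp js rs].
  exact: funext.
by move=> z; rewrite /s; case: cid => y /= <-; rewrite (shomB _ _ qs) (ses_comp _ e) subr0.
Qed.

Lemma ses_retraction X Y Z (j : X -> Y) (q : Y -> Z) (s : Z -> Y) : ses j q -> is_shom s ->
  (forall z, q (s z) = z) ->
  exists2 r : Y -> X, is_shom r & (forall y, j (r y) = y - s (q y)) /\ forall x, r (j x) = x.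
Proof.
move=> e ss qs; have [js qsh ji qT ex] := e.
have [||r rs jr] := ses_factor (f := fun y => y - s (q y)) e.
- by apply: shom_sub; [exact: shom_id | exact: shom_comp ss qsh].
- by move=> y; rewrite (shomB _ _ qsh) qs subrr.
exists r => //; split=> // x; apply: ji.
by rewrite jr (ses_comp _ e) (shom0 ss) subr0.
Qed.
End ShortExact.

(** * Syzygies and bounds on projective dimension *)

Section ProjectiveDimension.
Variables (K : numFieldType) (L : lieSuper K) (A : supermod L -> Prop).
Hypothesis Aab : abelian_subcat A.
Implicit Types M N P Q X Y Z : supermod L.

Lemma ess_in_self M : A M -> ess_in A M.
Proof. by move=> AM; exists M => //; apply: smod_iso_refl. Qed.

Lemma ess_in_inv M : ess_in A M -> exists2 N, A N & exists (f : N -> M) (h : M -> N),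
  [/\ is_shom f, is_shom h, forall n, h (f n) = n & forall m, f (h m) = m].
Proof.
case=> N AN [f fs fb]; have [h hs [fh hf]] := shom_inv fs fb.
by exists N => //; exists f, h.
Qed.

(** Projectivity in the closure of [A] under isomorphism, because the functors land in the
    subcategories only up to isomorphism. *)
Definition proj P : Prop := ess_in A P /\ forall M N (f : M -> N) (h : P -> N),
  ess_in A M -> ess_in A N -> is_shom f -> shom_surj f -> is_shom h ->
  exists2 k : P -> M, is_shom k & forall p, f (k p) = h p.

Lemma projective_in_proj P : projective_in A P -> proj P.
Proof.
move=> [AP lift]; split; first exact: ess_in_self.
move=> M N f h /ess_in_inv [M0 AM0 [a [a' [as_ a's aK a'K]]]].
move=> /ess_in_inv [N0 AN0 [b [b' [bs b's bK b'K]]]] fs fT hs.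
have [|||k ks kE] := lift M0 N0 (fun m => b' (f (a m))) (fun p => b' (h p)) AM0 AN0.
- exact: shom_comp b's (shom_comp fs as_).
- apply/shom_surjE => n; have [m em] := fT (b n); exists (a' m).
  by rewrite a'K em bK.
- exact: shom_comp b's hs.
exists (fun p => a (k p)); first exact: shom_comp as_ ks.
by move=> p; have /(congr1 b) := congr1 (fun u => u p) kE; rewrite /= !b'K.
Qed.

Lemma proj_projective_in P : proj P -> exists2 P', projective_in A P' &
  exists (f : P' -> P) (h : P -> P'),
    [/\ is_shom f, is_shom h, forall n, h (f n) = n & forall m, f (h m) = m].
Proof.
move=> [/ess_in_inv [P' AP' [f [h [fs hs hf fh]]]] lift]; exists P'; last by exists f, h.
split=> // M N u v AM AN us /shom_surjE uT vs.
have [k ks kE] := lift M N u (fun p => v (h p)) (ess_in_self AM) (ess_in_self AN) us uT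
  (shom_comp vs hs).
exists (fun p => k (f p)); first exact: shom_comp ks fs.
by apply: funext => p; rewrite /= kE hf.
Qed.

Lemma ess_in_iso M N (f : M -> N) (h : N -> M) : is_shom f -> is_shom h ->
  (forall m, h (f m) = m) -> (forall n, f (h n) = n) -> ess_in A M -> ess_in A N.
Proof.
move=> fs hs hf fh [M0 AM0 [g gs gb]]; exists M0 => //.
exists (fun m => f (g m)); first exact: shom_comp fs gs.
by apply: bij_comp gb; exists h.
Qed.

Lemma ess_kernel M N (f : M -> N) : ess_in A M -> ess_in A N -> is_shom f ->
  exists2 X, ess_in A X & exists2 j : X -> M, is_shom j /\ injective j &
    forall m, f m = 0 <-> exists x, j x = m.
Proof.
move=> /ess_in_inv [M0 AM0 [a [a' [as_ a's aK a'K]]]].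
move=> /ess_in_inv [N0 AN0 [b [b' [bs b's bK b'K]]]] fs.
have [|X AX [i [is_ ii] ex]] := abelian_kernel Aab (f := fun m => b' (f (a m))) AM0 AN0.
  exact: shom_comp b's (shom_comp fs as_).
exists X; first exact: ess_in_self.
exists (fun x => a (i x)).
  split; first exact: shom_comp as_ is_.
  by move=> x x' e; apply: ii; rewrite -[i x]aK e aK.
move=> m; split=> [fm|[x <-]].
  have : range i (a' m) by rewrite ex /= a'K fm (shom0 b's).
  by case=> x _ ix; exists x; rewrite ix a'K.
have : range i (i x) by exists x.
by rewrite ex /= => /(congr1 b); rewrite b'K (shom0 bs).
Qed.

Lemma ses_kernel M N (f : M -> N) : ess_in A M -> ess_in A N -> is_shom f -> shom_surj f ->
  exists2 X, ess_in A X & exists j : X -> M, ses j f.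
Proof.
by move=> eM eN fs fT; have [X eX [j [js ji] ex]] := ess_kernel eM eN fs; exists X => //; exists j.
Qed.

Lemma ses_cokernel M N (f : M -> N) : ess_in A M -> ess_in A N -> is_shom f -> injective f ->
  exists2 X, ess_in A X & exists q : N -> X, ses f q.
Proof.
move=> /ess_in_inv [M0 AM0 [a [a' [as_ a's aK a'K]]]].
move=> /ess_in_inv [N0 AN0 [b [b' [bs b's bK b'K]]]] fs fi.
have [|X AX [q [qs qT] ex]] := abelian_cokernel Aab (f := fun m => b' (f (a m))) AM0 AN0.
  exact: shom_comp b's (shom_comp fs as_).
exists X; first exact: ess_in_self.
exists (fun n => q (b' n)); split=> //.
- exact: shom_comp qs b's.
- by apply: shom_surj_comp; [apply/shom_surjE | move=> n; exists (b n)].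
move=> n; split=> [qn|[m <-]].
  have : (q @^-1` [set 0]) (b' n) by [].
  by rewrite ex => -[m _ em]; exists (a m); rewrite -[n]b'K -em b'K.
have : range (fun m => b' (f (a m))) (b' (f m)) by exists (a' m); rewrite // a'K.
by rewrite -ex.
Qed.

Lemma zero_projective : exists2 Z, projective_in A Z & forall z : Z, z = 0.
Proof.
have [Z AZ Z0] := abelian_zero Aab; exists Z => //; split=> // M N f h _ _ fs _ hs.
exists (fun=> 0); first exact: shom_0.
by apply: funext => z; rewrite /= (Z0 z) (shom0 fs) (shom0 hs).
Qed.

(* [M] is a direct summand of [M'] up to projectives. *)
Definition stable_retract M M' : Prop := exists2 Q, proj Q &
  exists (a : M -> M') (b : M' -> M) (s : M -> Q) (t : Q -> M),
    [/\ is_shom a, is_shom b, is_shom s & is_shom t] /\ forall m, m = b (a m) + t (s m).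

Lemma retract_stable M M' (a : M -> M') (b : M' -> M) : is_shom a -> is_shom b ->
  (forall m, b (a m) = m) -> stable_retract M M'.
Proof.
move=> as_ bs ab; have [Z /projective_in_proj pZ _] := zero_projective.
exists Z => //; exists a, b, (fun=> 0), (fun=> 0); split; last by move=> m; rewrite ab addr0.
by split=> //; apply: shom_0.
Qed.

Lemma stable_retract_proj M M' : ess_in A M -> stable_retract M M' -> proj M' -> proj M.
Proof.
move=> eM [Q [_ Qlift] [a [b [s [t [[as_ bs ss ts] e]]]]]] [_ Mlift].
split=> // X Y f h eX eY fs fT hs.
have [k1 k1s k1E] := Mlift X Y f (fun m => h (b m)) eX eY fs fT (shom_comp hs bs).
have [k2 k2s k2E] := Qlift X Y f (fun m => h (t m)) eX eY fs fT (shom_comp hs ts).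
exists (fun m => k1 (a m) + k2 (s m)).
  by apply: shom_add; [exact: shom_comp k1s as_ | exact: shom_comp k2s ss].
by move=> m; rewrite (shomD _ _ fs) k1E k2E -(shomD _ _ hs) -e.
Qed.

(** A form of Schanuel's lemma. Lift [a], [b] and [t] to the projectives; the defect of the lifts on
    P takes values in X, so on syzygies the correction factors through P. *)
Lemma stable_retract_syzygy X P M (i : X -> P) (e : P -> M)
    X' P' M' (i' : X' -> P') (e' : P' -> M') :
  ses i e -> ses i' e' -> proj P -> proj P' -> ess_in A M -> ess_in A M' ->
  stable_retract M M' -> stable_retract X X'.
Proof.
move=> E E' pP pP' eM eM' [Q pQ [a [b [s [t [[as_ bs ss ts] ab]]]]]].
have [is_ es ii eT ex] := E; have [i's e's i'i e'T ex'] := E'.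
have [g gs gE] := pP.2 P' M' e' (fun p => a (e p)) pP'.1 eM' e's e'T (shom_comp as_ es).
have [h hs hE] := pP'.2 P M e (fun p => b (e' p)) pP.1 eM es eT (shom_comp bs e's).
have [t' t's t'E] := pQ.2 P M e t pP.1 eM es eT ts.
have [||gX gXs gXE] := ses_factor (f := fun x => g (i x)) E'; first exact: shom_comp gs is_.
  by move=> x; rewrite gE (ses_comp _ E) (shom0 as_).
have [||hX hXs hXE] := ses_factor (f := fun x => h (i' x)) E; first exact: shom_comp hs i's.
  by move=> x; rewrite hE (ses_comp _ E') (shom0 bs).
have [||u us uE] := ses_factor (f := fun p => p - h (g p) - t' (s (e p))) E.
- apply: shom_sub; last exact: shom_comp t's (shom_comp ss es).
  by apply: shom_sub; [exact: shom_id | exact: shom_comp hs gs].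
- move=> p; rewrite !(shomB _ _ es) hE gE t'E {1}[e p]ab; zmodule.
exists P => //; exists gX, hX, i, u; split=> // x; apply: ii.
rewrite (shomD _ _ is_) hXE gXE uE (ses_comp _ E) (shom0 ss) (shom0 t's); zmodule.
Qed.

(** Quantifies over all syzygies, which makes the hypothesis easy to use; [pdle_syzygy] shows that a
    single one suffices. *)
Fixpoint pdle n M : Prop :=
  if n is n'.+1 then forall X P (i : X -> P) (e : P -> M),
    ses i e -> proj P -> ess_in A X -> pdle n' X
  else proj M.

Hypothesis A_enough : enough_projectives A.

Lemma enough_proj M : ess_in A M -> exists2 P, proj P & exists2 e : P -> M, is_shom e & shom_surj e.
Proof.
move=> /ess_in_inv [N AN [f [h [fs hs hf fh]]]].
have [P /projective_in_proj pP [e es /shom_surjE eT]] := A_enough AN.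
exists P => //; exists (fun p => f (e p)); first exact: shom_comp fs es.
by apply: shom_surj_comp => // m; exists (h m).
Qed.

Lemma syzygy_exists M : ess_in A M -> exists P X, [/\ proj P, ess_in A X &
  exists (i : X -> P) (e : P -> M), ses i e].
Proof.
move=> eM; have [P pP [e es eT]] := enough_proj eM.
have [X eX [i E]] := ses_kernel pP.1 eM es eT.
by exists P, X; split=> //; exists i, e.
Qed.

Lemma pdle_stable n M M' : ess_in A M -> ess_in A M' -> stable_retract M M' ->
  pdle n M' -> pdle n M.
Proof.
elim: n M M' => [|n IH] M M' eM eM' MM'; first exact: stable_retract_proj.
move=> pM' X P i e E pP eX.
have [P' [X' [pP' eX' [i' [e' E']]]]] := syzygy_exists eM'.
apply: (IH X X') => //; last exact: pM' E' pP' eX'.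
exact: (stable_retract_syzygy E E').
Qed.

Lemma pdle_retract n M M' (a : M -> M') (b : M' -> M) : is_shom a -> is_shom b ->
  (forall m, b (a m) = m) -> ess_in A M -> ess_in A M' -> pdle n M' -> pdle n M.
Proof. by move=> as_ bs ab eM eM'; apply: pdle_stable => //; exact: (retract_stable as_ bs). Qed.

Lemma pdle_syzygy n X P M (i : X -> P) (e : P -> M) : ses i e -> proj P -> ess_in A X ->
  ess_in A M -> pdle n X -> pdle n.+1 M.
Proof.
move=> E pP eX eM pX X' P' i' e' E' pP' eX'.
apply: pdle_stable pX => //; apply: (stable_retract_syzygy E' E) => //.
exact: (retract_stable (shom_id M) (shom_id M)).
Qed.

Lemma proj_section P M (e : M -> P) : proj P -> ess_in A M -> is_shom e -> shom_surj e ->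
  exists2 s : P -> M, is_shom s & forall p, e (s p) = p.
Proof. by move=> [eP lift] eM es eT; apply: lift => //; exact: shom_id. Qed.

Lemma pdleS n M : ess_in A M -> pdle n M -> pdle n.+1 M.
Proof.
elim: n M => [|n IH] M eM.
  move=> pM X P i e E pP eX.
  have [s ss sE] := proj_section pM pP.1 (ses_shom_r E) (ses_surj E).
  have [r rs [_ ri]] := ses_retraction E ss sE.
  by apply: (stable_retract_proj eX _ pP); exact: (retract_stable (ses_shom_l E) rs).
by move=> pM X P i e E pP eX; apply: IH => //; exact: pM E pP eX.
Qed.

Lemma pdle_mono m n M : (m <= n)%N -> ess_in A M -> pdle m M -> pdle n M.
Proof.
move=> mn eM pM; elim: n mn => [|n IH]; first by rewrite leqn0 => /eqP <-.
by rewrite leq_eqVlt => /predU1P[<- //|mn]; apply/pdleS/IH.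
Qed.

(* Pulling back a projective cover of [Y] rotates the sequence. *)
Lemma ses_rotate X Y Z (j : X -> Y) (q : Y -> Z) : ses j q ->
  ess_in A X -> ess_in A Y -> ess_in A Z ->
  exists P Y1 Z1, [/\ proj P, ess_in A Y1, ess_in A Z1 &
    exists (i1 : Y1 -> P) (e1 : P -> Y) (i2 : Z1 -> P) (e2 : P -> Z) (u : Y1 -> Z1) (v : Z1 -> X),
      [/\ ses i1 e1, ses i2 e2 & ses u v]].
Proof.
move=> E eX eY eZ; have [js qs ji qT ex] := E.
have [P pP [e es eT]] := enough_proj eY.
have [Y1 eY1 [i1 E1]] := ses_kernel pP.1 eY es eT.
have qes : is_shom (fun p => q (e p)) by exact: shom_comp qs es.
have [Z1 eZ1 [i2 E2]] := ses_kernel pP.1 eZ qes (shom_surj_comp qT eT).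
have [||u us uE] := ses_factor (f := i1) E2; first exact: (ses_shom_l E1).
  by move=> y; rewrite (ses_comp _ E1) (shom0 qs).
have [||v vs vE] := ses_factor (f := fun z => e (i2 z)) E.
- exact: shom_comp es (ses_shom_l E2).
- by move=> z; apply: (ses_comp _ E2).
exists P, Y1, Z1; split=> //; exists i1, e, i2, (fun p => q (e p)), u, v; split=> //; split=> //.
- by move=> y y' uy; apply: (ses_inj E1); rewrite -!uE uy.
- move=> x; have [p ep] := eT (j x).
  have /(ses_exact E2) [z iz] : q (e p) = 0 by rewrite ep (ses_comp _ E).
  by exists z; apply: ji; rewrite vE iz.
- move=> z; split=> [vz|[y <-]].
    have /(ses_exact E1) [y iy] : e (i2 z) = 0 by rewrite -vE vz (shom0 js).
    by exists y; apply: (ses_inj E2); rewrite uE.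
  by apply: ji; rewrite vE uE (shom0 js) (ses_comp _ E1).
Qed.

(** These replace the long exact sequence of Ext. [ses_rotate] gives 0 -> Y1 -> Z1 -> X -> 0 with
    syzygies Y1 and Z1, so each estimate reduces to another one, earlier in the induction. In the
    base case a projective quotient splits off. *)
Lemma pdle_ses m X Y Z (j : X -> Y) (q : Y -> Z) : ses j q ->
  ess_in A X -> ess_in A Y -> ess_in A Z ->
  [/\ pdle m X -> pdle m Z -> pdle m Y,
      pdle m X -> pdle m.+1 Y -> pdle m.+1 Z
    & pdle m Y -> pdle m.+1 Z -> pdle m X].
Proof.
elim: m X Y Z j q => [|m IH] X Y Z j q E eX eY eZ.
  have ext X' Y' Z' (j' : X' -> Y') (q' : Y' -> Z') : ses j' q' -> ess_in A Y' ->
      pdle 0 X' -> pdle 0 Z' -> pdle 0 Y'.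
    move=> E' eY' pX pZ; have [s ss sE] := proj_section pZ eY' (ses_shom_r E') (ses_surj E').
    have [r rs [jr _]] := ses_retraction E' ss sE.
    apply: stable_retract_proj pX => //; exists Z' => //; exists r, j', q', s.
    split; first by split=> //; [exact: ses_shom_l E' | exact: ses_shom_r E'].
    by move=> y; rewrite jr subrK.
  split; first exact: ext E eY.
    move=> pX pY; have [P [Y1 [Z1 [pP eY1 eZ1]]]] := ses_rotate E eX eY eZ.
    case=> [i1 [e1 [i2 [e2 [u [v [E1 E2 E3]]]]]]].
    by apply: (pdle_syzygy E2) => //; apply: (ext _ _ _ _ _ E3) => //; exact: pY E1 pP eY1.
  by move=> pY pZ; exact: pZ E pY eX.
have ext X' Y' Z' (j' : X' -> Y') (q' : Y' -> Z') : ses j' q' -> ess_in A X' -> ess_in A Y' ->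
    ess_in A Z' -> pdle m.+1 X' -> pdle m.+1 Z' -> pdle m.+1 Y'.
  move=> E' eX' eY' eZ' pX pZ; have [P [Y1 [Z1 [pP eY1 eZ1]]]] := ses_rotate E' eX' eY' eZ'.
  case=> [i1 [e1 [i2 [e2 [u [v [E1 E2 E3]]]]]]].
  have [_ _ IHc] := IH _ _ _ _ _ E3 eY1 eZ1 eX'.
  by apply: (pdle_syzygy E1) => //; apply: IHc => //; exact: pZ E2 pP eZ1.
have [P [Y1 [Z1 [pP eY1 eZ1]]]] := ses_rotate E eX eY eZ.
case=> [i1 [e1 [i2 [e2 [u [v [E1 E2 E3]]]]]]].
have [_ IHb _] := IH _ _ _ _ _ E3 eY1 eZ1 eX.
split; first exact: ext E eX eY eZ.
  move=> pX pY; apply: (pdle_syzygy E2) => //.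
  by apply: (ext _ _ _ _ _ E3) => //; exact: pY E1 pP eY1.
by move=> pY pZ; apply: IHb; [exact: pY E1 pP eY1 | exact: pZ E2 pP eZ1].
Qed.

Lemma resolution_pdle n M : ess_in A M -> has_proj_resolution A M n -> pdle n M.
Proof.
elim: n M => [|n IH] M eM [P [d [e [[pP ds es] [eT d0 dS Pn]]]]];
  have eP : ess_in A (P 0%N) by apply: ess_in_self; case: (pP 0%N).
  (* In the base case P_1 is 0, so [e] is an isomorphism. In the induction step this fact is
     established only in the branch for length 0. *)
  have einj : injective e.
    move=> p p' ep; apply/eqP; rewrite -subr_eq0; apply/eqP.
    have : (e @^-1` [set 0]) (p - p') by rewrite /= (shomB _ _ es) ep subrr.
    by rewrite -d0 => -[x _ <-]; rewrite (Pn 1%N isT x) (shom0 (ds 0%N)).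
  pose g m := let: exist p _ := cid (proj2 (shom_surjE e) eT m) in p.
  have gK m : e (g m) = m by rewrite /g; case: cid.
  have gs : is_shom g.
    apply: (shom_factor_inj es einj); rewrite (_ : (fun m => e (g m)) = fun m => m).
      exact: shom_id.
    exact: funext.
  apply: (pdle_retract gs es gK eM eP); exact/projective_in_proj.
have [X eX [i E]] := ses_kernel eP eM es (proj2 (shom_surjE e) eT).
have [||e' e's e'E] := ses_factor (f := d 0%N) E; first exact: ds.
  by move=> x; have : range (d 0%N) (d 0%N x) by []; rewrite d0.
apply: (pdle_syzygy E) => //; first exact/projective_in_proj.
apply: IH => //; exists (fun k => P k.+1), (fun k => d k.+1), e'; split; split=> //.
- apply/shom_surjE => x; have : (e @^-1` [set 0]) (i x) by exact: (ses_comp _ E).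
  by rewrite -d0 => -[y _ dy]; exists y; apply: (ses_inj E); rewrite e'E.
- rewrite dS; apply/seteqP; split=> x /= h.
    by apply: (ses_inj E); rewrite e'E h (shom0 (ses_shom_l E)).
  by rewrite -e'E h (shom0 (ses_shom_l E)).
- by move=> k nk; apply: Pn.
Qed.

Lemma pdle_resolution n M : ess_in A M -> pdle n M -> has_proj_resolution A M n.
Proof.
elim: n M => [|n IH] M eM pM.
  have [P pP [f [h [fs hs hf fh]]]] := proj_projective_in pM.
  have [Z pZ Z0] := zero_projective.
  exists (fun k => if k is _.+1 then Z else P), (fun k _ => 0), f; split; split=> //.
  - by case.
  - by move=> k; apply: shom_0.
  - by apply/shom_surjE => m; exists (h m).
  - apply/seteqP; split=> [_ [z _ <-]|p /= fp]; first exact: shom0.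
    by exists 0 => //; rewrite -(hf p) fp (shom0 hs).
  - move=> k; apply/seteqP; split=> [_ [z _ <-] //|z _].
    by exists 0 => //; rewrite (Z0 z).
  - by case.
have [P pP [e es eT]] := enough_proj eM.
(* A resolution must consist of objects of [A] itself, hence the passage to an isomorphic object. *)
have [P' pP' [f [h [fs hs hf fh]]]] := proj_projective_in pP.
have fes : is_shom (fun p => e (f p)) by exact: shom_comp es fs.
have feT : shom_surj (fun p => e (f p)).
  by apply: shom_surj_comp => // p; exists (h p).
have [X eX [i E]] := ses_kernel (ess_in_self pP'.1) eM fes feT.
have [Q [d [e' [[pQ ds e's] [e'T d0 dS Qn]]]]] :=
  IH X eX (pM _ _ _ _ E (projective_in_proj pP') eX).
pose PP k := if k is k'.+1 then Q k' else P'.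
pose dd k : PP k.+1 -> PP k := match k return PP k.+1 -> PP k with
  | 0%N => fun q => i (e' q) | k'.+1 => d k' end.
exists PP, dd, (fun p => e (f p)); split; split=> //.
- by case.
- by case=> [|k] /=; [exact: shom_comp (ses_shom_l E) e's | exact: ds].
- exact/shom_surjE.
- apply/seteqP; split=> [_ [q _ <-]|p /= h0]; first exact: (ses_comp _ E).
  have /(ses_exact E) [x <-] : e (f p) = 0 by [].
  have : range e' x by rewrite e'T.
  by case=> q _ <-; exists q.
- case=> [|k] /=; last exact: dS.
  rewrite d0; apply/seteqP; split=> q /= h0; first by rewrite h0 (shom0 (ses_shom_l E)).
  by apply: (ses_inj E); rewrite h0 (shom0 (ses_shom_l E)).
- by case=> [|k] //; apply: Qn.
Qed.

Lemma has_proj_resolutionE n M : ess_in A M -> has_proj_resolution A M n <-> pdle n M.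
Proof. by move=> eM; split; [exact: resolution_pdle | exact: pdle_resolution]. Qed.

End ProjectiveDimension.

(** * Comparison of the two categories *)

Section ChangeOfRings.
Variables (K : numFieldType) (L : lieSuper K).
Variables (Ct : supermod L -> Prop) (C : supermod (even_part L) -> Prop).
Hypothesis Ct_abelian : abelian_subcat Ct.
Hypothesis C_abelian : abelian_subcat C.
Hypothesis C_Ind : forall M, C M -> ess_in Ct (Ind M).
Hypothesis C_Coind : forall M, C M -> ess_in Ct (Coind M).
Hypothesis Ct_Res : forall N, Ct N -> ess_in C (Res N).
Hypothesis C_proj : enough_projectives C.

Lemma ess_Res N : ess_in Ct N -> ess_in C (Res N).
Proof.
move=> /ess_in_inv [N0 AN0 [f [h [fs hs hf fh]]]].
exact: (ess_in_iso (shom_Res fs) (shom_Res hs) hf fh (Ct_Res AN0)).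
Qed.

Lemma Ind_map_cancel (M N : supermod (even_part L)) (f : M -> N) (h : N -> M) :
  is_shom f -> is_shom h -> cancel f h ->
  cancel (@Ind_map K L _ _ f) (Ind_map h).
Proof.
move=> fs hs hf z.
have e : (fun z => Ind_map h (Ind_map f z)) = fun z => z.
  apply: Ind_hom_ext; first exact: shom_comp (shom_Ind_map hs) (shom_Ind_map fs).
    exact: shom_id.
  by move=> m; rewrite !Ind_map_unit // hf.
exact: (congr1 (fun k => k z) e).
Qed.

Lemma ess_Ind M : ess_in C M -> ess_in Ct (Ind M).
Proof.
move=> /ess_in_inv [N AN [f [h [fs hs hf fh]]]].
apply: (ess_in_iso (shom_Ind_map fs) (shom_Ind_map hs) _ _ (C_Ind AN)).
  exact: Ind_map_cancel.
exact: Ind_map_cancel.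
Qed.

Definition Coind_map (M N : supermod (even_part L)) (f : M -> N) (fs : is_shom f) :
    Coind M -> Coind N :=
  Coind_lift (shom_comp fs (shom_Coind_ev M)).

Lemma Coind_mapE (M N : supermod (even_part L)) (f : M -> N) (fs : is_shom f) k u :
  Coind_map fs k u = f (k u).
Proof. by rewrite /= coind_env_act mul1r. Qed.

Lemma shom_Coind_map (M N : supermod (even_part L)) (f : M -> N) (fs : is_shom f) :
  is_shom (Coind_map fs).
Proof. exact: shom_Coind_lift. Qed.

Lemma ess_Coind M : ess_in C M -> ess_in Ct (Coind M).
Proof.
move=> /ess_in_inv [N AN [f [h [fs hs hf fh]]]].
apply: (ess_in_iso (shom_Coind_map fs) (shom_Coind_map hs) _ _ (C_Coind AN)).
  by move=> k; apply: coindP => u; rewrite !Coind_mapE hf.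
by move=> k; apply: coindP => u; rewrite !Coind_mapE fh.
Qed.

Lemma Coind_map_surj (M N : supermod (even_part L)) (f : M -> N) (fs : is_shom f) :
  shom_surj f -> shom_surj (Coind_map fs).
Proof.
move=> /shom_surjE fT k; have [k' kk'] := Coind_lift_surj k fs fT.
by exists k'; apply: coindP => u; rewrite Coind_mapE kk'.
Qed.

Lemma ses_Res (X Y Z : supermod L) (j : X -> Y) (q : Y -> Z) : ses j q ->
  @ses _ _ (Res X) (Res Y) (Res Z) j q.
Proof. by case=> js qs ji qT ex; split=> //; apply: shom_Res. Qed.

Lemma ses_Ind (X Y Z : supermod (even_part L)) (j : X -> Y) (q : Y -> Z) : ses j q ->
  @ses K L _ _ _ (Ind_map j) (Ind_map q).
Proof.
case=> js qs ji qT ex; split; [exact: shom_Ind_map | exact: shom_Ind_map | exact: Ind_map_inj | |].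
  by apply/shom_surjE/Ind_map_surj => //; apply/shom_surjE.
have e : range j = q @^-1` [set 0].
  apply/seteqP; split=> y /=; first by case=> x _ <-; apply/ex; exists x.
  by move=> /ex [x <-]; exists x.
move=> z; have := Ind_map_exact (L := L) js qs e => /seteqP [s1 s2].
by split=> [/s2 [x _ <-]|[x <-]]; [exists x | apply: s1; exists x].
Qed.

(** [Res] is left adjoint to [Coind], which preserves surjections: transpose the lifting problem and
    evaluate the lift at 1. *)
Lemma Res_proj P : proj Ct P -> proj C (Res P).
Proof.
move=> [eP lift]; split; first exact: ess_Res.
move=> X Y f h eX eY fs fT hs.
have [k ks kE] := lift (Coind X) (Coind Y) (Coind_map fs) (Coind_lift hs) (ess_Coind eX)
  (ess_Coind eY) (shom_Coind_map fs) (Coind_map_surj fs fT) (shom_Coind_lift hs).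
exists (fun p => k p 1); first exact: (shom_comp (shom_Coind_ev X) (shom_Res ks)).
by move=> p; rewrite -(Coind_lift1 hs) -kE Coind_mapE.
Qed.

Lemma Ind_proj P : proj C P -> proj Ct (Ind P).
Proof.
move=> [eP lift]; split; first exact: ess_Ind.
move=> M N f h eM eN fs fT hs.
have hus : @is_shom _ _ P (Res N) (fun p => h (Ind_unit p)).
  exact: (shom_comp (shom_Res hs) (shom_Ind_unit P)).
have [k ks kE] := lift (Res M) (Res N) f _ (ess_Res eM) (ess_Res eN) (shom_Res fs) fT hus.
exists (Ind_lift k); first exact: shom_Ind_lift.
have e : (fun p => f (Ind_lift k p)) = h.
  apply: Ind_hom_ext => //; first exact: shom_comp fs (shom_Ind_lift ks).
  by move=> m; rewrite (Ind_lift_unit ks) kE.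
by move=> p; exact: (congr1 (fun u => u p) e).
Qed.

Lemma Ind_lift_surj (M : supermod (even_part L)) (N : supermod L) (h : M -> N) :
  @is_shom _ _ M (Res N) h -> shom_surj (N := Res N) h ->
  shom_surj (@Ind_lift K L N M h).
Proof.
by move=> hs hT n; have [m <-] := hT n; exists (Ind_unit m); rewrite (Ind_lift_unit hs).
Qed.

(** The transpose Ind P -> M of a surjection from a projective P onto Res M is surjective, with
    projective source. *)
Lemma Ct_enough : enough_projectives Ct.
Proof.
move=> M CM; have [P pP [e es eT]] := enough_proj C_proj (ess_Res (ess_in_self CM)).
have [P' pP' [f [h [fs hs hf fh]]]] := proj_projective_in (Ind_proj pP).
exists P' => //; exists (fun p => Ind_lift e (f p)); first exact: shom_comp (shom_Ind_lift es) fs.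
apply/shom_surjE; apply: (shom_surj_comp (Ind_lift_surj es eT)) => p.
by exists (h p).
Qed.

Lemma Res_pdle n M : ess_in Ct M -> pdle Ct n M -> pdle C n (Res M).
Proof.
elim: n M => [|n IH] M eM; first exact: Res_proj.
move=> pM; have [P [X [pP eX [i [e E]]]]] := syzygy_exists Ct_abelian Ct_enough eM.
apply: (pdle_syzygy C_abelian C_proj (ses_Res E)); [exact: Res_proj | exact: ess_Res..|].
by apply: IH => //; apply: pM E pP eX.
Qed.

Lemma Ind_pdle n M : ess_in C M -> pdle C n M -> pdle Ct n (Ind M).
Proof.
elim: n M => [|n IH] M eM; first exact: Ind_proj.
move=> pM; have [P [X [pP eX [i [e E]]]]] := syzygy_exists C_abelian C_proj eM.
apply: (pdle_syzygy Ct_abelian Ct_enough (ses_Ind E)); [exact: Ind_proj | exact: ess_Ind..|].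
by apply: IH => //; apply: pM E pP eX.
Qed.

(* A syzygy that is projective is relatively injective, so the sequence that it *)
(* starts splits as soon as its restriction does.                              *)
Lemma pdle_descent m M : ess_in Ct M -> pdle Ct m.+1 M -> pdle C m (Res M) -> pdle Ct m M.
Proof.
elim: m M => [|m IH] M eM pM pRM;
  have [P [X [pP eX [i [e E]]]]] := syzygy_exists Ct_abelian Ct_enough eM.
  have pX : proj Ct X := pM _ _ _ _ E pP eX.
  have ER := ses_Res E.
  have [s ss sE] := proj_section pRM (ess_Res pP.1) (ses_shom_r ER) (ses_surj ER).
  have [r0 r0s [_ r0i]] := ses_retraction ER ss sE.
  have ids : @is_shom _ _ (Res X) (Res X) (fun x => x) by exact: shom_id.
  (* The counit Ind Res X -> X is onto the projective X, hence has a section [j]. Relative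
     injectivity extends [j] to P, and the counit turns the extension into a retraction of X ->
     P. *)
  have cs := shom_Ind_lift ids.
  have cT : shom_surj (Ind_lift (M := Res X) (fun x => x)).
    by apply: Ind_lift_surj => // x; exists x.
  have [j js jE] := proj_section pX (ess_Ind (ess_Res eX)) cs cT.
  have [h hs hE] := Ind_relatively_injective (ses_shom_l E) r0s r0i js.
  have [||t ts tE] := ses_section (r := fun p => Ind_lift (M := Res X) (fun x => x) (h p)) E.
  - exact: shom_comp cs hs.
  - by move=> x; rewrite hE jE.
  exact: (pdle_retract Ct_abelian Ct_enough ts (ses_shom_r E) tE eM pP.1 (n := 0%N)).
apply: (pdle_syzygy Ct_abelian Ct_enough E) => //; apply: IH => //; first exact: pM E pP eX.
by apply: pRM (ses_Res E) _ _; [exact: Res_proj | exact: ess_Res].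
Qed.

(** For the sequence 0 -> M -> Res Ind M -> Q -> 0, the cokernel may have dimension n + 1 while M
    still has dimension at most n: the third estimate of [pdle_ses]. *)
Lemma pdle_Ind_unit n M : ess_in C M -> (forall N, ess_in C N -> pdle C n.+1 N) ->
  pdle Ct n (Ind M) -> pdle C n M.
Proof.
move=> eM Cn pI; have eRI := ess_Res (ess_Ind eM).
have [Q eQ [q E]] := ses_cokernel C_abelian eM eRI (shom_Ind_unit M) (@Ind_unit_inj _ _ M).
have [_ _] := pdle_ses C_abelian C_proj n E eM eRI eQ.
by apply; [apply: Res_pdle => //; exact: ess_Ind | exact: Cn].
Qed.

(** Descends from k to n one step at a time; at each intermediate bound [Res M] satisfies the
    hypothesis of [pdle_descent], since n already bounds it. *)
Lemma pdle_findim n M : (forall N, ess_in C N -> pdle C n N) -> ess_in Ct M ->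
  forall k, pdle Ct k M -> pdle Ct n M.
Proof.
move=> Cn eM k pk; have [kn|/ltnW nk] := leqP k n; first exact: pdle_mono pk.
rewrite -(subnK nk) addnC in pk; elim: (k - n)%N pk => [|l IH]; first by rewrite addn0.
rewrite addnS => /pdle_descent pd; apply/IH/pd => //.
have eR := ess_Res eM; apply: (pdle_mono C_abelian _ eR (Cn _ eR)).
exact: leq_addr.
Qed.
End ChangeOfRings.

(** * Extended-real dimensions and the comparison theorem *)

Section Dimensions.
Variables (R : realType) (L : lieSuper R[i]) (A : supermod L -> Prop).
Hypothesis A_abelian : abelian_subcat A.
Hypothesis A_enough : enough_projectives A.
Local Open Scope ereal_scope.

Let res n M (AM : A M) := has_proj_resolutionE A_abelian A_enough n (ess_in_self AM).

Lemma projdim_le n M : A M -> pdle A n M -> projdim (R := R) A M <= n%:R%:E.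
Proof. by move=> AM pM; apply: ereal_inf_lbound; exists n => //; apply/res. Qed.

Lemma projdim_ge n M : A M -> (forall m, pdle A m M -> (n <= m)%N) ->
  n%:R%:E <= projdim (R := R) A M.
Proof.
move=> AM nM; apply: le_ereal_inf_tmp => _ [m /res pm <-].
by rewrite lee_fin ler_nat; apply/nM/pm.
Qed.

Lemma projdim_fin M : A M -> projdim (R := R) A M < +oo -> exists n, pdle A n M.
Proof. by move=> AM /ereal_inf_lt [_ [n /res pn <-] _]; exists n; apply: pn. Qed.

Lemma gldim_le_pdle n M : A M -> gldim (R := R) A <= n%:R%:E -> pdle A n M.
Proof.
move=> AM gn; have : projdim (R := R) A M < n.+1%:R%:E.
  apply: (@le_lt_trans _ _ n%:R%:E); last by rewrite lte_fin ltr_nat.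
  by apply: le_trans gn; apply: ereal_sup_ubound; exists M.
move=> /ereal_inf_lt [_ [m /res pm <-]]; rewrite lte_fin ltr_nat ltnS => mn.
by apply: (pdle_mono A_abelian mn (ess_in_self AM)); apply: pm.
Qed.
End Dimensions.

Theorem theorem12 (R : realType) (g : lieSuper R[i]) (g_classical : classical g)
    (Ct : supermod g -> Prop) (C : supermod (even_part g) -> Prop)
    (Ct_abelian : abelian_subcat Ct) (C_abelian : abelian_subcat C)
    (C_Ind : forall M : supermod (even_part g), C M -> ess_in Ct (Ind M))
    (C_Coind : forall M : supermod (even_part g), C M -> ess_in Ct (Coind M))
    (Ct_Res : forall N : supermod g, Ct N -> ess_in C (Res N))
    (C_inj : enough_injectives C) (C_proj : enough_projectives C)
    (C_gldim : (gldim C < +oo)%E) :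
  findim Ct = gldim C.
Proof.
have Ct_enough := Ct_enough C_Ind Ct_Res C_proj.
pose bounded n := `[< forall N, ess_in C N -> pdle C n N >].
have ess_pdle n : (forall N, C N -> pdle C n N) -> bounded n.
  move=> Cn; apply/asboolP => M /[dup] eM /ess_in_inv [N CN [f [h [fs hs hf fh]]]].
  exact: (pdle_retract C_abelian C_proj hs fs fh eM (ess_in_self CN) (Cn N CN)).
have [n0 n0P] : exists n, bounded n.
  have [n gn] : exists n : nat, (gldim C <= n%:R%:E)%E.
    (* A value of minus infinity is bounded by 0; a real value is bounded by a natural number above
       it. *)
    case: (gldim C) C_gldim => [r _|//|_]; last by exists 0%N; rewrite leNye.
    exists (Num.Def.truncn r).+1; rewrite lee_fin; exact/ltW/truncnS_gt.
  by exists n; apply: ess_pdle => N CN; exact: gldim_le_pdle gn.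
have {n0 n0P} [n /asboolP nP n_min] : exists2 n, bounded n & forall m, bounded m -> (n <= m)%N.
  by exists (ex_minn (ex_intro _ n0 n0P)); case: ex_minnP.
have [Z pZ _] := zero_projective C_abelian.
have [Zt pZt _] := zero_projective Ct_abelian.
have gldimE : gldim C = n%:R%:E.
  apply/eqP; rewrite eq_le; apply/andP; split.
    by apply: ge_ereal_sup => _ [N CN ->]; apply: projdim_le => //; apply/nP/ess_in_self.
  (* For n = 0 any object bounds the supremum below by 0, and the zero object is at hand. Otherwise
     minimality of n yields an object that violates the previous bound. *)
  case: n nP n_min => [|n] nP n_min.
    apply: (@le_trans _ _ (projdim C Z)); last first.
      by apply: ereal_sup_ubound; exists Z => //; case: pZ.
    by apply: projdim_ge => //; case: pZ.
  have [N CN pN] : exists2 N, C N & ~ pdle C n N.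
    apply: contrapT => nN; suff /n_min : bounded n by rewrite ltnn.
    by apply: ess_pdle => N CN; apply: contrapT => pN; apply: nN; exists N.
  apply: (@le_trans _ _ (projdim C N)); last by apply: ereal_sup_ubound; exists N.
  apply: projdim_ge => // m pm; rewrite ltnNge; apply/negP => mn; apply: pN.
  exact: (pdle_mono C_abelian mn (ess_in_self CN)).
rewrite gldimE; apply/eqP; rewrite eq_le; apply/andP; split.
  apply: ge_ereal_sup => _ [N [CN Nfin] ->].
  have [k pk] := projdim_fin Ct_abelian Ct_enough CN Nfin.
  apply: projdim_le => //.
  exact: (pdle_findim Ct_abelian C_abelian C_Ind C_Coind Ct_Res C_proj nP (ess_in_self CN) pk).
case: n nP n_min gldimE => [|n] nP n_min gldimE.
  apply: (@le_trans _ _ (projdim Ct Zt)); first by apply: projdim_ge => //; case: pZt.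
  apply: ereal_sup_ubound; exists Zt => //; split; first by case: pZt.
  apply: (@le_lt_trans _ _ 0%:R%:E); last exact: ltry.
  by apply: (projdim_le Ct_abelian Ct_enough); [case: pZt | exact: projective_in_proj].
have [N CN pN] : exists2 N, C N & ~ pdle C n N.
  apply: contrapT => nN; suff /n_min : bounded n by rewrite ltnn.
  by apply: ess_pdle => N CN; apply: contrapT => pN; apply: nN; exists N.
have eN := ess_in_self CN.
(* [Ind N] belongs to [Ct] only up to isomorphism; [M] is the object that enters the supremum. *)
have [M CM [f [h [fs hs hf fh]]]] := ess_in_inv (C_Ind N CN).
have eM := ess_in_self CM; have eI := C_Ind N CN.
have pM : pdle Ct n.+1 M.
  apply: (pdle_retract Ct_abelian Ct_enough fs hs hf eM eI).
  exact: (Ind_pdle Ct_abelian C_abelian C_Ind Ct_Res C_proj eN (nP N eN)).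
apply: (@le_trans _ _ (projdim Ct M)); last first.
  apply: ereal_sup_ubound; exists M => //; split=> //.
  by apply: (@le_lt_trans _ _ n.+1%:R%:E); [exact: projdim_le | exact: ltry].
(* A bound of at most n on [M] would carry over to [Ind N], and through the unit to [N], against the
   choice of [N]. *)
apply: projdim_ge => // m pm; rewrite ltnNge; apply/negP => mn; apply: pN.
apply: (pdle_Ind_unit Ct_abelian C_abelian C_Ind C_Coind Ct_Res C_proj eN nP).
apply: (pdle_retract Ct_abelian Ct_enough hs fs fh eI eM).
exact: (pdle_mono Ct_abelian mn eM).
Qed.
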